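(* Let $d\ge 1$, $\tau>2$, $0<\alpha<d$ and $\sigma\in(0,\tau-1)$. Let $\mathbf{A}_N$ be the scaled adjacency matrix of the kernel-based random graph $\mathbb{G}_N$ on $\mathbf{V}_N=\{1,\dots,N\}^d$ with parameters $(d,\tau,\alpha,\sigma)$, and let $\mathrm{ESD}(\mathbf{A}_N)$ be its empirical spectral distribution. Then there exists a deterministic probability measure $\mu_{\sigma,\tau}$ on $\mathbb{R}$ such that $$\lim_{N\to\infty}\mathrm{ESD}(\mathbf{A}_N)=\mu_{\sigma,\tau}\qquad\text{in }\mathbb{P}\text{-probability}.$$
   Context: Notation: $a\wedge b=\min(a,b)$, $a\vee b=\max(a,b)$. The vertex set $\mathbf{V}_N=\{1,\dots,N\}^d$ carries the torus distance $\|i-j\|=\sum_{\ell=1}^d |i_\ell-j_\ell|\wedge(N-|i_\ell-j_\ell|)$. The weights $(W_i)_{i\in\mathbf{V}_N}$ are i.i.d. Pareto with parameter $\tau-1$: $\mathbf{P}(W>t)=t^{-(\tau-1)}$ for $t\ge 1$ and $\mathbf{P}(W>t)=1$ for $t<1$. The kernel is $\kappa_\sigma(w,v)=(w\vee v)(w\wedge v)^\sigma$. Conditionally on the weights, each pair of distinct vertices $i,j$ is joined by an undirected edge independently of the other pairs with probability $p_{ij}=\frac{\kappa_\sigma(W_i,W_j)}{\|i-j\|^\alpha}\wedge 1$; there are no self-loops. The resulting random graph is $\mathbb{G}_N$, and $\mathbb{P}$ denotes the joint law of weights and edges. Let $\mathbb{A}_{\mathbb{G}_N}$ be the $N^d\times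 N^d$ (0/1) adjacency matrix, $c_N=\frac{1}{N^d}\sum_{i\ne j\in\mathbf{V}_N}\|i-j\|^{-\alpha}$, and $\mathbf{A}_N=\mathbb{A}_{\mathbb{G}_N}/\sqrt{c_N}$. The empirical spectral distribution is $\mathrm{ESD}(\mathbf{A}_N)=\frac{1}{N^d}\sum_{i=1}^{N^d}\delta_{\lambda_i}$, with $\lambda_i$ the eigenvalues of $\mathbf{A}_N$. For random probability measures $\mu_N$ and a probability measure $\mu_0$ on $\mathbb{R}$, $\lim_N\mu_N=\mu_0$ in $\mathbb{P}$-probability means $\lim_N\mathbb{P}(d_L(\mu_N,\mu_0)>\varepsilon)=0$ for every $\varepsilon>0$, where $d_L(\mu,\nu)=\inf\{\varepsilon>0:\mu(A)\le\nu(A^\varepsilon)+\varepsilon\text{ and }\nu(A)\le\mu(A^\varepsilon)+\varepsilon\ \forall A\in\mathcal{B}(\mathbb{R})\}$ is the Lévy–Prokhorov distance and $A^\varepsilon$ is the $\varepsilon$-neighbourhood of $A$. *)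

(* Defs.v *)
From HB Require Import structures.
From mathcomp Require Import all_boot all_order all_algebra.
From mathcomp Require Import all_classical all_reals all_analysis.
From mathcomp.real_closed Require complex.
Set Implicit Arguments.
Unset Strict Implicit.
Unset Printing Implicit Defensive.
Import Order.TTheory GRing.Theory Num.Theory.
Import numFieldNormedType.Exports.
Local Open Scope classical_set_scope.
Local Open Scope ring_scope.

(* Coordinates run over {0, ..., N-1} instead of {1, ..., N}: only coordinate
   differences matter. *)
Notation vertex d N := {ffun 'I_d -> 'I_N}.

Definition torus_dist (d N : nat) (i j : vertex d N) : nat :=
  (\sum_(l < d) minn `|i l - j l| (N - `|i l - j l|))%N.

Section kernel.
Context {R : realType}.

Definition kernel (sigma w v : R) : R :=
  Num.max w v * (Num.min w v) `^ sigma.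

Definition edge_prob (d N : nat) (alpha sigma : R) (W : vertex d N -> R)
    (i j : vertex d N) : R :=
  Num.min (kernel sigma (W i) (W j) / (torus_dist i j)%:R `^ alpha) 1.

Definition scaling (d N : nat) (alpha : R) : R :=
  ((N ^ d)%:R)^-1 *
  \sum_(p : vertex d N * vertex d N | p.1 != p.2)
     (torus_dist p.1 p.2)%:R `^ (- alpha).

End kernel.

Section random_graph.
Context {R : realType} {disp : measure_display} {T : measurableType disp}.
Variable P : probability T R.

Definition pareto (X : {RV P >-> R}) (s : R) : Prop :=
  forall t : R, P [set w | t < X w] =
    if 1 <= t then (t `^ (- s))%:E else 1%:E.

(* Letting some B i be the full set gives the product rule for subfamilies. *)
Definition independent_RVs (I : finType) (X : I -> {RV P >-> R}) : Prop :=
  forall B : I -> set R, (forall i, measurable (B i)) ->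
    P (\bigcap_(i in [set: I]) X i @^-1` B i) =
    (\prod_(i : I) fine (P (X i @^-1` B i)))%:E.

Definition generated_salgebra (I : finType) (X : I -> {RV P >-> R}) :
    set (set T) :=
  <<s [set A | exists i : I, exists2 B : set R,
          measurable B & A = X i @^-1` B] >>.

(* Each unordered pair of distinct elements, exactly once. *)
Definition upair (I : finType) : pred (I * I) :=
  fun p => (enum_rank p.1 < enum_rank p.2)%N.

(* The last clause says that the conditional law of the graph given the
   weights is the product of the Bernoulli(p_ij): for every g, a version of
   the conditional probability of {graph = g} given sigma(W) is
   \prod_{ij in g} p_ij * \prod_{ij notin g} (1 - p_ij). *)
Record kernel_random_graph (d N : nat) (tau alpha sigma : R)
    (W : vertex d N -> {RV P >-> R}) (adj : T -> rel (vertex d N)) : Prop := {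
  weight_pareto : forall i, pareto (W i) (tau - 1);
  weight_indep : independent_RVs W;
  adj_sym : forall w, symmetric (adj w);
  adj_irr : forall w, irreflexive (adj w);
  adj_measurable : forall i j, measurable [set w | adj w i j];
  adj_cond_law : forall (g : rel (vertex d N)) (A : set T),
    generated_salgebra W A ->
    P (A `&` [set w | forall p, upair p -> adj w p.1 p.2 = g p.1 p.2]) =
    (\int[P]_(w in A) (\prod_(p : vertex d N * vertex d N | upair p)
       let q := edge_prob alpha sigma (fun k => W k w) p.1 p.2 in
       if g p.1 p.2 then q else 1 - q)%:E)%E
}.

End random_graph.

Section spectrum.
Context {R : realType}.

Definition adjacency (I : finType) (e : rel I) : 'M[R]_#|I| :=
  \matrix_(i, j) (e (enum_val i) (enum_val j))%:R.

Definition scaled_adjacency (d N : nat) (alpha : R) (e : rel (vertex d N)) :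
    'M[R]_#|{: vertex d N}| :=
  (Num.sqrt (scaling d N alpha))^-1 *: adjacency e.

(* Eigenvalues counted with algebraic multiplicity, in some order.  Such a
   sequence exists as soon as A is symmetric, see eigenvaluesP. *)
Definition eigenvalues (n : nat) (A : 'M[R]_n) : seq R :=
  xget [::] [set s | char_poly A = \prod_(x <- s) ('X - x%:P)].

Import complex.

Lemma eigenvaluesP (n : nat) (A : 'M[R]_n) : A^T = A ->
  char_poly A = \prod_(x <- eigenvalues A) ('X - x%:P).
Proof.
move=> symA; pose B : 'M[R[i]]_n := map_mx (real_complex R) A.
have realB : B \is a mxOver Num.real.
  by apply/mxOverP => i j; rewrite mxE complex_real.
have hermB : B \is hermsymmx.
  apply: realsym_hermsym realB.
  apply/is_hermitianmxP; rewrite expr0 scale1r map_mx_id// ?trmxK.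
  by rewrite /B -[in LHS]symA map_trmx.
have /orthomx_spectralP defB := hermitian_normalmx hermB.
have /mxOverP realD := hermitian_spectral_diag_real hermB.
have charB : char_poly B = \prod_(i < n) ('X - (spectral_diag B 0 i)%:P).
  have -> : char_poly B = char_poly (diag_mx (spectral_diag B)).
    set S := spectralmx B in defB; set D := diag_mx _ in defB *.
    have Su : S \in unitmx by apply: spectral_unit.
    rewrite /char_poly.
    have -> : char_poly_mx B =
        map_mx polyC (invmx S) *m char_poly_mx D *m map_mx polyC S.
      rewrite /char_poly_mx mulmxBr mulmxBl -!map_mxM -defB; congr (_ - _).
      by rewrite mul_mx_scalar -scalemxAl -map_mxM mulVmx// map_mx1 scalemx1.
    rewrite !det_mulmx mulrAC -det_mulmx -map_mxM mulVmx// map_mx1 det1.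
    by rewrite mul1r.
  rewrite char_poly_trig; last exact/diag_mx_is_trig.
  by apply: eq_bigr => i _; rewrite mxE eqxx.
suff H : char_poly A =
    \prod_(x <- [seq complex.Re (spectral_diag B 0 i) | i : 'I_n]) ('X - x%:P).
  by rewrite /eigenvalues; case: xgetP => [//|/(_ _ H)].
apply: (map_poly_inj (real_complex R)).
rewrite map_char_poly/= -/B charB rmorph_prod big_image/=.
apply: eq_bigr => i _; rewrite rmorphB/= map_polyX map_polyC/=.
by congr ('X - _%:P); rewrite RRe_real.
Qed.

Definition esd (n : nat) (A : 'M[R]_n) :
    {measure set (measurableTypeR R) -> \bar R} :=
  mscale (n%:R^-1)%:nng (msum (fun k : nat =>
    \d_((eigenvalues A)`_k : measurableTypeR R)) n).

Lemma esdT n (A : 'M[R]_n) : (0 < n)%N -> esd A setT = 1%E.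
Proof.
move=> n0; rewrite /esd /= /mscale /= /msum /=.
rewrite (eq_bigr (fun=> 1%E)) => [|k _]; last by rewrite diracT.
by rewrite sumEFin sumr_const card_ord -EFinM mulVf ?pnatr_eq0 -?lt0n.
Qed.

End spectrum.

Section weak_convergence.
Context {R : realType}.

Definition eps_nbhd (B : set R) (e : R) : set R :=
  [set x | exists2 y, B y & `|x - y| < e].

Definition levy_prokhorov
    (mu nu : {measure set (measurableTypeR R) -> \bar R}) : R :=
  inf [set e : R | 0 < e /\
    forall B : set (measurableTypeR R), measurable B ->
      (mu B <= nu (eps_nbhd B e) + e%:E)%E /\
      (nu B <= mu (eps_nbhd B e) + e%:E)%E].

Definition cvg_in_probability (disp : nat -> measure_display)
    (T : forall N, measurableType (disp N)) (P : forall N, probability (T N) R)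
    (mu : forall N, T N -> {measure set (measurableTypeR R) -> \bar R})
    (mu0 : {measure set (measurableTypeR R) -> \bar R}) : Prop :=
  forall eps : R, 0 < eps ->
    (fun N : nat => P N [set w | eps < levy_prokhorov (mu N w) mu0])
      @ \oo --> 0%E.

End weak_convergence.

(* Main.v *)
(* With W frozen, A_N is a symmetric matrix with independent Bernoulli entries of
   means p_ij.  Fix m, keep only the edges between vertices of weight at most m,
   and center them.  This costs in mean squared Hilbert-Schmidt norm (divided by
   the dimension) at most the kernel mass of the heavy pairs, which decays like a
   power of m because tau - 1 > max(1, sigma), plus a term of order
   1/N^d sum c_N s_ij^2 -> 0, where s_ij = |i-j|^-alpha / c_N has row sums 1.

   For the centered matrix, resolvent expansion and the Efron-Stein inequality give
   an approximate quadratic vector equation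
     z u_i + 1 + u_i sum_j s_ij kappa(W_i, W_j) u_j = o(1),  u_i = E G_ii(z), Im z large.
   Weights are discretized into finitely many types; the torus rows s_i. average the
   type indicators to their means, so u_i is close to a Picard iterate depending only
   on the type of i, the same for all d, alpha and N.  Hence Tr G / N^d has a
   universal limit for Im z large.

   The closed linear span of 1, 1/(x^2+y^2), x/(x^2+y^2), y >= y0, is an algebra that
   contains the generators for all y >= 1, which transfers the statement from the
   truncated matrix to A_N, and approximates ramps up to e (1 + x^2).  As E Tr A_N^2 / N^d
   stays bounded, the averages of ramps over the spectrum have deterministic limits,
   from which the limiting distribution function is read off. *)
From HB Require Import structures.
From mathcomp Require Import all_boot all_order all_algebra.
From mathcomp.real_closed Require complex.
From mathcomp Require Import boolp reals ring lra zify.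
Set Implicit Arguments.
Unset Strict Implicit.
Unset Printing Implicit Defensive.
Import Order.TTheory GRing.Theory Num.Theory.
Local Open Scope ring_scope.

(** * Independent Bernoulli variables *)

(** The contraction of the limit equation needs [2 * M <= y ^+ 2], where [M] is the kernel at the
    truncation level [m]. The usable values of [y] thus recede as [m] grows, whereas truncation can
    only be removed for test functions fixed in advance. Closing the span of the resolvent functions
    under uniform limits takes the place of analytic continuation and restores all [y >= 1]. The
    limit equation is never solved exactly. For each tolerance, finitely many Picard steps on
    finitely many types give a number [l] close to the statistic, fixed before the dimension,
    [alpha] and the probability space. Exact limits are recovered afterwards as suprema, and they
    are compared with each other on one large model. Stability is proved in the mean over vertices,
    because the kernel errors and the deviations of the type frequencies are estimated in mean. With
    frozen weights the graph is a point of a finite set, so the spectral estimates are finite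
    weighted sums. Measure theory enters when the weights are integrated, over the full event that
    all of them exceed 1. *)

Section bernoulli_product.
Variables (K : comNzRingType) (E : finType) (q : E -> K).
Implicit Types (f g : {ffun E -> bool} -> K) (w : {ffun E -> bool}) (e : E).

Definition bern (p : K) (b : bool) : K := if b then p else 1 - p.

Definition bweight w : K := \prod_e bern (q e) (w e).

(** The ring is arbitrary so that one set of identities serves real and complex functions; order
    enters only with real parameters in [0, 1]. *)
Definition Ex f : K := \sum_w bweight w * f w.

Definition upd w e (b : bool) : {ffun E -> bool} :=
  [ffun e' => if e' == e then b else w e'].

Definition avg e f w : K :=
  q e * f (upd w e true) + (1 - q e) * f (upd w e false).

Definition jump e f w : K := f (upd w e true) - f (upd w e false).

Lemma updE w e b e' : upd w e b e' = if e' == e then b else w e'.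
Proof. by rewrite ffunE. Qed.

Lemma upd_id w e : upd w e (w e) = w.
Proof. by apply/ffunP => e'; rewrite ffunE; case: eqP => // ->. Qed.

Lemma upd_upd w e b b' : upd (upd w e b) e b' = upd w e b'.
Proof. by apply/ffunP => e'; rewrite !ffunE; case: eqP. Qed.

Lemma updC w e e' b b' : e != e' ->
  upd (upd w e b) e' b' = upd (upd w e' b') e b.
Proof.
move=> ne; apply/ffunP => x; rewrite !ffunE.
by case: eqP => // ->; rewrite eq_sym (negbTE ne).
Qed.

Lemma sum_bweight : \sum_w bweight w = 1.
Proof.
rewrite /bweight -(bigA_distr_bigA (fun e b => bern (q e) b)).
by rewrite big1// => e _; rewrite big_bool /bern/= addrC subrK.
Qed.

Lemma Ex_cst c : Ex (fun=> c) = c.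
Proof. by rewrite /Ex -mulr_suml sum_bweight mul1r. Qed.

Lemma ExD f g : Ex (fun w => f w + g w) = Ex f + Ex g.
Proof. by rewrite /Ex -big_split; apply: eq_bigr => w _; rewrite mulrDr. Qed.

Lemma ExZ c f : Ex (fun w => c * f w) = c * Ex f.
Proof. by rewrite /Ex mulr_sumr; apply: eq_bigr => w _; rewrite mulrCA. Qed.

Lemma ExN f : Ex (fun w => - f w) = - Ex f.
Proof. by rewrite /Ex -sumrN; apply: eq_bigr => w _; rewrite mulrN. Qed.

Lemma ExB f g : Ex (fun w => f w - g w) = Ex f - Ex g.
Proof. by rewrite ExD ExN. Qed.

Lemma Ex_sum (I : Type) (r : seq I) (P : pred I) (F : I -> {ffun E -> bool} -> K) :
  Ex (fun w => \sum_(i <- r | P i) F i w) = \sum_(i <- r | P i) Ex (F i).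
Proof.
rewrite /Ex exchange_big/=; apply: eq_bigr => w _.
by rewrite mulr_sumr.
Qed.

Lemma eq_Ex f g : f =1 g -> Ex f = Ex g.
Proof. by move=> fg; apply: eq_bigr => w _; rewrite fg. Qed.

Lemma bweight_upd w e b :
  bweight (upd w e b) = bern (q e) b * \prod_(e' | e' != e) bern (q e') (w e').
Proof.
rewrite /bweight (bigD1 e)//= updE eqxx; congr (_ * _).
by apply: eq_bigr => e' ne; rewrite updE (negbTE ne).
Qed.

Lemma sum_upd f e :
  \sum_w f w = \sum_(w : {ffun E -> bool} | w e)
    (f (upd w e true) + f (upd w e false)).
Proof.
rewrite (bigID (fun w : {ffun E -> bool} => w e))/= big_split/=; congr (_ + _).
  by apply: eq_bigr => w we; rewrite -{1}(upd_id w e) we.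
rewrite (reindex_onto (fun w => upd w e false) (fun w => upd w e true))/=;
  last by move=> w /negbTE we; rewrite upd_upd -{1}we upd_id.
apply: eq_bigl => w; rewrite updE eqxx upd_upd/=.
by apply/eqP/idP => [<-|we]; rewrite ?updE ?eqxx// -{1}we upd_id.
Qed.

Lemma Ex_avg f e : Ex (avg e f) = Ex f.
Proof.
rewrite /Ex (sum_upd _ e) [RHS](sum_upd _ e); apply: eq_bigr => w we.
rewrite /avg !upd_upd !bweight_upd /bern; ring.
Qed.

(** Discrete integration by parts: on the two values of coordinate [e] the centered variable carries
    the masses [q e * (1 - q e)] and its opposite, so only the difference of [f] survives. The
    identity is exact, with no Taylor remainder. *)
Lemma Ex_centered e f :
  Ex (fun w => ((w e)%:R - q e) * f w) = q e * (1 - q e) * Ex (jump e f).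
Proof.
rewrite -(Ex_avg _ e) -ExZ; apply: eq_Ex => w.
rewrite /avg /jump !updE eqxx/=; ring.
Qed.

Lemma avg_jumpC e e' f : e != e' -> avg e (jump e' f) =1 jump e' (avg e f).
Proof.
move=> ne w; rewrite /avg /jump !(updC _ _ _ ne); ring.
Qed.

End bernoulli_product.

Section bernoulli_real.
Variables (R : realFieldType) (E : finType) (q : E -> R).
Hypothesis q01 : forall e, 0 <= q e <= 1.
Implicit Types (f g : {ffun E -> bool} -> R) (w : {ffun E -> bool}) (e : E).

Lemma bweight_ge0 w : 0 <= bweight q w.
Proof.
apply: prodr_ge0 => e _; rewrite /bern; case: ifP => _.
  by case/andP: (q01 e).
by rewrite subr_ge0; case/andP: (q01 e).
Qed.

Lemma le_Ex f g : (forall w, f w <= g w) -> Ex q f <= Ex q g.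
Proof.
by move=> fg; apply: ler_sum => w _; rewrite ler_wpM2l ?bweight_ge0.
Qed.

Lemma Ex_ge0 f : (forall w, 0 <= f w) -> 0 <= Ex q f.
Proof. by move=> f0; apply: sumr_ge0 => w _; rewrite mulr_ge0 ?bweight_ge0. Qed.

Lemma Ex_le_cst f c : (forall w, f w <= c) -> Ex q f <= c.
Proof. by move=> fc; rewrite -(Ex_cst q c); apply: le_Ex. Qed.

Lemma Ex_sqr f : Ex q f ^+ 2 <= Ex q (fun w => f w ^+ 2).
Proof.
have : 0 <= Ex q (fun w => (f w - Ex q f) ^+ 2).
  by apply: Ex_ge0 => w; apply: sqr_ge0.
rewrite (@eq_Ex _ _ _ _ (fun w => f w ^+ 2 - 2 * Ex q f * f w + Ex q f ^+ 2)).
  rewrite ExD ExB ExZ Ex_cst; set a := Ex _ _; set b := Ex _ _; nra.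
by move=> w; ring.
Qed.

Lemma sqr_avg_le e f w : avg q e f w ^+ 2 <= avg q e (fun w => f w ^+ 2) w.
Proof.
rewrite /avg; set a := f _; set b := f _; have /andP[] := q01 e.
set p := q e => p0 p1; rewrite -subr_ge0.
have -> : p * a ^+ 2 + (1 - p) * b ^+ 2 - (p * a + (1 - p) * b) ^+ 2 =
  p * (1 - p) * (a - b) ^+ 2 by ring.
by rewrite mulr_ge0 ?sqr_ge0// mulr_ge0// subr_ge0.
Qed.

Lemma avg_var e f w :
  avg q e (fun w => f w ^+ 2) w - avg q e f w ^+ 2 =
  q e * (1 - q e) * jump e f w ^+ 2.
Proof. by rewrite /avg /jump; ring. Qed.

(** The conditional expectation of [f] given the coordinates outside [r]. *)
Let avgs (r : seq E) f := foldr (avg q) f r.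

Lemma avgs_upd r f e b : e \in r ->
  forall w, avgs r f (upd w e b) = avgs r f w.
Proof.
elim: r => //= e' r IH; rewrite inE; have [<- _|ne /= er] := eqVneq e e'.
  by move=> w; rewrite /avg !upd_upd.
by move=> w; rewrite /avg !(updC _ _ _ ne) !(IH er).
Qed.

(** The coordinates of [w] are changed into those of [w'] one at a time; a coordinate already
    averaged out may be changed freely. *)
Lemma avgs_cst f w w' : avgs (enum E) f w = avgs (enum E) f w'.
Proof.
have H r : {subset r <= enum E} -> forall u : {ffun E -> bool},
    avgs (enum E) f (foldr (fun e u => upd u e (w' e)) u r) = avgs (enum E) f u.
  elim: r => //= e r IH sub u; rewrite avgs_upd ?IH ?mem_enum//.
  by move=> x xr; apply: sub; rewrite inE xr orbT.
rewrite -(H (enum E) _ w)//; congr (avgs _ _ _); apply/ffunP => x.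
have : x \in enum E by rewrite mem_enum.
elim: (enum E) => //= e r IH; rewrite inE updE; have [->//|ne /= xr] := eqVneq.
exact: IH.
Qed.

Lemma Ex_avgs r f : Ex q (avgs r f) = Ex q f.
Proof. by elim: r => //= e r IH; rewrite Ex_avg. Qed.

Lemma avgsE f w : avgs (enum E) f w = Ex q f.
Proof.
rewrite -(Ex_avgs (enum E) f) -[LHS](Ex_cst q); apply: eq_Ex => w'.
exact: avgs_cst.
Qed.

(** Averaging over another coordinate commutes with the difference along [e], and by Jensen it can
    only decrease the mean square. *)
Lemma jump_avgs e r f : e \notin r ->
  Ex q (fun w => jump e (avgs r f) w ^+ 2) <= Ex q (fun w => jump e f w ^+ 2).
Proof.
elim: r => //= e' r IH; rewrite inE negb_or => /andP[ne er].
apply: le_trans (IH er).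
rewrite -[leRHS](Ex_avg _ _ e'); apply: le_Ex => w.
rewrite -avg_jumpC 1?eq_sym//; exact: sqr_avg_le.
Qed.

(** The variance telescopes along the coordinates: averaging out [e] costs exactly the conditional
    variance [q e * (1 - q e) * jump ^+ 2] of the function averaged so far, and [jump_avgs] returns
    from that function to [f]. *)
Theorem efron_stein f :
  Ex q (fun w => f w ^+ 2) - Ex q f ^+ 2 <=
  \sum_e q e * (1 - q e) * Ex q (fun w => jump e f w ^+ 2).
Proof.
have /(_ (enum E)) H r : uniq r ->
    Ex q (fun w => f w ^+ 2) - Ex q (fun w => avgs r f w ^+ 2) <=
    \sum_(e <- r) q e * (1 - q e) * Ex q (fun w => jump e f w ^+ 2).
  elim: r => [|e r IH /= /andP[er ur]]; first by rewrite big_nil subrr.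
  rewrite big_cons; apply: le_trans (lerD _ (IH ur)); last first.
    have /andP[q0 q1] := q01 e.
    apply: ler_wpM2l (jump_avgs f er).
    by rewrite mulr_ge0// subr_ge0.
  rewrite -ExZ (eq_Ex _ (fun w => esym (avg_var e (avgs r f) w))).
  rewrite ExB Ex_avg; lra.
have := H (enum_uniq _); rewrite big_enum/=; apply: le_trans.
rewrite lerD2l lerN2 (@eq_Ex _ _ _ _ (fun=> Ex q f ^+ 2)) ?Ex_cst//.
by move=> w; rewrite avgsE.
Qed.

End bernoulli_real.

(** * Resolvents of real symmetric matrices *)

Section complex_modulus.
Import complex ComplexField.Normc.
Local Open Scope complex_scope.
Variable R : rcfType.
Implicit Types (x y : R[i]).

(** The norm on [R[i]] is itself complex-valued; a real-valued modulus lets the estimates be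
    combined by real arithmetic. *)
Definition modc x : R := Num.sqrt (Re x ^+ 2 + Im x ^+ 2).

Lemma modcE x : modc x = normc x. Proof. by case: x. Qed.

Lemma modc_ge0 x : 0 <= modc x. Proof. exact: sqrtr_ge0. Qed.

Lemma modc_sqr x : modc x ^+ 2 = Re x ^+ 2 + Im x ^+ 2.
Proof. by rewrite sqr_sqrtr// addr_ge0 ?sqr_ge0. Qed.

Lemma modc0 : modc 0 = 0. Proof. by rewrite modcE normc0. Qed.

Lemma modcM x y : modc (x * y) = modc x * modc y.
Proof. by rewrite !modcE normcM. Qed.

Lemma modcV x : modc x^-1 = (modc x)^-1.
Proof. by rewrite !modcE normcV. Qed.

Lemma modcN x : modc (- x) = modc x.
Proof. by rewrite !modcE normcN. Qed.

Lemma modcD x y : modc (x + y) <= modc x + modc y.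
Proof. by rewrite !modcE le_normcD. Qed.

Lemma modcB x y : modc (x - y) <= modc x + modc y.
Proof. by rewrite -(modcN y) modcD. Qed.

Lemma modcBC x y : modc (x - y) = modc (y - x).
Proof. by rewrite -modcN opprB. Qed.

Lemma modc_real (a : R) : modc a%:C = `|a|.
Proof. by rewrite /modc/= expr0n/= addr0 sqrtr_sqr. Qed.

Lemma modc_eq0 x : modc x = 0 -> x = 0.
Proof. by rewrite modcE => /eq0_normc. Qed.

Lemma modc_gt0 x : x != 0 -> 0 < modc x.
Proof.
move=> x0; rewrite lt_def modc_ge0 andbT.
by apply: contra x0 => /eqP/modc_eq0 ->.
Qed.

Lemma modc_ge_Re x : `|Re x| <= modc x.
Proof.
by rewrite -sqrtr_sqr ler_wsqrtr// lerDl sqr_ge0.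
Qed.

Lemma modc_ge_Im x : `|Im x| <= modc x.
Proof.
by rewrite -sqrtr_sqr ler_wsqrtr// lerDr sqr_ge0.
Qed.

Lemma modc_sum (I : Type) (r : seq I) (P : pred I) (F : I -> R[i]) :
  modc (\sum_(i <- r | P i) F i) <= \sum_(i <- r | P i) modc (F i).
Proof.
elim/big_rec2: _ => [|i a b _ ab]; first by rewrite modc0.
by apply: (le_trans (modcD _ _)); rewrite lerD2l.
Qed.

Lemma Re_sum (I : Type) (r : seq I) (P : pred I) (F : I -> R[i]) :
  Re (\sum_(i <- r | P i) F i) = \sum_(i <- r | P i) Re (F i).
Proof. exact: (raddf_sum (@Re R : Rcomplex R -> R)). Qed.

Lemma Im_sum (I : Type) (r : seq I) (P : pred I) (F : I -> R[i]) :
  Im (\sum_(i <- r | P i) F i) = \sum_(i <- r | P i) Im (F i).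
Proof. exact: (raddf_sum (@Im R : Rcomplex R -> R)). Qed.

Lemma Re_realM (a : R) x : Re (a%:C * x) = a * Re x.
Proof. by case: x => u v /=; rewrite mul0r subr0. Qed.

Lemma Im_realM (a : R) x : Im (a%:C * x) = a * Im x.
Proof. by case: x => u v /=; rewrite mul0r addr0. Qed.

Lemma mulc_conj x : x * x^* = (modc x ^+ 2)%:C.
Proof. by rewrite modc_sqr; case: x => a b; simpc; congr (_ +i* _); ring. Qed.

Lemma modc_conj x : modc x^* = modc x.
Proof. by case: x => a b; rewrite /modc/= sqrrN. Qed.

End complex_modulus.

Lemma invmx_uniq (F : comUnitRingType) (n : nat) (A B : 'M[F]_n) :
  A *m B = 1%:M -> invmx A = B.
Proof.
move=> AB; have [Au _] := mulmx1_unit AB.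
by rewrite -[LHS]mulmx1 -AB mulKmx.
Qed.

Module Resolvent.
Import complex.
Local Open Scope complex_scope.

(** The spectral parameter stays on the imaginary axis, [z = iy]; the real and imaginary parts of
    the trace then give the two families [x / (x^2 + y^2)] and [y / (x^2 + y^2)]. *)
Definition zmx (R : rcfType) (n : nat) (A : 'M[R]_n) (y : R) : 'M[R[i]]_n :=
  map_mx (real_complex R) A - ('i * y%:C)%:M.

(* Locked, since conversion tests between resolvents are prohibitively slow. *)
HB.lock Definition resolvent (R : rcfType) (n : nat) (A : 'M[R]_n) (y : R) :
  'M[R[i]]_n := invmx (zmx A y).

End Resolvent.
Import Resolvent.

Section resolvent.
Import complex.
Local Open Scope complex_scope.
Variables (R : rcfType) (n : nat).
Implicit Types (A B : 'M[R]_n) (y : R).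

(** Diagonalization and characteristic polynomial come together because [eigenvalues] is known only
    through its polynomial: a trace computed from [d] is then a sum over any list of roots. *)
Lemma symmetric_spectral A : A^T = A -> exists (S : 'M[R[i]]_n) (d : 'rV[R]_n),
  [/\ S \in unitmx,
      map_mx (real_complex R) A =
        invmx S *m diag_mx (map_mx (real_complex R) d) *m S &
      char_poly A = \prod_i ('X - (d 0 i)%:P)].
Proof.
move=> symA; pose B : 'M[R[i]]_n := map_mx (real_complex R) A.
have realB : B \is a mxOver Num.real.
  by apply/mxOverP => i j; rewrite mxE complex_real.
have hermB : B \is hermsymmx.
  apply: realsym_hermsym realB.
  apply/is_hermitianmxP; rewrite expr0 scale1r map_mx_id// ?trmxK.
  by rewrite /B -[in LHS]symA map_trmx.
have /orthomx_spectralP defB := hermitian_normalmx hermB.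
have /mxOverP realD := hermitian_spectral_diag_real hermB.
have Su : spectralmx B \in unitmx by apply: spectral_unit.
pose d : 'rV[R]_n := \row_i Re (spectral_diag B 0 i).
have dE : map_mx (real_complex R) d = spectral_diag B.
  by apply/rowP => i; rewrite !mxE RRe_real.
exists (spectralmx B), d; split; [exact: Su|by rewrite dE|].
apply: (map_poly_inj (real_complex R)).
rewrite map_char_poly/= rmorph_prod/=.
have -> : char_poly (map_mx (real_complex R) A) =
    char_poly (diag_mx (spectral_diag B)).
  rewrite -/B; set S := spectralmx B in defB Su *; set D := diag_mx _ in defB *.
  rewrite /char_poly.
  have -> : char_poly_mx B =
      map_mx polyC (invmx S) *m char_poly_mx D *m map_mx polyC S.
    rewrite /char_poly_mx mulmxBr mulmxBl -!map_mxM -defB; congr (_ - _).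
    by rewrite mul_mx_scalar -scalemxAl -map_mxM mulVmx// map_mx1 scalemx1.
  rewrite !det_mulmx mulrAC -det_mulmx -map_mxM mulVmx// map_mx1 det1.
  by rewrite mul1r.
rewrite char_poly_trig; last exact/diag_mx_is_trig.
apply: eq_bigr => i _; rewrite !mxE eqxx rmorphB/= map_polyX map_polyC/=.
by rewrite mulr1n RRe_real.
Qed.

Lemma real_sub_iy_neq0 (a y : R) : 0 < y -> a%:C - 'i * y%:C != 0.
Proof. by move=> y0; apply/eqP => -[_]; rewrite mul0r add0r mul1r; lra. Qed.

Section fixed.
Variables (A : 'M[R]_n) (y : R).
Hypotheses (symA : A^T = A) (y0 : 0 < y).
Local Notation G := (resolvent A y).

Lemma zmx_spectral (S : 'M[R[i]]_n) (d : 'rV[R]_n) : S \in unitmx ->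
  map_mx (real_complex R) A = invmx S *m diag_mx (map_mx (real_complex R) d) *m S ->
  zmx A y = invmx S *m diag_mx (\row_i ((d 0 i)%:C - 'i * y%:C)) *m S.
Proof.
move=> Su defA; rewrite /zmx defA.
have -> : diag_mx (\row_i ((d 0 i)%:C - 'i * y%:C)) =
    diag_mx (map_mx (real_complex R) d) - ('i * y%:C)%:M.
  apply/matrixP => i j; rewrite !mxE -mulrnBl.
  by case: eqP => [->|].
rewrite mulmxBr mulmxBl mul_mx_scalar -scalemxAl mulVmx//.
by rewrite scalemx1.
Qed.

Lemma zmx_unit : zmx A y \in unitmx.
Proof.
have [S [d [Su defA _]]] := symmetric_spectral symA.
rewrite (zmx_spectral Su defA) !unitmx_mul unitmx_inv Su andbT/=.
rewrite unitmxE det_diag unitfE; apply/prodf_neq0 => i _.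
by rewrite mxE real_sub_iy_neq0.
Qed.

Lemma resolvent_trace (s : seq R) : char_poly A = \prod_(x <- s) ('X - x%:P) ->
  \tr G = \sum_(x <- s) (x%:C - 'i * y%:C)^-1.
Proof.
have [S [d [Su defA chA]]] := symmetric_spectral symA.
rewrite chA -(big_map (fun i => d 0 i) xpredT (fun x => 'X - x%:P)) => eqs.
set s' := map _ _ in eqs.
rewrite (perm_big s')/=; last by apply: prod_XsubC_eq; rewrite -eqs.
rewrite big_map resolvent.unlock (zmx_spectral Su defA).
set D := diag_mx _.
pose D' : 'M[R[i]]_n := diag_mx (\row_i ((d 0 i)%:C - 'i * y%:C)^-1).
have DD' : D *m D' = 1%:M.
  rewrite mulmx_diag; apply/matrixP => i j; rewrite !mxE.
  by rewrite divff// real_sub_iy_neq0.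
have -> : invmx (invmx S *m D *m S) = invmx S *m D' *m S.
  apply: invmx_uniq; rewrite !mulmxA mulmxK//.
  by rewrite -(mulmxA _ D) DD' mulmx1 mulVmx.
rewrite mxtrace_mulC mulmxA mulmxV// mul1mx mxtrace_diag.
by apply: eq_bigr => i _; rewrite mxE.
Qed.

Lemma resolventVr : zmx A y *m G = 1%:M.
Proof. by rewrite resolvent.unlock mulmxV// zmx_unit. Qed.

Lemma trmx_resolvent : G^T = G.
Proof.
by rewrite resolvent.unlock trmx_inv /zmx linearB/= map_trmx symA tr_scalar_mx.
Qed.

Lemma resolvent_sym i j : G i j = G j i.
Proof. by rewrite -[in LHS]trmx_resolvent mxE. Qed.

Lemma resolvent_row i j :
  \sum_k (A i k)%:C * G k j - 'i * y%:C * G i j = (i == j)%:R.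
Proof.
have /matrixP/(_ i j) := resolventVr.
rewrite /zmx mulmxBl mul_scalar_mx !mxE => <-; congr (_ - _).
by apply: eq_bigr => k _; rewrite mxE.
Qed.

(* Pairing (A - iy) w = x with w and taking imaginary parts, the Hermitian
   form of A drops out. *)
Lemma Im_pairing (w x : 'cV[R[i]]_n) : zmx A y *m w = x ->
  Im (\sum_i (w i 0)^* * x i 0) = - y * \sum_i modc (w i 0) ^+ 2.
Proof.
move=> wx; pose q := \sum_i \sum_j (w i 0)^* * (A i j)%:C * w j 0.
have Eq : \sum_i (w i 0)^* * x i 0 =
    q - 'i * y%:C * (\sum_i modc (w i 0) ^+ 2)%:C.
  rewrite rmorph_sum/= mulr_sumr -sumrB; apply: eq_bigr => i _.
  rewrite -wx /zmx mulmxBl mul_scalar_mx !mxE mulrBr; congr (_ - _).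
    by rewrite mulr_sumr; apply: eq_bigr => j _; rewrite mxE mulrA.
  by rewrite -mulc_conj mulrCA; congr (_ * _); rewrite mulrC.
have qreal : q^* = q.
  rewrite /q rmorph_sum exchange_big/=; apply: eq_bigr => i _.
  rewrite rmorph_sum; apply: eq_bigr => j _.
  rewrite !rmorphM/= conjcK oppr0 -/(real_complex R _).
  have -> : A j i = A i j by rewrite -[in LHS]symA mxE.
  by rewrite mulrC mulrA mulrAC [_^* * _]mulrC mulrAC.
have Imq : Im q = 0.
  have := congr1 (@Im R) qreal; case: (q) => a b /=; lra.
rewrite Eq; set t := \sum_i _ ^+ 2.
case: (q) Imq => a b /= ->; ring.
Qed.

(** The operator bound by [1 / y], phrased for one vector: [y * |w|^2] is minus the imaginary part
    of the pairing of [w] with [x], and Young's inequality absorbs half of it. *)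
Lemma resolvent_contract (w x : 'cV[R[i]]_n) : zmx A y *m w = x ->
  \sum_i modc (w i 0) ^+ 2 <= (y ^+ 2)^-1 * \sum_i modc (x i 0) ^+ 2.
Proof.
move=> wx; have := Im_pairing wx.
set W := \sum_i modc (w i 0) ^+ 2; set X := \sum_i modc (x i 0) ^+ 2.
set t := \sum_i _ => Imt.
have : y * W <= y / 2 * W + (2 * y)^-1 * X.
  have -> : y * W = - Im t by rewrite Imt mulNr opprK.
  apply: (le_trans (ler_norm _)); rewrite normrN.
  apply: (le_trans (modc_ge_Im _)); apply: (le_trans (modc_sum _ _ _)).
  rewrite /W /X !mulr_sumr -big_split/=; apply: ler_sum => i _.
  rewrite modcM modc_conj; set a := modc _; set b := modc _.
  rewrite -subr_ge0.
  have -> : y / 2 * a ^+ 2 + (2 * y)^-1 * b ^+ 2 - a * b =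
      (y * a - b) ^+ 2 / (2 * y) by field; rewrite gt_eqF.
  by rewrite divr_ge0 ?sqr_ge0// mulr_ge0// ltW.
move=> H; have {}H : y ^+ 2 * W <= X.
  have -> : X = 2 * y * ((2 * y)^-1 * X) by field; rewrite gt_eqF.
  rewrite -subr_ge0; set T := _^-1 * X in H *.
  have -> : 2 * y * T - y ^+ 2 * W = 2 * y * (T - y / 2 * W) by field.
  by apply: mulr_ge0; [rewrite mulr_ge0// ltW|lra].
by rewrite ler_pdivlMl// exprn_gt0.
Qed.

Lemma zmx_col_resolvent i : zmx A y *m col i G = col i 1%:M.
Proof. by rewrite !colE mulmxA resolventVr. Qed.

Lemma resolvent_col i : \sum_j modc (G j i) ^+ 2 <= (y ^+ 2)^-1.
Proof.
have := resolvent_contract (zmx_col_resolvent i).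
have -> : \sum_k modc ((col i 1%:M : 'cV[R[i]]_n) k 0) ^+ 2 = 1.
  rewrite (bigD1 i)//= big1 ?addr0 => [|k /negbTE ki].
    by rewrite !mxE eqxx (modc_real 1) normr1 expr1n.
  by rewrite !mxE ki modc0 expr0n.
rewrite mulr1; apply: le_trans; apply: ler_sum => j _.
by rewrite [X in _ <= modc X ^+ 2]mxE.
Qed.

Lemma resolvent_le i j : modc (G i j) <= y^-1.
Proof.
rewrite -(ler_pXn2r (n := 2))// ?nnegrE ?modc_ge0 ?invr_ge0 ?(ltW y0)//.
rewrite exprVn; apply: le_trans (resolvent_col j).
by rewrite (bigD1 i)//= lerDl sumr_ge0// => k _; rewrite sqr_ge0.
Qed.

Lemma Im_resolvent_ge0 i : 0 <= Im (G i i).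
Proof.
have := Im_pairing (zmx_col_resolvent i).
have -> : \sum_k ((col i G) k 0)^* * (col i 1%:M : 'cV[R[i]]_n) k 0 = (G i i)^*.
  rewrite (bigD1 i)//= big1 ?addr0 => [|k /negbTE ki].
    by rewrite !mxE eqxx mulr1.
  by rewrite !mxE ki mulr0.
case: (G i i) => a b /= bE.
have : 0 <= y * \sum_j modc (col i G j 0) ^+ 2.
  apply: mulr_ge0; [exact: ltW|by apply: sumr_ge0 => j _; apply: sqr_ge0].
lra.
Qed.

End fixed.

Section two.
Variables (A B : 'M[R]_n) (y : R).
Hypotheses (symA : A^T = A) (symB : B^T = B) (y0 : 0 < y).
Local Notation GA := (resolvent A y).
Local Notation GB := (resolvent B y).

Lemma resolvent_identity :
  GA - GB = - (GA *m map_mx (real_complex R) (A - B) *m GB).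
Proof.
have uA := zmx_unit symA y0; have uB := zmx_unit symB y0.
have -> : map_mx (real_complex R) (A - B) = zmx A y - zmx B y.
  by rewrite /zmx opprB addrA subrK map_mxB.
by rewrite resolvent.unlock mulmxBr mulmxBl mulVmx// mul1mx -mulmxA mulmxV// mulmx1 opprB.
Qed.

(** The trace of [GA D GB] pairs [GA D], of squared Hilbert-Schmidt norm at most that of [D] over
    [y ^+ 2], with [GB], for which it is at most [n / y ^+ 2]. Young's inequality with a free weight
    [eta] keeps the bound linear in the squared norm of [D], so that it can be averaged over graphs
    directly. *)
Lemma resolvent_trace_diff (eta : R) : 0 < eta ->
  modc (\tr GA - \tr GB) <=
  (y ^+ 2)^-1 * (n%:R * eta + eta^-1 * \sum_i \sum_j (A i j - B i j) ^+ 2).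
Proof.
move=> eta0; rewrite -raddfB/= resolvent_identity.
set D := map_mx _ _.
rewrite raddfN/= modcN.
have -> : \tr (GA *m D *m GB) = \sum_i \sum_j (GA *m D) i j * GB j i.
  by apply: eq_bigr => i _; rewrite [LHS]mxE.
set S := \sum_i \sum_j (A i j - B i j) ^+ 2.
have SD : \sum_i \sum_j modc ((GA *m D) i j) ^+ 2 <= (y ^+ 2)^-1 * S.
  rewrite /S [X in _ * X]exchange_big mulr_sumr [leLHS]exchange_big/=.
  apply: ler_sum => j _.
  have H : zmx A y *m col j (GA *m D) = col j D.
    by rewrite !colE !mulmxA resolventVr// mul1mx.
  have := resolvent_contract symA y0 H.
  have -> : \sum_i modc (col j (GA *m D) i 0) ^+ 2 = \sum_i modc ((GA *m D) i j) ^+ 2.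
    by apply: eq_bigr => i _; rewrite [X in modc X ^+ 2 = _]mxE.
  move=> /le_trans; apply; apply: ler_wpM2l.
    by rewrite invr_ge0 sqr_ge0.
  by apply: ler_sum => i _; rewrite !mxE modc_real real_normK ?num_real.
have SG : \sum_i \sum_j modc (GB i j) ^+ 2 <= (y ^+ 2)^-1 * n%:R.
  rewrite exchange_big/=.
  have -> : (y ^+ 2)^-1 * n%:R = \sum_(i < n) (y ^+ 2)^-1.
    by rewrite sumr_const card_ord mulr_natr.
  by apply: ler_sum => j _; apply: resolvent_col.
apply: (le_trans (modc_sum _ _ _)).
have step : \sum_i modc (\sum_j (GA *m D) i j * GB j i) <=
    \sum_i \sum_j (eta^-1 * modc ((GA *m D) i j) ^+ 2 + eta * modc (GB i j) ^+ 2).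
  apply: ler_sum => i _; apply: (le_trans (modc_sum _ _ _)).
  apply: ler_sum => j _; rewrite modcM (resolvent_sym y symB j i).
  set a := modc _; set b := modc _.
  have a0 : 0 <= a by apply: modc_ge0.
  have b0 : 0 <= b by apply: modc_ge0.
  have -> : eta^-1 * a ^+ 2 + eta * b ^+ 2 = eta^-1 * (a - eta * b) ^+ 2 + 2 * (a * b).
    by field; rewrite gt_eqF.
  have : 0 <= eta^-1 * (a - eta * b) ^+ 2 by rewrite mulr_ge0 ?sqr_ge0// invr_ge0 ltW.
  have : 0 <= a * b by rewrite mulr_ge0.
  lra.
apply: (le_trans step).
under eq_bigr do rewrite big_split/= -!mulr_sumr.
rewrite big_split/= -!mulr_sumr.
have -> : (y ^+ 2)^-1 * (n%:R * eta + eta^-1 * S) =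
  eta^-1 * ((y ^+ 2)^-1 * S) + eta * ((y ^+ 2)^-1 * n%:R) by ring.
by apply: lerD; apply: ler_wpM2l => //; rewrite ?invr_ge0 ltW.
Qed.

End two.
End resolvent.

(** * The self-consistent equation *)

Section complex_expectation.
Import complex.
Local Open Scope complex_scope.
Variables (R : rcfType) (E : finType) (q : E -> R).
Hypothesis q01 : forall e, 0 <= q e <= 1.
Implicit Types (f : {ffun E -> bool} -> R[i]) (w : {ffun E -> bool}) (e : E).

Definition ExC f : R[i] := Ex (fun e => (q e)%:C) f.

Lemma bweightC w : bweight (fun e => (q e)%:C) w = (bweight q w)%:C.
Proof.
rewrite /bweight rmorph_prod/=; apply: eq_bigr => e _.
by rewrite /bern; case: ifP => // _; rewrite rmorphB.
Qed.

Lemma Re_ExC f : Re (ExC f) = Ex q (fun w => Re (f w)).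
Proof.
by rewrite /ExC /Ex Re_sum; apply: eq_bigr => w _; rewrite bweightC Re_realM.
Qed.

Lemma Im_ExC f : Im (ExC f) = Ex q (fun w => Im (f w)).
Proof.
by rewrite /ExC /Ex Im_sum; apply: eq_bigr => w _; rewrite bweightC Im_realM.
Qed.

Lemma modc_ExC f : modc (ExC f) <= Ex q (fun w => modc (f w)).
Proof.
apply: (le_trans (modc_sum _ _ _)); apply: ler_sum => w _.
by rewrite bweightC modcM modc_real ger0_norm ?bweight_ge0.
Qed.

Lemma modc_ExC_le f (b : R) : (forall w, modc (f w) <= b) -> modc (ExC f) <= b.
Proof. by move=> fb; apply: (le_trans (modc_ExC f)); apply: Ex_le_cst. Qed.

Lemma efron_stein_modc f :
  Ex q (fun w => modc (f w - ExC f) ^+ 2) <=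
  \sum_e q e * (1 - q e) * Ex q (fun w => modc (jump e f w) ^+ 2).
Proof.
have H1 := efron_stein q01 (fun w => Re (f w)).
have H2 := efron_stein q01 (fun w => Im (f w)).
have -> : \sum_e q e * (1 - q e) * Ex q (fun w => modc (jump e f w) ^+ 2) =
    \sum_e q e * (1 - q e) * Ex q (fun w => jump e (fun w => Re (f w)) w ^+ 2) +
    \sum_e q e * (1 - q e) * Ex q (fun w => jump e (fun w => Im (f w)) w ^+ 2).
  rewrite -big_split/=; apply: eq_bigr => e _; rewrite -mulrDr -ExD.
  congr (_ * _); apply: eq_Ex => w; rewrite modc_sqr /jump.
  by case: (f _) => a b; case: (f _).
apply: le_trans (lerD H1 H2).
rewrite -Re_ExC -Im_ExC; set m := ExC f.
rewrite (@eq_Ex _ _ _ _ (fun w => Re (f w) ^+ 2 + (- 2 * Re m) * Re (f w) +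
   (Im (f w) ^+ 2 + (- 2 * Im m) * Im (f w)) + (Re m ^+ 2 + Im m ^+ 2))).
  rewrite !ExD !ExZ !Ex_cst -Re_ExC -Im_ExC -/m; lra.
by move=> w; rewrite modc_sqr; case: (f w) (m) => a b [c d] /=; ring.
Qed.

Lemma Ex_modc_le f (b : R) : 0 <= b ->
  Ex q (fun w => modc (f w) ^+ 2) <= b ^+ 2 -> Ex q (fun w => modc (f w)) <= b.
Proof.
move=> b0 fb; rewrite -(ler_pXn2r (n := 2))// ?nnegrE//.
  exact: le_trans (Ex_sqr q01 _) fb.
by apply: Ex_ge0 => // w; apply: modc_ge0.
Qed.

End complex_expectation.

Section ring_identities.
Variable K : comNzRingType.
Implicit Types a b c d e f g : K.

Lemma mulBmul a b c d : a * b - c * d = (a - c) * b + c * (b - d).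
Proof. ring. Qed.

Lemma two_mulB a b c d e f g :
  a * b + c * d - (e * f + g ^+ 2) = (a * b - g * g) + (c * d - f * e).
Proof. ring. Qed.

Lemma add_sub_add a b c d : a + (b - a) + c = b + d - (d - c).
Proof. ring. Qed.

Lemma sub_add_sub a b c : a - b = c + (a - (b + c)).
Proof. ring. Qed.

End ring_identities.

Lemma sqrD_le (R : realFieldType) (x z : R) : (x + z) ^+ 2 <= 2 * (x ^+ 2 + z ^+ 2).
Proof.
rewrite -subr_ge0.
have -> : 2 * (x ^+ 2 + z ^+ 2) - (x + z) ^+ 2 = (x - z) ^+ 2 by ring.
exact: sqr_ge0.
Qed.

Lemma mul_le_sqrD (R : realFieldType) (s t x z : R) : 0 <= s -> 0 <= t ->
  s <= 2 * (x + z) -> t <= 2 * (x + z) -> s * t <= 8 * (x ^+ 2 + z ^+ 2).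
Proof.
move=> s0 t0 hs ht; apply: (@le_trans _ _ ((2 * (x + z)) * (2 * (x + z)))).
  exact: ler_pM.
have -> : 2 * (x + z) * (2 * (x + z)) = 4 * (x + z) ^+ 2 by ring.
by have := sqrD_le x z; lra.
Qed.

Lemma weighted_sqr_le (R : realFieldType) (v b s x z : R) : 0 <= v -> 0 <= s ->
  s <= 16 * b * (x + z) ->
  v * s ^+ 2 <= 512 * (b ^+ 2 * v) * (x ^+ 2 + z ^+ 2).
Proof.
move=> v0 s0 sb; have s2 : s ^+ 2 <= (16 * b * (x + z)) ^+ 2.
  by rewrite lerXn2r ?nnegrE// (le_trans s0 sb).
apply: (@le_trans _ _ (v * (16 * b * (x + z)) ^+ 2)); first exact: ler_wpM2l.
have -> : v * (16 * b * (x + z)) ^+ 2 = 256 * (b ^+ 2 * v) * (x + z) ^+ 2 by ring.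
have -> : 512 * (b ^+ 2 * v) * (x ^+ 2 + z ^+ 2) =
  256 * (b ^+ 2 * v) * (2 * (x ^+ 2 + z ^+ 2)) by ring.
apply: ler_wpM2l; last exact: sqrD_le.
by apply: mulr_ge0 => //; apply: mulr_ge0 => //; apply: sqr_ge0.
Qed.

(** * Resolvent of a centered symmetric matrix with independent entries *)

Section random_matrix.
Import complex.
Local Open Scope complex_scope.
Variables (R : rcfType) (n : nat) (p beta : 'I_n -> 'I_n -> R) (b0 y M : R).
Hypotheses (p01 : forall i j, 0 <= p i j <= 1) (psym : forall i j, p i j = p j i).
Hypotheses (beta_ge0 : forall i j, 0 <= beta i j)
  (beta_le : forall i j, beta i j <= b0)
  (beta_sym : forall i j, beta i j = beta j i) (beta_diag : forall i, beta i i = 0).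
Hypotheses (b0_ge0 : 0 <= b0) (b0_le1 : b0 <= 1) (y1 : 1 <= y) (M1 : 1 <= M).
Local Notation Omega := {ffun 'I_n * 'I_n -> bool}.
Implicit Types (w : Omega) (i j k l : 'I_n) (e : 'I_n * 'I_n).

(* A graph is coded by the coordinates (i, j) with i < j; all others are almost
   surely false. *)
Definition eprob e : R := if (e.1 < e.2)%N then p e.1 e.2 else 0.

Definition edge i j : 'I_n * 'I_n := if (i < j)%N then (i, j) else (j, i).

Definition has_edge w i j : bool := (i != j) && w (edge i j).

Definition cmat w : 'M[R]_n :=
  \matrix_(i, j) (beta i j * ((has_edge w i j)%:R - p i j)).

(** The variance of the entry [(i, j)] of [cmat]. *)
Definition vprof i j : R := beta i j ^+ 2 * (p i j * (1 - p i j)).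

Hypothesis vsum : forall i, \sum_j vprof i j <= M.

Lemma edgeC i j : edge i j = edge j i.
Proof.
rewrite /edge; case: ltngtP => // ij.
by rewrite (val_inj ij).
Qed.

Lemma has_edgeC w i j : has_edge w i j = has_edge w j i.
Proof. by rewrite /has_edge eq_sym edgeC. Qed.

Lemma eprob01 e : 0 <= eprob e <= 1.
Proof. by rewrite /eprob; case: ifP => // _; rewrite lexx ler01. Qed.

Lemma eprob_edge i j : i != j -> eprob (edge i j) = p i j.
Proof.
rewrite /eprob /edge => ij; case: (ltngtP i j) => [lt|gt|/val_inj eq] /=.
- by rewrite lt.
- by rewrite gt psym.
- by rewrite eq eqxx in ij.
Qed.

Lemma cmat_sym w : (cmat w)^T = cmat w.
Proof. by apply/matrixP => i j; rewrite !mxE beta_sym psym has_edgeC. Qed.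

Lemma edge_inj i j k l : edge i j = edge k l ->
  (i == k) && (j == l) || (i == l) && (j == k).
Proof.
by rewrite /edge; case: ifP => _; case: ifP => _ [-> ->]; rewrite !eqxx ?orbT.
Qed.

Lemma cmat_upd w i j a b : i != j ->
  cmat (upd w (edge i j) a) - cmat (upd w (edge i j) b) =
  (beta i j * (a%:R - b%:R)) *: (delta_mx i j + delta_mx j i).
Proof.
move=> ij; apply/matrixP => k l; rewrite !mxE /has_edge !updE.
have [->|ne] := eqVneq k l.
  rewrite beta_diag !mul0r subrr; have [->|_] := eqVneq l i.
    by rewrite (negbTE ij)/= addr0 mulr0.
  by rewrite /= andbF addr0 mulr0.
case: eqP => /= [/edge_inj/orP[]/andP[/eqP -> /eqP ->]|ee].
- by rewrite !eqxx/= (negbTE ij) /= addr0 mulr1; ring.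
- rewrite !eqxx/= (eq_sym j) (negbTE ij)/= add0r mulr1 beta_sym; ring.
- rewrite subrr; case: eqP => [ki|_]; case: eqP => [lj|_] /=.
  + by rewrite ki lj in ee.
  + case: eqP => [kj|_]; last by rewrite addr0 mulr0.
    by move: ij; rewrite -ki kj eqxx.
  + case: eqP => [kj|_] /=; last by rewrite addr0 mulr0.
    by move: ne; rewrite kj lj eqxx.
  + case: eqP => [kj|_] /=; last by rewrite addr0 mulr0.
    case: eqP => [li|_] /=; last by rewrite addr0 mulr0.
    by move: ee; rewrite kj li edgeC.
Qed.

Lemma cmatE w i j : cmat w i j = beta i j * ((has_edge w i j)%:R - p i j).
Proof. by rewrite mxE. Qed.

Local Notation G := (fun w => resolvent (cmat w) y).
Local Notation E := (Ex eprob).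
Local Notation EC := (ExC eprob).

Let y0 : 0 < y. Proof. exact: lt_le_trans y1. Qed.

Lemma res_le1 w i j : modc (G w i j) <= 1.
Proof.
apply: (le_trans (resolvent_le (cmat_sym w) y0 i j)).
by rewrite invf_le1.
Qed.

Lemma res_col1 w i : \sum_j modc (G w j i) ^+ 2 <= 1.
Proof.
apply: (le_trans (resolvent_col (cmat_sym w) y0 i)).
by rewrite invf_le1 ?exprn_gt0// exprn_ege1.
Qed.

(** Changing one edge perturbs the matrix along [delta_mx i j + delta_mx j i], so the resolvent
    identity becomes a closed formula, with one factor at each value of the edge. *)
Lemma res_upd w i j a b k l : i != j ->
  G (upd w (edge i j) a) k l - G (upd w (edge i j) b) k l =
  - ((beta i j * (a%:R - b%:R))%:C *
     (G (upd w (edge i j) a) k i * G (upd w (edge i j) b) j l +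
      G (upd w (edge i j) a) k j * G (upd w (edge i j) b) i l)).
Proof.
move=> ij; have := resolvent_identity (cmat_sym (upd w (edge i j) a))
  (cmat_sym (upd w (edge i j) b)) y0.
rewrite cmat_upd// map_mxZ map_mxD !map_delta_mx/=.
rewrite -scalemxAr -scalemxAl mulmxDr mulmxDl => /matrixP/(_ k l).
have H (X Y : 'M[R[i]]_n) s t : (X *m delta_mx s t *m Y) k l = X k s * Y t l.
  rewrite mxE (bigD1 t)//= big1 ?addr0 => [|u /negbTE ut].
    rewrite mxE (bigD1 s)//= big1 ?addr0 => [|u /negbTE us].
      by rewrite mxE !eqxx mulr1.
    by rewrite mxE us mulr0.
  rewrite mxE big1 ?mul0r// => x _.
  by rewrite mxE ut andbF mulr0.
have mxBE (X Y : 'M[R[i]]_n) : (X - Y) k l = X k l - Y k l by rewrite !mxE.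
have mxZE c (X Y : 'M[R[i]]_n) : (- (c *: (X + Y))) k l = - (c * (X k l + Y k l)).
  by rewrite !mxE.
by rewrite mxBE mxZE !H.
Qed.

Lemma res_upd_le w i j a k l : i != j ->
  modc (G (upd w (edge i j) a) k l - G w k l) <= 2 * b0.
Proof.
move=> ij; rewrite -{2}(upd_id w (edge i j)) res_upd// modcN modcM modc_real.
rewrite mulrC; apply: ler_pM; rewrite ?modc_ge0 ?normr_ge0//.
  apply: (le_trans (modcD _ _)); rewrite !modcM -[leRHS]/(1 + 1).
  by apply: lerD; rewrite mulr_ile1 ?modc_ge0 ?res_le1.
rewrite normrM (ger0_norm (beta_ge0 i j)) -[leRHS]mulr1.
apply: ler_pM => //; rewrite ?normr_ge0//.
by case: a; case: (w _); rewrite ?subrr ?normr0 ?subr0 ?sub0r ?normrN ?normr1 ?ler01.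
Qed.

Lemma modc_mulB (a b c d : R[i]) (t : R) : modc b <= 1 -> modc c <= 1 ->
  modc (a - c) <= t -> modc (b - d) <= t ->
  modc (a * b - c * d) <= 2 * t.
Proof.
move=> hb hc h1 h2.
rewrite mulBmul; apply: (le_trans (modcD _ _)); rewrite !modcM mulr_natl mulr2n.
by apply: lerD; [rewrite -[leRHS]mulr1|rewrite -[leRHS]mul1r];
  apply: ler_pM; rewrite ?modc_ge0.
Qed.

(** The jump of [G k i] along the edge [ik], up to the factor [- beta i k]. *)
Definition mixed i k w : R[i] :=
  G (upd w (edge i k) true) k i * G (upd w (edge i k) false) k i +
  G (upd w (edge i k) true) k k * G (upd w (edge i k) false) i i.

Lemma EC_offdiag i k : i != k ->
  EC (fun w => (cmat w i k)%:C * G w k i) = - (vprof i k)%:C * EC (mixed i k).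
Proof.
move=> ik; pose e := edge i k.
rewrite /ExC (@eq_Ex _ _ _ _ (fun w =>
  (beta i k)%:C * (((w e)%:R - (eprob e)%:C) * G w k i))); last first.
  move=> w; rewrite mulrA; congr (_ * _); rewrite cmatE /has_edge ik/=.
  by rewrite rmorphM/= eprob_edge// rmorphB rmorph_nat.
rewrite ExZ (Ex_centered _ e (fun w => G w k i)).
rewrite (@eq_Ex _ _ _ _ (fun w => - (beta i k)%:C * mixed i k w)); last first.
  by move=> w; rewrite /jump res_upd// subr0 mulr1 mulNr.
rewrite ExZ eprob_edge// !mulrA; congr (_ * _).
rewrite /vprof !rmorphM/= ?rmorphXn rmorphB rmorph1/=.
move: (beta i k)%:C (p i k)%:C => b c; ring.
Qed.

Lemma mixed_le i k w : i != k ->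
  modc (mixed i k w - (G w i i * G w k k + G w k i ^+ 2)) <= 8 * b0.
Proof.
move=> ik; rewrite /mixed.
rewrite two_mulB; apply: (le_trans (modcD _ _)).
have -> : 8 * b0 = 2 * (2 * b0) + 2 * (2 * b0) by ring.
by apply: lerD; apply: modc_mulB; rewrite ?res_le1 ?res_upd_le.
Qed.

Lemma vprof_ge0 i j : 0 <= vprof i j.
Proof.
have /andP[? ?] := p01 i j.
by rewrite mulr_ge0 ?sqr_ge0// mulr_ge0 ?subr_ge0.
Qed.

Lemma vprof_le i j : vprof i j <= b0 ^+ 2.
Proof.
have /andP[p0 p1] := p01 i j; rewrite -[leRHS]mulr1.
apply: ler_pM; rewrite ?sqr_ge0 ?mulr_ge0 ?subr_ge0 ?lerXn2r ?nnegrE//.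
by rewrite mulr_ile1 ?subr_ge0//; lra.
Qed.

Lemma vprof_sym i j : vprof i j = vprof j i.
Proof. by rewrite /vprof beta_sym psym. Qed.

(** Entries after the change are bounded by entries at the same [w], so that the column bound
    [res_col1] can be applied to sums of squares. *)
Lemma res_upd_near w i j a k m : i != j ->
  modc (G (upd w (edge i j) a) k m) <=
  modc (G w k m) + (modc (G w k i) + modc (G w k j)).
Proof.
move=> ij; set g := G (upd _ _ _) k m.
rewrite -(subKr (G w k m) g).
apply: (le_trans (modcB _ _)); rewrite lerD2l.
rewrite /g -{1}(upd_id w (edge i j)) res_upd// upd_id modcN modcM modc_real.
rewrite -[leRHS]mul1r; apply: ler_pM; rewrite ?modc_ge0 ?normr_ge0//.
  rewrite normrM (ger0_norm (beta_ge0 i j)) mulr_ile1//.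
    exact: le_trans (beta_le i j) b0_le1.
  by case: a {g}; case: (w _); rewrite ?subrr ?normr0 ?subr0 ?sub0r ?normrN ?normr1 ?ler01.
apply: (le_trans (modcD _ _)); rewrite !modcM.
by apply: lerD; rewrite -[leRHS]mulr1; apply: ler_pM; rewrite ?modc_ge0 ?res_le1.
Qed.

Section trace.
Variables (d : 'I_n -> R) (D S : R).
Hypotheses (D0 : 0 <= D) (d0D : forall i, 0 <= d i <= D) (dS : \sum_i d i <= S).
Let X w := \sum_i (d i)%:C * G w i i.
Let a w k := \sum_j d j * modc (G w j k) ^+ 2.

Let d_ge0 i : 0 <= d i. Proof. by case/andP: (d0D i). Qed.

Let a_ge0 w k : 0 <= a w k.
Proof. by apply: sumr_ge0 => j _; rewrite mulr_ge0 ?sqr_ge0. Qed.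

(** Each [G j j] moves by products of entries of row [j] at [k] and [l]. All these factors are at
    most [2 * (x + z)] in terms of the entries at [w], which yields the squares collected in [a]. *)
Lemma jump_trace_le w k l : k != l ->
  modc (jump (edge k l) X w) <= 16 * beta k l * (a w k + a w l).
Proof.
move=> kl; rewrite /jump /X -sumrB.
apply: (le_trans (modc_sum _ _ _)).
rewrite mulrDr /a !mulr_sumr -big_split/=; apply: ler_sum => j _.
rewrite -mulrBr modcM modc_real ger0_norm// res_upd// subr0 mulr1 modcN modcM.
rewrite modc_real ger0_norm//.
have -> : 16 * beta k l * (d j * modc (G w j k) ^+ 2) +
    16 * beta k l * (d j * modc (G w j l) ^+ 2) =
    d j * (beta k l * (16 * (modc (G w j k) ^+ 2 + modc (G w j l) ^+ 2))) by ring.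
apply: ler_wpM2l => //; apply: ler_wpM2l => //.
apply: (le_trans (modcD _ _)); rewrite !modcM.
set u := upd _ _ true; set u' := upd _ _ false.
rewrite (resolvent_sym y (cmat_sym u') l j) (resolvent_sym y (cmat_sym u') k j).
have h1 := res_upd_near w true j k kl; have h2 := res_upd_near w true j l kl.
have h3 := res_upd_near w false j k kl; have h4 := res_upd_near w false j l kl.
rewrite -/u -/u' in h1 h2 h3 h4.
set x := modc (G w j k) in h1 h2 h3 h4 *; set z := modc (G w j l) in h1 h2 h3 h4 *.
have x0 : 0 <= x by apply: modc_ge0.
have z0 : 0 <= z by apply: modc_ge0.
have nearx s : s <= x + (x + z) -> s <= 2 * (x + z).
  by move/le_trans; apply; rewrite mulr_natl mulr2n lerD2r lerDl.
have nearz s : s <= z + (x + z) -> s <= 2 * (x + z).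
  by move/le_trans; apply; rewrite mulr_natl mulr2n lerD2r lerDr.
have -> : 16 * (x ^+ 2 + z ^+ 2) = 8 * (x ^+ 2 + z ^+ 2) + 8 * (x ^+ 2 + z ^+ 2) by ring.
apply: lerD; apply: mul_le_sqrD (modc_ge0 _) (modc_ge0 _) _ _.
- exact: nearx h1.
- exact: nearz h4.
- exact: nearz h2.
- exact: nearx h3.
Qed.

(** Columns of [G] have norm at most 1, so every [a w k] is at most [D]; rows do too by symmetry, so
    the [a w k] add up to at most [S]. Each estimate bounds one factor of the square. *)
Lemma sum_Ex_sqr_le : \sum_k E (fun w => a w k ^+ 2) <= D * S.
Proof.
rewrite -(Ex_sum _ _ xpredT (fun k w => a w k ^+ 2)).
apply: (Ex_le_cst eprob01) => w.
have aD k : a w k <= D.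
  apply: (@le_trans _ _ (\sum_j D * modc (G w j k) ^+ 2)).
    by apply: ler_sum => j _; rewrite ler_wpM2r ?sqr_ge0//; case/andP: (d0D j).
  by rewrite -mulr_sumr -[leRHS]mulr1 ler_wpM2l// res_col1.
apply: (@le_trans _ _ (\sum_k D * a w k)).
  by apply: ler_sum => k _; rewrite expr2 ler_wpM2r.
rewrite -mulr_sumr.
apply: ler_wpM2l => //; apply: le_trans dS.
rewrite exchange_big/=; apply: ler_sum => j _.
rewrite -mulr_sumr -[leRHS]mulr1 ler_wpM2l//.
rewrite (eq_bigr (fun k => modc (G w k j) ^+ 2)) ?res_col1// => k _.
by rewrite (resolvent_sym y (cmat_sym w)).
Qed.

(** Efron-Stein turns an edge into [512 * vprof] times the squared masses [a] at its two ends. Row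
    sums of [vprof] are at most [M], and the two ends give the same contribution. *)
Lemma Ex_trace_var : E (fun w => modc (X w - EC X) ^+ 2) <= 1024 * M * D * S.
Proof.
apply: (le_trans (efron_stein_modc eprob01 X)).
have step e : eprob e * (1 - eprob e) * E (fun w => modc (jump e X w) ^+ 2) <=
    512 * vprof e.1 e.2 * E (fun w => a w e.1 ^+ 2) +
    512 * vprof e.1 e.2 * E (fun w => a w e.2 ^+ 2).
  have [lt|] := boolP (e.1 < e.2)%N; last first.
    move=> lt; have -> : eprob e = 0 by rewrite /eprob (negbTE lt).
    rewrite !mul0r.
    have V := vprof_ge0 e.1 e.2.
    apply: addr_ge0; apply: mulr_ge0; try by rewrite mulr_ge0.
      by apply: (Ex_ge0 eprob01) => w; apply: sqr_ge0.
    by apply: (Ex_ge0 eprob01) => w; apply: sqr_ge0.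
  have ne : e.1 != e.2 by rewrite neq_ltn lt.
  have ee : e = edge e.1 e.2 by rewrite /edge lt; case: (e).
  rewrite -mulrDr -ExD.
  have -> : eprob e = p e.1 e.2 by rewrite /eprob lt.
  rewrite -!ExZ; apply: (le_Ex eprob01) => w.
  have HJ := jump_trace_le w ne; rewrite -ee in HJ.
  have /andP[p0 p1] := p01 e.1 e.2.
  by apply: weighted_sqr_le (modc_ge0 _) HJ; rewrite mulr_ge0// subr_ge0.
apply: (le_trans (ler_sum _ (fun e _ => step e))).
rewrite big_split/=.
have H : \sum_(e : 'I_n * 'I_n) 512 * vprof e.1 e.2 * E (fun w => a w e.1 ^+ 2) <=
    512 * M * (D * S).
  rewrite -(pair_bigA _ (fun k l => 512 * vprof k l * E (fun w => a w k ^+ 2)))/=.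
  apply: (@le_trans _ _ (\sum_k 512 * M * E (fun w => a w k ^+ 2))).
    apply: ler_sum => k _; rewrite -mulr_suml -mulr_sumr.
    apply: ler_wpM2r; first by apply: (Ex_ge0 eprob01) => w; apply: sqr_ge0.
    by rewrite ler_wpM2l.
  rewrite -mulr_sumr ler_wpM2l ?sum_Ex_sqr_le//; have := M1; lra.
have -> : \sum_(e : 'I_n * 'I_n) 512 * vprof e.1 e.2 * E (fun w => a w e.2 ^+ 2) =
    \sum_(e : 'I_n * 'I_n) 512 * vprof e.1 e.2 * E (fun w => a w e.1 ^+ 2).
  rewrite -(pair_bigA _ (fun k l => 512 * vprof k l * E (fun w => a w l ^+ 2)))/=.
  rewrite -(pair_bigA _ (fun k l => 512 * vprof k l * E (fun w => a w k ^+ 2)))/=.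
  rewrite exchange_big/=; apply: eq_bigr => k _; apply: eq_bigr => l _.
  by rewrite vprof_sym.
by apply: (le_trans (lerD H H)); rewrite le_eqVlt; apply/orP; left; apply/eqP; ring.
Qed.

End trace.

Local Notation u := (fun i => EC (fun w => G w i i)).

Lemma Ex_trace_dev (d : 'I_n -> R) (D S : R) : 0 <= D ->
  (forall i, 0 <= d i <= D) -> \sum_i d i <= S -> D <= b0 ^+ 2 -> S <= M ->
  E (fun w => modc (\sum_i (d i)%:C * G w i i - \sum_i (d i)%:C * u i)) <=
  32 * M * b0.
Proof.
move=> D0 dD dS Db SM; have M0 : 0 <= M by apply: le_trans M1.
have -> : \sum_i (d i)%:C * u i = EC (fun w => \sum_i (d i)%:C * G w i i).
  rewrite /ExC Ex_sum; apply: eq_bigr => i _.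
  by rewrite -ExZ.
apply: (Ex_modc_le eprob01); first by rewrite !mulr_ge0.
apply: (le_trans (Ex_trace_var D0 dD dS)).
have -> : (32 * M * b0) ^+ 2 = 1024 * M * (b0 ^+ 2) * M by ring.
have S0 : 0 <= S by apply: le_trans dS; apply: sumr_ge0 => i _; case/andP: (dD i).
apply: ler_pM => //; first by rewrite !mulr_ge0.
by rewrite ler_wpM2l// mulr_ge0.
Qed.

(** The diagonal entry of [(A - iy) G = 1] is averaged. Integration by parts turns [A i k * G k i]
    into [- vprof i k] times [G i i * G k k + G k i ^+ 2], up to [8 * b0]. The squares contribute at
    most [b0 ^+ 2] by the column bound, and concentration of the weighted trace separates it from
    [G i i] at the cost [32 * M * b0]. *)
Lemma approx_self_consistency i :
  modc ('i * y%:C * u i + 1 + u i * \sum_j (vprof i j)%:C * u j) <= (40 * M + 1) * b0.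
Proof.
have vii : vprof i i = 0 by rewrite /vprof beta_diag expr0n mul0r.
have row : \sum_k EC (fun w => (cmat w i k)%:C * G w k i) - 'i * y%:C * u i = 1.
  rewrite -[RHS](Ex_cst (fun e => (eprob e)%:C) (1 : R[i])) /ExC -Ex_sum -ExZ -ExB.
  apply: eq_Ex => w; rewrite (resolvent_row (cmat_sym w) y0) eqxx//.
pose V w := \sum_j (vprof i j)%:C * G w j j.
have main : modc (\sum_k EC (fun w => (cmat w i k)%:C * G w k i) +
    EC (fun w => G w i i * V w)) <= 8 * b0 * M + b0 ^+ 2.
  have -> : EC (fun w => G w i i * V w) =
      \sum_k (vprof i k)%:C * EC (fun w => G w i i * G w k k).
    rewrite /ExC; under eq_bigr do rewrite -ExZ.
    rewrite -Ex_sum; apply: eq_Ex => w; rewrite /V mulr_sumr.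
    by apply: eq_bigr => k _; rewrite mulrCA.
  rewrite -big_split/=; apply: (le_trans (modc_sum _ _ _)).
  have step k : modc (EC (fun w => (cmat w i k)%:C * G w k i) +
      (vprof i k)%:C * EC (fun w => G w i i * G w k k)) <=
      8 * b0 * vprof i k + b0 ^+ 2 * E (fun w => modc (G w k i) ^+ 2).
    have [<-|ik] := eqVneq i k.
      rewrite vii mul0r addr0 mulr0 add0r.
      have -> : EC (fun w => (cmat w i i)%:C * G w i i) = 0.
        rewrite -[RHS](Ex_cst (fun e => (eprob e)%:C)); apply: eq_Ex => w.
        by rewrite cmatE beta_diag !mul0r.
      rewrite modc0 mulr_ge0 ?sqr_ge0// (Ex_ge0 eprob01)// => w.
      by rewrite sqr_ge0.
    rewrite EC_offdiag// mulNr -mulrN -mulrDr modcM modc_real ger0_norm ?vprof_ge0//.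
    rewrite addrC -/(_ - _) -ExB.
    apply: (@le_trans _ _ (vprof i k * E (fun w => 8 * b0 + modc (G w k i) ^+ 2))).
      apply: ler_wpM2l; first exact: vprof_ge0.
      apply: (le_trans (modc_ExC eprob01 _)); apply: (le_Ex eprob01) => w.
      rewrite modcBC (sub_add_sub _ _ (G w k i ^+ 2)) addrC.
      apply: (le_trans (modcD _ _)); rewrite [G w k i ^+ 2]expr2 modcM -expr2.
      by rewrite lerD2r mixed_le.
    rewrite ExD Ex_cst mulrDr mulrC lerD2l ler_wpM2r ?vprof_le//.
    by apply: (Ex_ge0 eprob01) => w; rewrite sqr_ge0.
  apply: (le_trans (ler_sum _ (fun k _ => step k))).
  rewrite big_split/= -!mulr_sumr; apply: lerD; first by rewrite ler_wpM2l ?mulr_ge0.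
  rewrite -[leRHS]mulr1 ler_wpM2l ?sqr_ge0// -Ex_sum.
  by apply: (Ex_le_cst eprob01) => w; apply: res_col1.
have dec : modc (EC (fun w => G w i i * V w) - u i * \sum_j (vprof i j)%:C * u j) <=
    32 * M * b0.
  rewrite [u i * _]mulrC -[X in modc (_ - X)]ExZ -ExB.
  apply: (le_trans (modc_ExC eprob01 _)).
  apply: (@le_trans _ _ (E (fun w => modc (V w - \sum_j (vprof i j)%:C * u j)))).
    apply: (le_Ex eprob01) => w; rewrite [X in _ - X]mulrC -mulrBr modcM.
    by rewrite -[leRHS]mul1r ler_wpM2r ?modc_ge0 ?res_le1.
  apply: (Ex_trace_dev (D := b0 ^+ 2) (S := M)) => //; first exact: sqr_ge0.
  by move=> j; rewrite vprof_ge0 vprof_le.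
set T := \sum_k _ in row main; set W := EC (fun w => _ * V w) in main dec.
set Q := u i * _ in dec *.
have -> : 'i * y%:C * u i + 1 + Q = (T + W) - (W - Q).
  by rewrite -row; apply: add_sub_add.
apply: (le_trans (modcB _ _)); apply: (le_trans (lerD main dec)).
have b2 : b0 ^+ 2 <= b0 by rewrite expr2 -[leRHS]mulr1 ler_wpM2l.
have -> : (40 * M + 1) * b0 = 8 * b0 * M + b0 + 32 * M * b0 by ring.
by rewrite lerD2r lerD2l.
Qed.

Lemma Im_EC_res_ge0 i : 0 <= Im (u i).
Proof.
rewrite Im_ExC; apply: (Ex_ge0 eprob01) => w.
exact: Im_resolvent_ge0 (cmat_sym w) y0 i.
Qed.

Lemma modc_EC_res i : modc (u i) <= 1.
Proof. by apply: (modc_ExC_le eprob01) => w; apply: res_le1. Qed.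

End random_matrix.

(** * Picard iteration for the limit equation and its stability in the mean *)

Section fixed_point_iteration.
Import complex.
Local Open Scope complex_scope.
Variables (R : rcfType) (Theta : finType) (K : Theta -> Theta -> R)
  (q : Theta -> R) (y : R).
Implicit Types (a b : Theta) (k : nat).

(* Picard iterates for [z h a + 1 + h a * \sum_b q b K(a,b) h b = 0] at [z = 'i y]. *)
Fixpoint iterate k a : R[i] :=
  if k is k'.+1 then
    - ('i * y%:C + \sum_b (q b * K a b)%:C * iterate k' b)^-1
  else 0.

(** Approximates the normalized trace of the resolvent; only the types and their law enter, which is
    the source of universality. *)
Definition iterate_mean k : R[i] := \sum_a (q a)%:C * iterate k a.

Hypotheses (K0 : forall a b, 0 <= K a b) (q0 : forall a, 0 <= q a) (y1 : 1 <= y).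

Lemma modc_shift_ge (x : R[i]) : 0 <= Im x -> y <= modc ('i * y%:C + x).
Proof.
move=> x0; apply: (@le_trans _ _ (Im ('i * y%:C + x))).
  by case: x x0 => u v /= v0; rewrite mul0r add0r mul1r lerDl.
by apply: (le_trans _ (modc_ge_Im _)); apply: ler_norm.
Qed.

Lemma shift_neq0 (x : R[i]) : 0 <= Im x -> 'i * y%:C + x != 0.
Proof.
move=> /modc_shift_ge H; apply/eqP => E; move: H; rewrite E modc0.
by rewrite leNgt (lt_le_trans ltr01 y1).
Qed.

Lemma Im_opp_inv (x : R[i]) : 0 <= Im x -> 0 <= Im (- x^-1).
Proof.
case: x => u v /= v0; rewrite opprK divr_ge0//.
by rewrite addr_ge0 ?sqr_ge0.
Qed.

Lemma Im_sum_ge0 (I : finType) (c : I -> R) (h : I -> R[i]) :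
  (forall i, 0 <= c i) -> (forall i, 0 <= Im (h i)) ->
  0 <= Im (\sum_i (c i)%:C * h i).
Proof.
move=> c0 h0; rewrite Im_sum; apply: sumr_ge0 => i _.
by rewrite Im_realM mulr_ge0.
Qed.

Lemma Im_iterate_ge0 k a : 0 <= Im (iterate k a).
Proof.
elim: k a => [|k IH] a //=; apply: Im_opp_inv.
have : 0 <= Im (\sum_b (q b * K a b)%:C * iterate k b).
  by apply: Im_sum_ge0 => // b; rewrite mulr_ge0.
by case: (\sum_b _) => u v /= v0; rewrite mul0r add0r mul1r addr_ge0// (le_trans ler01).
Qed.

Lemma modc_iterate_le1 k a : modc (iterate k a) <= 1.
Proof.
case: k => [|k] /=; first by rewrite modc0.
rewrite modcN modcV invf_le1.
  apply: (le_trans y1); apply: modc_shift_ge.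
  by apply: Im_sum_ge0 => b; rewrite ?Im_iterate_ge0// mulr_ge0.
apply: modc_gt0; apply: shift_neq0.
by apply: Im_sum_ge0 => b; rewrite ?Im_iterate_ge0// mulr_ge0.
Qed.

Section stability.
Variables (n : nat) (u : 'I_n -> R[i]) (v s : 'I_n -> 'I_n -> R)
  (t : 'I_n -> Theta) (M e : R).
Hypotheses (KM : forall a b, K a b <= M) (M1 : 1 <= M) (yM : 2 * M <= y ^+ 2).
Hypotheses (v0 : forall i j, 0 <= v i j) (vsym : forall i j, v i j = v j i)
  (vM : forall i, \sum_j v i j <= M).
Hypotheses (s0 : forall i j, 0 <= s i j) (ssym : forall i j, s i j = s j i)
  (s1 : forall i, \sum_j s i j = 1).
Hypotheses (Imu : forall i, 0 <= Im (u i)) (u1 : forall i, modc (u i) <= 1).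
Hypothesis approx : forall i,
  modc ('i * y%:C * u i + 1 + u i * \sum_j (v i j)%:C * u j) <= e.

Definition kernel_defect : R :=
  n%:R^-1 * \sum_i \sum_j `|v i j - s i j * K (t i) (t j)|.

(** The [s]-weighted frequency of type [a] seen from row [i] is compared with its law, in the mean
    over [i]. *)
Definition type_defect : R :=
  \sum_a n%:R^-1 * \sum_i `|\sum_j s i j * (t j == a)%:R - q a|.

Let dev k : R := n%:R^-1 * \sum_i modc (u i - iterate k (t i)).

Let n0 : 0 <= n%:R^-1 :> R. Proof. by rewrite invr_ge0. Qed.

Lemma sum_types (c : 'I_n -> R) (g : Theta -> R[i]) :
  \sum_j (c j)%:C * g (t j) =
  \sum_a (\sum_j c j * (t j == a)%:R)%:C * g a.
Proof.
under [RHS]eq_bigr do rewrite rmorph_sum/= mulr_suml.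
rewrite exchange_big/=; apply: eq_bigr => j _.
rewrite (bigD1 (t j))//= eqxx mulr1 big1 ?addr0// => a ja.
by rewrite eq_sym (negbTE ja) mulr0 mul0r.
Qed.

(** The difference of the two fixed point forms has denominators [z + V] and [z + S], of modulus at
    least [y] because both sums have nonnegative imaginary part. In [V - S], first [u] is changed
    into the iterate, then [v] into [s * K], then the weighted frequencies into [q]. *)
Lemma dev_step k i :
  modc (u i - iterate k.+1 (t i)) <= e + (y ^+ 2)^-1 *
    (\sum_j v i j * modc (u j - iterate k (t j)) +
     \sum_j `|v i j - s i j * K (t i) (t j)| +
     M * \sum_a `|\sum_j s i j * (t j == a)%:R - q a|).
Proof.
have y0 : 0 < y by apply: lt_le_trans y1.
rewrite /=; set V := \sum_j (v i j)%:C * u j.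
set S := \sum_b (q b * K (t i) b)%:C * iterate k b.
have V0 : 0 <= Im V by apply: Im_sum_ge0.
have S0 : 0 <= Im S.
  by apply: Im_sum_ge0 => b; rewrite ?Im_iterate_ge0// mulr_ge0.
have Vn := shift_neq0 V0; have Sn := shift_neq0 S0.
have Vy := modc_shift_ge V0; have Sy := modc_shift_ge S0.
have := approx i; rewrite -/V; set z := 'i * y%:C => Hi.
rewrite -/z in Vn Sn Vy Sy *.
have -> : u i - - (z + S)^-1 =
    (z * u i + 1 + u i * V) / (z + V) + (V - S) / ((z + V) * (z + S)).
  by field; rewrite Vn Sn.
apply: (le_trans (modcD _ _)); apply: lerD.
  rewrite modcM modcV ler_pdivrMr ?modc_gt0//.
  apply: (le_trans Hi); rewrite -[leLHS]mulr1 ler_wpM2l//.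
    exact: le_trans (modc_ge0 _) Hi.
  exact: le_trans Vy.
rewrite modcM modcV modcM mulrC; apply: ler_pM; rewrite ?modc_ge0//.
- by rewrite invr_ge0 mulr_ge0 ?modc_ge0.
- rewrite lef_pV2 ?posrE ?mulr_gt0 ?modc_gt0 ?exprn_gt0//.
  by rewrite expr2 ler_pM// ltW.
pose T := \sum_j (s i j * K (t i) (t j))%:C * iterate k (t j).
have -> : V - S = (V - \sum_j (v i j)%:C * iterate k (t j)) +
    (\sum_j (v i j)%:C * iterate k (t j) - T) + (T - S).
  by rewrite !subrKA.
apply: (le_trans (modcD _ _)); apply: lerD.
  apply: (le_trans (modcD _ _)); apply: lerD.
    rewrite -sumrB; apply: (le_trans (modc_sum _ _ _)).
    by apply: ler_sum => j _; rewrite -mulrBr modcM modc_real ger0_norm.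
  rewrite -sumrB; apply: (le_trans (modc_sum _ _ _)).
  apply: ler_sum => j _; rewrite -mulrBl -rmorphB modcM modc_real.
  by rewrite -[leRHS]mulr1 ler_wpM2l ?modc_iterate_le1.
have -> : T = \sum_a (\sum_j s i j * (t j == a)%:R)%:C * ((K (t i) a)%:C * iterate k a).
  rewrite -(sum_types (s i) (fun a => (K (t i) a)%:C * iterate k a)).
  by apply: eq_bigr => j _; rewrite rmorphM mulrA.
rewrite /S -sumrB; apply: (le_trans (modc_sum _ _ _)).
rewrite mulr_sumr; apply: ler_sum => a _.
rewrite rmorphM -mulrA -mulrBl -rmorphB modcM modc_real mulrC.
apply: ler_wpM2r; first exact: normr_ge0.
rewrite modcM modc_real ger0_norm// -[leRHS]mulr1.
by apply: ler_pM; rewrite ?modc_ge0 ?modc_iterate_le1.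
Qed.

Hypothesis n_gt0 : (0 < n)%N.

(** In the mean over [i], the column sums of [v], equal to row sums by symmetry, produce the factor
    [M / y ^+ 2 <= 1 / 2]. The map thus contracts the mean deviation, and the defects enter as means
    as well. *)
Lemma dev_le k : dev k <= 2^-1 ^+ k + 2 * (e + kernel_defect + M * type_defect).
Proof.
have nK : n%:R^-1 * n%:R = 1 :> R by rewrite mulVf// pnatr_eq0 -lt0n.
have M0 : 0 <= M by apply: le_trans M1.
have i0 : 'I_n by apply: (Ordinal n_gt0).
have e0 : 0 <= e by apply: (le_trans (modc_ge0 _) (approx i0)).
have H0 : 0 <= kernel_defect.
  by rewrite mulr_ge0// sumr_ge0// => i _; rewrite sumr_ge0.
have L0 : 0 <= type_defect.
  by rewrite sumr_ge0// => a _; rewrite mulr_ge0// sumr_ge0.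
have dev0 k' : 0 <= dev k'.
  by rewrite mulr_ge0// sumr_ge0// => i _; rewrite modc_ge0.
have y2 : 0 < y ^+ 2 by rewrite exprn_gt0// (lt_le_trans ltr01).
have step k' : dev k'.+1 <= e + (y ^+ 2)^-1 * (M * dev k' + kernel_defect + M * type_defect).
  rewrite /dev.
  apply: (le_trans (ler_wpM2l n0 (ler_sum _ (fun i _ => dev_step k' i)))).
  rewrite big_split/= sumr_const card_ord -(mulr_natl e) mulrDr (mulrA _ _ e) nK mul1r.
  rewrite lerD2l -mulr_sumr mulrCA ler_wpM2l ?invr_ge0 ?(ltW y2)//.
  rewrite !big_split/= !mulrDr; apply: lerD; last first.
    rewrite -mulr_sumr mulrCA ler_wpM2l// /type_defect exchange_big/=.
    by rewrite mulr_sumr.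
  rewrite lerD2r mulrCA ler_wpM2l// exchange_big/= mulr_sumr.
  apply: ler_sum => j _; rewrite -mulr_suml ler_wpM2r ?modc_ge0//.
  by rewrite (eq_bigr (v j))// => i _; rewrite vsym.
set c := e + _ + _ in step *.
have half x : 0 <= x -> (y ^+ 2)^-1 * (M * x) <= 2^-1 * x.
  move=> x0; rewrite mulrA ler_wpM2r// ler_pdivrMl//.
  by rewrite ler_pdivlMr// mulrC.
have c0 : 0 <= c by rewrite !addr_ge0// mulr_ge0.
elim: k => [|k IH].
  rewrite expr0; apply: (@le_trans _ _ 1); last by rewrite lerDl mulr_ge0.
  rewrite -[leRHS]nK ler_wpM2l//.
  rewrite -[X in X%:R]card_ord -sumr_const; apply: ler_sum => i _.
  by rewrite subr0.
apply: (le_trans (step k)); rewrite -addrA mulrDr addrCA.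
apply: (@le_trans _ _ (2^-1 * dev k + c)).
  apply: lerD; first exact: half.
  rewrite /c -addrA lerD2l -[leRHS]mul1r; apply: ler_wpM2r.
    by apply: addr_ge0 => //; apply: mulr_ge0.
  by rewrite invf_le1// exprn_ege1.
rewrite exprS; move: IH; set d := dev k; set x := 2^-1 ^+ k => IH; lra.
Qed.

Lemma mean_close k :
  modc ((n%:R^-1)%:C * \sum_i u i - iterate_mean k) <=
  2^-1 ^+ k + 2 * (e + kernel_defect + M * type_defect) + type_defect.
Proof.
have nK : n%:R^-1 * n%:R = 1 :> R by rewrite mulVf// pnatr_eq0 -lt0n.
set m := (n%:R^-1)%:C * \sum_i iterate k (t i).
rewrite -(subrKA m); apply: (le_trans (modcD _ _)); apply: lerD.
  rewrite -mulrBr -sumrB modcM modc_real ger0_norm//.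
  by apply: le_trans (dev_le k); rewrite ler_wpM2l// modc_sum.
have -> : m = \sum_a (n%:R^-1 * \sum_i \sum_j s i j * (t j == a)%:R)%:C * iterate k a.
  (* The columns of [s] also sum to 1, so the plain mean over vertices equals the mean of the
     [s]-weighted row means, which [type_defect] controls. *)
  rewrite /m; have -> : \sum_i iterate k (t i) = \sum_j (\sum_i s i j)%:C * iterate k (t j).
    apply: eq_bigr => j _; have -> : \sum_i s i j = 1.
      by rewrite -(s1 j); apply: eq_bigr.
    by rewrite mul1r.
  rewrite sum_types mulr_sumr; apply: eq_bigr => a _.
  rewrite mulrA -rmorphM; congr (_%:C * _); congr (_ * _).
  by rewrite [RHS]exchange_big/=; apply: eq_bigr => j _; rewrite mulr_suml.
rewrite /iterate_mean -sumrB; apply: (le_trans (modc_sum _ _ _)).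
apply: ler_sum => a _; rewrite -mulrBl -rmorphB modcM modc_real -[leRHS]mulr1.
apply: ler_pM; rewrite ?modc_ge0 ?modc_iterate_le1//.
have {1}-> : q a = n%:R^-1 * \sum_(i < n) q a.
  by rewrite sumr_const card_ord -(mulr_natl (q a)) mulrA nK mul1r.
rewrite -mulrBr -sumrB normrM ger0_norm// ler_wpM2l//.
exact: ler_norm_sum.
Qed.

End stability.
End fixed_point_iteration.

(** * Functions generated by the resolvent *)

Section closed_span.
Variable R : realType.
Implicit Types (f g h : R -> R) (x y z e : R).

Lemma expr_small (r e : R) : 0 <= r -> r < 1 -> 0 < e -> exists m, r ^+ m <= e.
Proof.
move=> r0 r1 e0; have [->|rn0] := eqVneq r 0.
  by exists 1%N; rewrite expr1 ltW.
have rgt0 : 0 < r by rewrite lt_def rn0.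
pose s := r^-1 - 1.
have s0 : 0 < s by rewrite subr_gt0 invf_gt1.
have bern m : 1 + m%:R * s <= (1 + s) ^+ m.
  elim: m => [|m IH]; first by rewrite expr0 mul0r addr0.
  rewrite exprS mulrDl mul1r; apply: (@le_trans _ _ (1 + m%:R * s + s * 1)).
    by rewrite mulr1 -natr1 mulrDl mul1r addrA.
  apply: lerD => //; rewrite ler_wpM2l ?(ltW s0)//.
  by apply: le_trans IH; rewrite lerDl mulr_ge0// ltW.
pose m := Num.bound (e^-1 / s); exists m.
have re : r = (1 + s)^-1 by rewrite /s addrC subrK invrK.
have s1 : 0 < (1 + s) ^+ m by rewrite exprn_gt0// addr_gt0.
have bound : e^-1 <= (1 + s) ^+ m.
  have : e^-1 / s < m%:R.
    by apply: archi_boundP; rewrite divr_ge0 ?invr_ge0 ?(ltW e0) ?(ltW s0).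
  rewrite ltr_pdivrMr// => /ltW /le_trans; apply.
  by apply: le_trans (bern m); rewrite lerDr.
by rewrite re exprVn invf_ple ?posrE// -(invrK e) lef_pV2 ?posrE ?invr_gt0.
Qed.

Definition lorentz y x : R := (x ^+ 2 + y ^+ 2)^-1.

(** In the last constructor the approximants are a function of the tolerance instead of sitting
    under an existential, so that the induction principle supplies a hypothesis for each of them. *)
Inductive clspan (y0 : R) : (R -> R) -> Prop :=
| clspan_one : clspan y0 (fun=> 1)
| clspan_even y : y0 <= y -> clspan y0 (lorentz y)
| clspan_odd y : y0 <= y -> clspan y0 (fun x => x * lorentz y x)
| clspan_add f g : clspan y0 f -> clspan y0 g -> clspan y0 (fun x => f x + g x)
| clspan_scale c f : clspan y0 f -> clspan y0 (fun x => c * f x)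
| clspan_lim (g : R -> R -> R) f : (forall e, 0 < e -> clspan y0 (g e)) ->
    (forall e, 0 < e -> forall x, `|f x - g e x| <= e) -> clspan y0 f.

Lemma clspan_minimal y0 (S : (R -> R) -> Prop) : S (fun=> 1) ->
  (forall y, y0 <= y -> S (lorentz y)) ->
  (forall y, y0 <= y -> S (fun x => x * lorentz y x)) ->
  (forall f g, S f -> S g -> S (fun x => f x + g x)) ->
  (forall c f, S f -> S (fun x => c * f x)) ->
  (forall f, (forall e, 0 < e -> exists2 g, S g & forall x, `|f x - g x| <= e) -> S f) ->
  forall f, clspan y0 f -> S f.
Proof.
move=> S1 Se So Sa Ss Sl f; elim=> {f} //.
- by move=> f g _ Sf _ Sg; apply: Sa.
- by move=> c f _ Sf; apply: Ss.
- by move=> g f _ Sg fg; apply: Sl => e e0; exists (g e); [apply: Sg|apply: fg].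
Qed.

Section fixed_y0.
Variable y0 : R.
Hypothesis y01 : 1 <= y0.
Local Notation cl := (clspan y0).

Lemma clspan_ext f g : f =1 g -> cl f -> cl g.
Proof.
move=> fg clf; apply: (clspan_lim (g := fun=> f)) => // e e0 x.
by rewrite fg subrr normr0 ltW.
Qed.

Lemma sqr_add_ge1 y x : 1 <= y -> 1 <= x ^+ 2 + y ^+ 2.
Proof.
by move=> y1; rewrite -[leLHS]add0r lerD ?sqr_ge0// exprn_ege1.
Qed.

Lemma lorentz_ge0 y x : 0 <= lorentz y x.
Proof. by rewrite invr_ge0 addr_ge0 ?sqr_ge0. Qed.

Lemma sqr_add_neq0 y x : 1 <= y -> x ^+ 2 + y ^+ 2 != 0.
Proof.
by move=> y1; rewrite gt_eqF// (lt_le_trans ltr01)// sqr_add_ge1.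
Qed.

Lemma lorentz_le1 y x : 1 <= y -> lorentz y x <= 1.
Proof.
move=> y1; have H := sqr_add_ge1 x y1.
by rewrite invf_le1// (lt_le_trans ltr01).
Qed.

Lemma odd_lorentz_le1 y x : 1 <= y -> `|x * lorentz y x| <= 1.
Proof.
move=> y1; rewrite normrM (ger0_norm (lorentz_ge0 _ _)).
have H := sqr_add_ge1 x y1.
rewrite ler_pdivrMr ?(lt_le_trans ltr01)// mul1r.
have -> : x ^+ 2 = `|x| ^+ 2 by rewrite real_normK ?num_real.
have : 1 <= y ^+ 2 by rewrite exprn_ege1.
have := sqr_ge0 (`|x| - 1); nra.
Qed.

Lemma lorentz_prod a b x : 1 <= a -> 1 <= b ->
  lorentz a x - lorentz b x = (b ^+ 2 - a ^+ 2) * (lorentz a x * lorentz b x).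
Proof.
by move=> a1 b1; rewrite /lorentz; field; rewrite !sqr_add_neq0.
Qed.

Lemma clspan_bounded f : cl f -> exists2 C, 0 < C & forall x, `|f x| <= C.
Proof.
elim=> {f}.
- by exists 1 => // x; rewrite normr1.
- move=> y yy; exists 1 => // x; rewrite ger0_norm ?lorentz_ge0 ?lorentz_le1//.
  exact: le_trans yy.
- by move=> y yy; exists 1 => // x; apply: odd_lorentz_le1; apply: le_trans yy.
- move=> f g _ [C C0 fC] _ [D D0 gD]; exists (C + D); first exact: addr_gt0.
  by move=> x; apply: (le_trans (ler_normD _ _)); apply: lerD.
- move=> c f _ [C C0 fC]; exists (`|c| * C + 1).
    by rewrite ltr_wpDl// mulr_ge0// ltW.
  by move=> x; rewrite normrM (@le_trans _ _ (`|c| * C)) ?ler_wpM2l// lerDl.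
- move=> g f _ /(_ 1 ltr01) [C C0 gC] /(_ 1 ltr01) fg; exists (1 + C).
    by rewrite addr_gt0.
  move=> x; rewrite -[f x](subrK (g 1 x)).
  by apply: (le_trans (ler_normD _ _)); apply: lerD.
Qed.

Lemma clspan_opp f : cl f -> cl (fun x => - f x).
Proof.
by move=> /(clspan_scale (-1)); apply: clspan_ext => x; rewrite mulN1r.
Qed.

Lemma clspan_sub f g : cl f -> cl g -> cl (fun x => f x - g x).
Proof. by move=> clf /clspan_opp; apply: clspan_add. Qed.

Lemma clspan_cst c : cl (fun=> c).
Proof.
by have := clspan_scale c (clspan_one y0); apply: clspan_ext => x; rewrite mulr1.
Qed.

(* The limit b -> a handles products of two kernels with the same parameter,
   for which partial fractions are not available. *)
Lemma clspan_diagonal a h : y0 <= a -> (forall x, `|h x| <= 1) ->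
  (forall b, y0 <= b -> b != a -> cl (fun x => h x * lorentz b x)) ->
  cl (fun x => h x * lorentz a x).
Proof.
move=> ya h1 H; have a1 : 1 <= a by apply: le_trans ya.
have c0 : 0 < 2 * a + 1 by lra.
(* For [b = a + d], the factor [b ^+ 2 - a ^+ 2 = d * (2 * a + d)] is at most [d * (2 * a + 1)] once
   [d <= 1]. *)
pose d e := Num.min 1 (e / (2 * a + 1)).
have d0 e : 0 < e -> 0 < d e by move=> e0; rewrite lt_min ltr01 divr_gt0.
apply: (clspan_lim (g := fun e x => h x * lorentz (a + d e) x)) => e e0.
  apply: H; first by apply: (le_trans ya); rewrite lerDl ltW// d0.
  by rewrite gt_eqF// ltrDl d0.
have de := d0 e e0.
have b1 : 1 <= a + d e by apply: (le_trans a1); rewrite lerDl ltW.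
move=> x; rewrite -mulrBr normrM -[leRHS]mul1r; apply: ler_pM => //.
rewrite lorentz_prod// normrM -[leRHS]mulr1; apply: ler_pM => //; last first.
  rewrite ger0_norm ?mulr_ge0 ?lorentz_ge0//.
  by rewrite mulr_ile1 ?lorentz_ge0 ?lorentz_le1.
have -> : (a + d e) ^+ 2 - a ^+ 2 = d e * (2 * a + d e) by ring.
rewrite ger0_norm; last by rewrite mulr_ge0 ?addr_ge0 ?mulr_ge0//; lra.
have d1 : d e <= 1 by rewrite ge_min lexx.
have d2 : d e <= e / (2 * a + 1) by rewrite ge_min lexx orbT.
apply: (@le_trans _ _ (e / (2 * a + 1) * (2 * a + 1))); last by rewrite divfK ?gt_eqF.
by apply: ler_pM => //; lra.
Qed.

Lemma clspan_even_mul a b : y0 <= a -> y0 <= b ->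
  cl (fun x => lorentz a x * lorentz b x).
Proof.
move=> ya; have a1 := le_trans y01 ya.
have main c : y0 <= c -> c != a -> cl (fun x => lorentz a x * lorentz c x).
  move=> yc ca; have c1 := le_trans y01 yc.
  have clf := clspan_scale (c ^+ 2 - a ^+ 2)^-1
    (clspan_sub (clspan_even ya) (clspan_even yc)).
  apply: clspan_ext clf => x; rewrite lorentz_prod// mulKf//.
  by rewrite subr_eq0 eqrXn2 ?(le_trans ler01).
have [->|ba yb] := eqVneq b a; last exact: main.
move=> _; apply: clspan_diagonal => // x.
by rewrite ger0_norm ?lorentz_ge0// lorentz_le1.
Qed.

Lemma clspan_odd_even_mul a b : y0 <= a -> y0 <= b ->
  cl (fun x => x * lorentz a x * lorentz b x).
Proof.
move=> ya; have a1 := le_trans y01 ya.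
have main c : y0 <= c -> c != a -> cl (fun x => x * lorentz a x * lorentz c x).
  move=> yc ca; have c1 := le_trans y01 yc.
  have clf := clspan_scale (c ^+ 2 - a ^+ 2)^-1
    (clspan_sub (clspan_odd ya) (clspan_odd yc)).
  apply: clspan_ext clf => x; rewrite -mulrBr lorentz_prod// (mulrCA x) mulKf ?mulrA//.
  by rewrite subr_eq0 eqrXn2 ?(le_trans ler01).
have [->|ba yb] := eqVneq b a; last exact: main.
move=> _; apply: clspan_diagonal => // x.
exact: odd_lorentz_le1.
Qed.

(** [x ^+ 2 * lorentz a x = 1 - a ^+ 2 * lorentz a x] reduces this to the even case. *)
Lemma clspan_odd_odd_mul a b : y0 <= a -> y0 <= b ->
  cl (fun x => x * lorentz a x * (x * lorentz b x)).
Proof.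
move=> ya yb; have a1 := le_trans y01 ya.
have clf := clspan_sub (clspan_even yb) (clspan_scale (a ^+ 2) (clspan_even_mul ya yb)).
apply: clspan_ext clf => x; rewrite /lorentz; field.
by rewrite !sqr_add_neq0// (le_trans y01).
Qed.

(** Induction on both factors; uniform limits pass through a product because the other factor is
    bounded. *)
Lemma clspan_mul f g : cl f -> cl g -> cl (fun x => f x * g x).
Proof.
have lim (g' : R -> R -> R) f' h : cl h ->
    (forall e, 0 < e -> forall x, `|f' x - g' e x| <= e) ->
    (forall e, 0 < e -> cl (fun x => h x * g' e x)) -> cl (fun x => h x * f' x).
  move=> /clspan_bounded[C C0 hC] fg clg.
  apply: (clspan_lim (g := fun e x => h x * g' (e / C) x)) => e e0.
    by apply: clg; rewrite divr_gt0.
  move=> x; rewrite -mulrBr normrM; apply: (@le_trans _ _ (C * (e / C))).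
    by apply: ler_pM => //; apply: fg; rewrite divr_gt0.
  by rewrite mulrC divfK ?gt_eqF.
have even a h : y0 <= a -> cl h -> cl (fun x => lorentz a x * h x).
  move=> ya; elim=> {h}.
  - by apply: clspan_ext (clspan_even ya) => x; rewrite mulr1.
  - by move=> b; apply: clspan_even_mul.
  - move=> b yb; apply: clspan_ext (clspan_odd_even_mul yb ya) => x.
    by rewrite mulrC.
  - move=> f1 f2 _ cl1 _ cl2; apply: clspan_ext (clspan_add cl1 cl2) => x.
    by rewrite mulrDr.
  - by move=> c f1 _ cl1; apply: clspan_ext (clspan_scale c cl1) => x; rewrite mulrCA.
  - by move=> g' f' _ IH fg; apply: (lim g') => //; apply: clspan_even.
have odd a h : y0 <= a -> cl h -> cl (fun x => x * lorentz a x * h x).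
  move=> ya; elim=> {h}.
  - by apply: clspan_ext (clspan_odd ya) => x; rewrite mulr1.
  - by move=> b; apply: clspan_odd_even_mul.
  - by move=> b; apply: clspan_odd_odd_mul.
  - move=> f1 f2 _ cl1 _ cl2; apply: clspan_ext (clspan_add cl1 cl2) => x.
    by rewrite mulrDr.
  - by move=> c f1 _ cl1; apply: clspan_ext (clspan_scale c cl1) => x; rewrite mulrCA.
  - by move=> g' f' _ IH fg; apply: (lim g') => //; apply: clspan_odd.
move=> clf; elim=> {g}.
- by apply: clspan_ext clf => x; rewrite mulr1.
- by move=> b yb; apply: clspan_ext (even b f yb clf) => x; rewrite mulrC.
- by move=> b yb; apply: clspan_ext (odd b f yb clf) => x; rewrite mulrC.
- move=> f1 f2 _ cl1 _ cl2; apply: clspan_ext (clspan_add cl1 cl2) => x.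
  by rewrite mulrDr.
- by move=> c f1 _ cl1; apply: clspan_ext (clspan_scale c cl1) => x; rewrite mulrCA.
- by move=> g' f' _ IH fg; apply: (lim g').
Qed.

Lemma clspan_exp f m : cl f -> cl (fun x => f x ^+ m).
Proof.
move=> clf; elim: m => [|m IH]; first exact: clspan_ext (clspan_one _).
by apply: clspan_ext (clspan_mul clf IH) => x; rewrite exprS.
Qed.

Lemma clspan_sum (F : nat -> R -> R) m : (forall k, cl (F k)) ->
  cl (fun x => \sum_(k < m) F k x).
Proof.
move=> clF; elim: m => [|m IH].
  by apply: clspan_ext (clspan_cst 0) => x; rewrite big_ord0.
by apply: clspan_ext (clspan_add IH (clF m)) => x; rewrite big_ord_recr.
Qed.

(* Neumann series in [lorentz y0]. *)
Lemma clspan_small y (w : R -> R) : 1 <= y -> y <= y0 ->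
  cl (fun x => w x * lorentz y0 x) -> (forall x, `|w x * lorentz y x| <= 1) ->
  cl (fun x => w x * lorentz y x).
Proof.
move=> y1 yy0 clw w1.
have y00 : 0 < y0 by apply: lt_le_trans y01.
pose theta x := (y0 ^+ 2 - y ^+ 2) * lorentz y0 x.
have cltheta : cl theta by apply: clspan_scale; apply: clspan_even.
have dy : 0 <= y0 ^+ 2 - y ^+ 2.
  by rewrite subr_ge0 lerXn2r ?nnegrE ?(le_trans ler01).
pose r := (y0 ^+ 2 - y ^+ 2) / y0 ^+ 2.
have y02 : 0 < y0 ^+ 2 by rewrite exprn_gt0.
have r1 : r < 1.
  by rewrite ltr_pdivrMr// mul1r ltrBlDr ltrDl exprn_gt0// (lt_le_trans ltr01).
have r0 : 0 <= r by rewrite divr_ge0 ?(ltW y02).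
have theta_le x : `|theta x| <= r.
  rewrite ger0_norm ?mulr_ge0 ?lorentz_ge0// ler_wpM2l//.
  rewrite lef_pV2 ?posrE ?(lt_le_trans ltr01 (sqr_add_ge1 x y01))//.
  by rewrite lerDr sqr_ge0.
(* [1 - theta x] is the ratio of [x ^+ 2 + y ^+ 2] to [x ^+ 2 + y0 ^+ 2], so this is a finite
   geometric sum with its remainder. *)
have series m x : w x * lorentz y x =
    w x * lorentz y0 x * \sum_(k < m) theta x ^+ k + theta x ^+ m * (w x * lorentz y x).
  have E : lorentz y0 x = (1 - theta x) * lorentz y x.
    by rewrite /theta /lorentz; field; rewrite !sqr_add_neq0.
  rewrite E; have := subrX1 (theta x) m; set S := \sum_(k < m) _ => HS.
  have -> : theta x ^+ m = 1 - (1 - theta x) * S by rewrite -[theta x ^+ m](subrK 1) HS; ring.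
  ring.
have [F [clF FE]] : exists F : R -> R -> R, (forall e, 0 < e -> cl (F e)) /\
    forall e, 0 < e -> forall x, `|w x * lorentz y x - F e x| <= e.
  have ex e : exists m, 0 < e -> r ^+ m <= e.
    have [e0|_] := ltP 0 e; last by exists 0%N.
    by have [m rm] := expr_small r0 r1 e0; exists m.
  have {ex} [m rm] := choice ex.
  exists (fun e x => w x * lorentz y0 x * \sum_(k < m e) theta x ^+ k); split.
    move=> e _; apply: clspan_mul => //.
    by apply: (clspan_sum (F := fun k x => theta x ^+ k)) => k; apply: clspan_exp.
  move=> e e0 x; rewrite {1}(series (m e) x) [X in `|X|]addrC addKr.
  rewrite normrM normrX -[leRHS]mulr1; apply: ler_pM => //; first exact: exprn_ge0.
  by apply: le_trans (rm e e0); rewrite lerXn2r ?nnegrE.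
exact: (clspan_lim clF).
Qed.

(** Plays the role of analytic continuation: [y0] will grow with the truncation level, yet the
    generators from [y = 1] on remain available. *)
Lemma clspan_lorentz_small y : 1 <= y -> cl (lorentz y).
Proof.
move=> y1; have [yy|/ltW yy] := leP y0 y; first exact: clspan_even.
have H : cl (fun x => 1 * lorentz y x).
  apply: (clspan_small (w := fun=> 1) y1 yy) => [|x].
    by apply: clspan_ext (clspan_even (lexx y0)) => z; rewrite mul1r.
  by rewrite mul1r ger0_norm ?lorentz_ge0// lorentz_le1.
by apply: clspan_ext H => x; rewrite mul1r.
Qed.

Lemma clspan_odd_lorentz_small y : 1 <= y -> cl (fun x => x * lorentz y x).
Proof.
move=> y1; have [yy|/ltW yy] := leP y0 y; first exact: clspan_odd.
apply: (clspan_small (w := id) y1 yy) => [|x]; first exact: clspan_odd.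
exact: odd_lorentz_le1.
Qed.

(** The polynomial iteration for [|t|] on [-1, 1] known from the Stone-Weierstrass theorem; it is
    built from ring operations, under which the span is closed. *)
Fixpoint abs_approx k (t : R) : R :=
  if k is k'.+1 then abs_approx k' t + (t ^+ 2 - abs_approx k' t ^+ 2) / 2 else 0.

Lemma abs_approx_bound k t : `|t| <= 1 ->
  0 <= abs_approx k t <= `|t| /\
  `|t| - abs_approx k t <= `|t| * (1 - `|t| / 2) ^+ k.
Proof.
move=> t1; have t0 := normr_ge0 t.
elim: k => [|k [/andP[p0 pt] IH]] /=; first by rewrite lexx t0 subr0 expr0 mulr1.
set p := abs_approx k t in p0 pt IH *.
have tt : t ^+ 2 = `|t| ^+ 2 by rewrite real_normK ?num_real.
have E : `|t| - (p + (t ^+ 2 - p ^+ 2) / 2) = (`|t| - p) * (1 - (`|t| + p) / 2).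
  by rewrite tt; field.
have f0 : 0 <= 1 - (`|t| + p) / 2 by lra.
split; last first.
  rewrite E exprSr mulrA; apply: ler_pM => //; first by rewrite subr_ge0.
  by lra.
apply/andP; split; last by rewrite -subr_ge0 E mulr_ge0// subr_ge0.
rewrite addr_ge0// divr_ge0// subr_ge0 tt lerXn2r ?nnegrE//.
Qed.

Lemma clspan_abs_le1 f : cl f -> (forall x, `|f x| <= 1) -> cl (fun x => `|f x|).
Proof.
move=> clf f1.
have [m Hm] : exists m : R -> nat, forall e, 0 < e ->
    forall t, `|t| <= 1 -> `| `|t| - abs_approx (m e) t| <= e.
  have ex e : exists m, 0 < e -> forall t, `|t| <= 1 -> `| `|t| - abs_approx m t| <= e.
    have [e0|_] := ltP 0 e; last by exists 0%N.
    have [e1|/ltW e1] := leP 1 e.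
      exists 0%N => _ t t1 /=; rewrite subr0 normr_id; exact: le_trans e1.
    have h0 : 0 <= 1 - e / 2 by lra.
    have h1 : 1 - e / 2 < 1 by lra.
    have [m rm] := expr_small h0 h1 e0; exists m => _ t t1.
    have [/andP[p0 pt] H] := abs_approx_bound m t1.
    rewrite ger0_norm ?subr_ge0//; apply: (le_trans H).
    have t0 := normr_ge0 t.
    (* For [|t|] below [e] the error is at most [|t|] itself; above, each iteration shrinks the
       bound by a factor at most [1 - e / 2]. *)
    have [te|/ltW te] := leP `|t| e.
      apply: le_trans te; rewrite -[leRHS]mulr1 ler_wpM2l// exprn_ile1//; lra.
    apply: le_trans rm; rewrite -[leRHS]mul1r; apply: ler_pM => //.
      by rewrite exprn_ge0//; lra.
    by rewrite lerXn2r ?nnegrE//; lra.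
  by have [m Hm] := choice ex; exists m.
apply: (clspan_lim (g := fun e x => abs_approx (m e) (f x))) => [e e0|e e0 x].
  elim: (m e) => [|k IH] /=; first exact: clspan_cst.
  have := clspan_scale 2^-1 (clspan_sub (clspan_mul clf clf) (clspan_mul IH IH)).
  by move/(clspan_add IH); apply: clspan_ext => x; rewrite !expr2 [_^-1 * _]mulrC.
exact: Hm.
Qed.

Lemma clspan_abs f : cl f -> cl (fun x => `|f x|).
Proof.
move=> clf; have [C C0 fC] := clspan_bounded clf.
have H : cl (fun x => `|C^-1 * f x|).
  apply: clspan_abs_le1; first exact: clspan_scale.
  move=> x; rewrite normrM gtr0_norm ?invr_gt0// ler_pdivrMl// mulr1.
  exact: fC.
apply: clspan_ext (clspan_scale C H) => x.
by rewrite normrM gtr0_norm ?invr_gt0// mulVKf// gt_eqF.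
Qed.

Lemma clspan_max f g : cl f -> cl g -> cl (fun x => Num.max (f x) (g x)).
Proof.
move=> clf clg; have := clspan_scale 2^-1 (clspan_add (clspan_add clf clg)
  (clspan_abs (clspan_sub clf clg))).
by apply: clspan_ext => x; rewrite maxr_absE mulrC.
Qed.

Lemma clspan_min f g : cl f -> cl g -> cl (fun x => Num.min (f x) (g x)).
Proof.
move=> clf clg; have := clspan_scale 2^-1 (clspan_sub (clspan_add clf clg)
  (clspan_abs (clspan_sub clf clg))).
by apply: clspan_ext => x; rewrite minr_absE mulrC.
Qed.

(** A continuous substitute for the indicator of [x <= a]: 1 up to [a], 0 from [a + h] on. *)
Definition ramp (a h x : R) : R := Num.max 0 (Num.min 1 ((a + h - x) / h)).

Lemma ramp_lip (a h : R) x z : 0 < h -> `|ramp a h x - ramp a h z| <= `|x - z| / h.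
Proof.
move=> h0; have clip (u v : R) : `|Num.max 0 (Num.min 1 u) - Num.max 0 (Num.min 1 v)| <= `|u - v|.
  have bnd (s t : R) : - `|s - t| <= s - t <= `|s - t|.
    by have := lexx `|s - t|; rewrite ler_norml.
  have mx (s t : R) : `|Num.max 0 s - Num.max 0 t| <= `|s - t|.
    have /andP[? ?] := bnd s t; have := normr_ge0 (s - t).
    by case: (leP 0 s) => ?; case: (leP 0 t) => ? ?; rewrite ler_norml; apply/andP; split; lra.
  have mn (s t : R) : `|Num.min 1 s - Num.min 1 t| <= `|s - t|.
    have /andP[? ?] := bnd s t; have := normr_ge0 (s - t).
    by case: (leP 1 s) => ?; case: (leP 1 t) => ? ?; rewrite ler_norml; apply/andP; split; lra.
  exact: le_trans (mx _ _) (mn _ _).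
apply: (le_trans (clip _ _)).
have -> : (a + h - x) / h - (a + h - z) / h = (z - x) / h by field; rewrite gt_eqF.
by rewrite normrM (gtr0_norm (_ : 0 < h^-1)) ?invr_gt0// distrC.
Qed.

Lemma ramp_ge0 (a h : R) x : 0 <= ramp a h x.
Proof. by rewrite /ramp le_max lexx. Qed.

Lemma ramp_le1 (a h : R) x : ramp a h x <= 1.
Proof. by rewrite /ramp ge_max ler01 ge_min lexx. Qed.

(* [L ^+ 2 * x / (x ^+ 2 + L ^+ 2)] tends to [x] locally uniformly as [L] grows. *)
Lemma clspan_ramp (a h : R) e : 0 < h -> 0 < e ->
  exists2 g, cl g & forall x, `|ramp a h x - g x| <= e * (1 + x ^+ 2).
Proof.
(* Beyond [T] one has [e * x ^+ 2 >= 1], which pays for the difference of two values in [0, 1].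
   Within [T], the choice of [L] makes [|x - xL x|], at most [T ^+ 3 / L ^+ 2], no larger than
   [e * h]. *)
move=> h0 e0; pose T := Num.max 1 e^-1.
have T1 : 1 <= T by rewrite le_max lexx.
have Te : e^-1 <= T by rewrite le_max lexx orbT.
have T0 : 0 < T by apply: lt_le_trans T1.
pose L := Num.max y0 (T ^+ 3 / (h * e)).
have yL : y0 <= L by rewrite le_max lexx.
have L1 := le_trans y01 yL.
have L0 : 0 < L by apply: lt_le_trans L1.
have TL : T ^+ 3 / (h * e) <= L by rewrite le_max lexx orbT.
pose xL x := L ^+ 2 * (x * lorentz L x).
exists (fun x => ramp a h (xL x)).
  have clx : cl (fun x => (a + h - xL x) / h).
    have := clspan_scale h^-1 (clspan_sub (clspan_cst (a + h)) (clspan_scale (L ^+ 2) (clspan_odd yL))).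
    by apply: clspan_ext => x; rewrite mulrC.
  exact: clspan_max (clspan_cst 0) (clspan_min (clspan_cst 1) clx).
move=> x; have [xT|/ltW xT] := leP `|x| T.
  apply: (le_trans (ramp_lip _ _ _ h0)).
  apply: (@le_trans _ _ e); last by rewrite -[leLHS]mulr1 ler_wpM2l ?(ltW e0)// lerDl sqr_ge0.
  rewrite ler_pdivrMr//.
  have -> : x - xL x = x ^+ 3 * lorentz L x.
    by rewrite /xL /lorentz; field; rewrite sqr_add_neq0.
  rewrite normrM normrX (ger0_norm (lorentz_ge0 _ _)).
  rewrite ler_pdivrMr ?(lt_le_trans ltr01 (sqr_add_ge1 x L1))//.
  apply: (@le_trans _ _ (T ^+ 3)); first by rewrite lerXn2r ?nnegrE// ltW.
  apply: (@le_trans _ _ (e * h * L)).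
    move: TL; rewrite ler_pdivrMr ?mulr_gt0// => /le_trans; apply.
    by rewrite mulrC [h * e]mulrC.
  rewrite ler_wpM2l ?mulr_ge0 ?(ltW h0) ?(ltW e0)//.
  by rewrite -[leLHS]add0r lerD ?sqr_ge0// expr2 -[leLHS]mulr1 ler_wpM2l ?(ltW L0).
apply: (@le_trans _ _ 1).
  have := ramp_ge0 a h x; have := ramp_le1 a h x.
  have := ramp_ge0 a h (xL x); have := ramp_le1 a h (xL x).
  by move=> *; rewrite ler_norml; apply/andP; split; lra.
have x2 : T <= x ^+ 2.
  have -> : x ^+ 2 = `|x| ^+ 2 by rewrite real_normK ?num_real.
  by rewrite expr2 (le_trans xT)// -[leLHS]mulr1 ler_wpM2l// (le_trans T1).
apply: (@le_trans _ _ (e * x ^+ 2)); last by rewrite ler_wpM2l ?(ltW e0)// lerDr.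
by rewrite -ler_pdivrMl// mulr1 (le_trans Te).
Qed.

End fixed_y0.
End closed_span.

From mathcomp Require Import all_classical all_reals all_analysis.
From mathcomp Require Import measurable_realfun.
Require Import Defs.
Import Order.TTheory GRing.Theory Num.Theory.
Import numFieldNormedType.Exports.
Local Open Scope classical_set_scope.
Local Open Scope ring_scope.

(** * Linear spectral statistics and the trace of the resolvent *)

Section linear_statistic.
Import complex.
Local Open Scope complex_scope.
Variables (R : realType) (n : nat).
Implicit Types (A B : 'M[R]_n) (f g : R -> R).

Definition lin_stat A f : R := n%:R^-1 * \sum_(x <- eigenvalues A) f x.

Lemma size_eigenvalues A : A^T = A -> size (eigenvalues A) = n.
Proof.
move=> /eigenvaluesP chA; have := size_char_poly A.
by rewrite chA size_prod_XsubC => -[].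
Qed.

Lemma lin_statD A f g : lin_stat A (fun x => f x + g x) = lin_stat A f + lin_stat A g.
Proof. by rewrite /lin_stat big_split mulrDr. Qed.

Lemma lin_statZ A c f : lin_stat A (fun x => c * f x) = c * lin_stat A f.
Proof. by rewrite /lin_stat -mulr_sumr mulrCA. Qed.

Lemma lin_stat_le A f g : (forall x, f x <= g x) -> lin_stat A f <= lin_stat A g.
Proof. by move=> fg; rewrite ler_wpM2l ?invr_ge0//; apply: ler_sum. Qed.

Lemma lin_stat_norm A f : `|lin_stat A f| <= lin_stat A (fun x => `|f x|).
Proof.
rewrite normrM ger0_norm ?invr_ge0// ler_wpM2l ?invr_ge0//.
exact: ler_norm_sum.
Qed.

Lemma lin_statB_le A f g : `|lin_stat A f - lin_stat A g| <=
  lin_stat A (fun x => `|f x - g x|).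
Proof.
have -> : lin_stat A f - lin_stat A g = lin_stat A (fun x => f x - g x).
  by rewrite /lin_stat sumrB mulrBr.
exact: lin_stat_norm.
Qed.

Lemma lin_stat_cst A c : A^T = A -> (0 < n)%N -> lin_stat A (fun=> c) = c.
Proof.
move=> symA n0; rewrite /lin_stat big_const_seq count_predT size_eigenvalues//.
by rewrite iter_addr_0 -(mulr_natl c) mulKf// pnatr_eq0 -lt0n.
Qed.

Lemma lin_stat_unif A f g e : A^T = A -> (0 < n)%N ->
  (forall x, `|f x - g x| <= e) -> `|lin_stat A f - lin_stat A g| <= e.
Proof.
move=> symA n0 fg; apply: (le_trans (lin_statB_le _ _ _)).
by rewrite -[leRHS](lin_stat_cst e symA n0); apply: lin_stat_le.
Qed.

Lemma lin_stat_sqr A : A^T = A ->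
  lin_stat A (fun x => x ^+ 2) = n%:R^-1 * \sum_i \sum_j A i j ^+ 2.
Proof.
move=> symA; congr (_ * _).
have [S [d [Su defA chA]]] := symmetric_spectral symA.
rewrite (perm_big [seq d 0 i | i : 'I_n])/=; last first.
  apply: prod_XsubC_eq; rewrite -(eigenvaluesP symA) chA big_image/=.
  by [].
rewrite big_image/=; apply: complexI; rewrite !rmorph_sum/=.
transitivity (\tr (map_mx (real_complex R) (A *m A))); last first.
  rewrite /mxtrace; apply: eq_bigr => i _; rewrite !mxE; congr (_%:C).
  by apply: eq_bigr => j _; rewrite expr2 -{2}symA [X in _ * X = _]mxE.
rewrite map_mxM/= defA !mulmxA mulmxK// -mulmxA -mulmxA mxtrace_mulC.
rewrite -!mulmxA mulmxV// mulmx1 mulmx_diag mxtrace_diag.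
by apply: eq_bigr => i _; rewrite !mxE rmorphXn expr2.
Qed.

Lemma inv_sub_iy (x y : R) :
  (x%:C - 'i * y%:C)^-1 = (x * lorentz y x) +i* (y * lorentz y x).
Proof.
have -> : x%:C - 'i * y%:C = x -i* y by simpc.
by rewrite /GRing.inv/= /lorentz sqrrN; congr (_ +i* _); rewrite mulNr opprK.
Qed.

Lemma trace_even A (y : R) : A^T = A -> 1 <= y ->
  lin_stat A (lorentz y) = y^-1 * Im ((n%:R^-1)%:C * \tr (resolvent A y)).
Proof.
move=> symA y1; have y0 : 0 < y by apply: lt_le_trans y1.
rewrite (resolvent_trace symA y0 (eigenvaluesP symA)) Im_realM mulrCA; congr (_ * _).
rewrite Im_sum mulr_sumr; apply: eq_bigr => x _; rewrite inv_sub_iy/=.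
by rewrite mulKf// gt_eqF.
Qed.

Lemma trace_odd A (y : R) : A^T = A -> 1 <= y ->
  lin_stat A (fun x => x * lorentz y x) = Re ((n%:R^-1)%:C * \tr (resolvent A y)).
Proof.
move=> symA y1; have y0 : 0 < y by apply: lt_le_trans y1.
rewrite (resolvent_trace symA y0 (eigenvaluesP symA)) Re_realM; congr (_ * _).
by rewrite Re_sum; apply: eq_bigr => x _; rewrite inv_sub_iy.
Qed.

(* A generator of [clspan 1], bundled with the functional that recovers it from
   the normalized trace of the resolvent. *)
Definition is_generator (y : R) (f : R -> R) (phi : R[i] -> R) : Prop :=
  (f = lorentz y /\ phi = (fun z => y^-1 * Im z)) \/
  (f = (fun x => x * lorentz y x) /\ phi = @Re R).

Lemma generator_stat A y f phi : is_generator y f phi -> A^T = A -> 1 <= y ->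
  lin_stat A f = phi ((n%:R^-1)%:C * \tr (resolvent A y)).
Proof. by move=> [[-> ->]|[-> ->]] ? ?; [apply: trace_even|apply: trace_odd]. Qed.

Lemma generator_lip y f phi (z z' : R[i]) : is_generator y f phi -> 1 <= y ->
  `|phi z - phi z'| <= modc (z - z').
Proof.
move=> gen y1; have y0 : 0 < y by apply: lt_le_trans y1.
case: gen => [[_ ->]|[_ ->]]; last first.
  by apply: le_trans (modc_ge_Re _); case: z z' => a b [c d].
rewrite -mulrBr normrM gtr0_norm ?invr_gt0//.
apply: (@le_trans _ _ (modc (z - z'))) => //.
rewrite -[leRHS]mul1r; apply: ler_pM => //; first by rewrite invr_ge0 ltW.
  by rewrite invf_le1.
by apply: le_trans (modc_ge_Im _); case: z z' => a b [c d].
Qed.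

Lemma generator_stat_diff A B y f phi eta : is_generator y f phi -> 1 <= y ->
  (0 < n)%N -> A^T = A -> B^T = B -> 0 < eta ->
  `|lin_stat A f - lin_stat B f| <=
  eta + eta^-1 * (n%:R^-1 * \sum_i \sum_j (A i j - B i j) ^+ 2).
Proof.
move=> gen y1 n0 symA symB eta0; have y0 : 0 < y by apply: lt_le_trans y1.
have n1 : n%:R != 0 :> R by rewrite pnatr_eq0 -lt0n.
rewrite !(generator_stat gen)//; apply: (le_trans (generator_lip _ _ gen y1)).
rewrite -mulrBr modcM modc_real ger0_norm ?invr_ge0//.
set S := \sum_i _.
apply: (@le_trans _ _ (n%:R^-1 * (n%:R * eta + eta^-1 * S))); last first.
  by rewrite mulrDr mulKf// mulrCA.
rewrite ler_wpM2l ?invr_ge0//.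
apply: (le_trans (resolvent_trace_diff symA symB y0 eta0)).
rewrite -[leRHS]mul1r ler_wpM2r//.
  rewrite addr_ge0 ?mulr_ge0 ?invr_ge0 ?(ltW eta0)//.
  by apply: sumr_ge0 => i _; apply: sumr_ge0 => j _; apply: sqr_ge0.
by rewrite invf_le1 ?exprn_gt0// exprn_ege1.
Qed.

End linear_statistic.

Section kernel_bounds.
Variables (R : realType) (sigma : R).
Hypothesis sigma0 : 0 < sigma.
Implicit Types (w v : R).

Lemma kernelC w v : Defs.kernel sigma w v = Defs.kernel sigma v w.
Proof. by rewrite /Defs.kernel maxC minC. Qed.

Lemma kernel_ge0 w v : 0 <= w -> 0 <= Defs.kernel sigma w v.
Proof. by move=> w0; rewrite mulr_ge0 ?powR_ge0// le_max w0. Qed.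

Lemma kernel_mono w v w' v' : 0 <= w -> 0 <= v -> w <= w' -> v <= v' ->
  Defs.kernel sigma w v <= Defs.kernel sigma w' v'.
Proof.
move=> w0 v0 ww vv; have w'0 := le_trans w0 ww; have v'0 := le_trans v0 vv.
rewrite /Defs.kernel; apply: ler_pM; rewrite ?powR_ge0//.
- by rewrite le_max w0.
- by rewrite ge_max !le_max ww vv orbT.
apply: ge0_ler_powR; rewrite ?nnegrE ?(ltW sigma0) ?le_min ?w0 ?v0 ?w'0 ?v'0//.
by rewrite !ge_min ww vv orbT.
Qed.

(** Homogeneity makes a geometric grid the natural discretization: rounding the weights to the grid
    costs a fixed factor, whatever their size. *)
Lemma kernel_homog r w v : 0 < r -> 0 <= w -> 0 <= v ->
  Defs.kernel sigma (r * w) (r * v) = r `^ (1 + sigma) * Defs.kernel sigma w v.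
Proof.
move=> r0 w0 v0; have r0' := ltW r0; rewrite /Defs.kernel -maxr_pMr// -minr_pMr//.
rewrite powRM ?le_min ?w0//.
rewrite powRD ?(gt_eqF r0) ?implybT// powRr1//; ring.
Qed.

(** A bound in product form, to which independence of the two weights can be applied; both exponents
    1 and [sigma] are at most [s]. *)
Lemma kernel_le_pow w v s : 1 <= w -> 1 <= v -> 1 <= s -> sigma <= s ->
  Defs.kernel sigma w v <= (w * v) `^ s.
Proof.
move=> w1 v1 s1 ss; have w0 := le_trans ler01 w1; have v0 := le_trans ler01 v1.
have -> : w * v = Num.max w v * Num.min w v.
  by case: (leP w v) => _ //; rewrite mulrC.
have M1 : 1 <= Num.max w v by rewrite le_max w1.
have m1 : 1 <= Num.min w v by rewrite le_min w1.
rewrite powRM ?(le_trans ler01)// /Defs.kernel; apply: ler_pM; rewrite ?powR_ge0 ?(le_trans ler01 M1)//.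
  by rewrite -[leLHS]powRr1 ?(le_trans ler01 M1)// ler_powR.
by rewrite ler_powR.
Qed.

End kernel_bounds.

(** * The graph with frozen weights *)

Section types.
Variables (R : realType) (sigma t0 m : R) (L : nat).
Hypotheses (sigma0 : 0 < sigma) (t00 : 0 < t0) (m1 : 1 < m) (L0 : (0 < L)%N).
Implicit Types (w v : R) (a b : 'I_L).

(** Ratio of the geometric grid [mesh ^+ k], which reaches [m] in exactly [L] steps. *)
Definition mesh : R := m `^ (L%:R^-1).

Definition cell a w : bool := mesh ^+ a < w <= mesh ^+ a.+1.

(* [None] collects the weights outside [`]1, m]]. *)
Definition type_of w : option 'I_L := [pick a | cell a w].

Definition type_kernel (x z : option 'I_L) : R :=
  if x is Some a then
    if z is Some b then Defs.kernel sigma (mesh ^+ a) (mesh ^+ b) else 0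
  else 0.

(** Pareto probabilities of the cells. [None] receives the mass above [m], since weights up to 1
    form a null event. *)
Definition type_law (x : option 'I_L) : R :=
  if x is Some a then (mesh ^+ a) `^ (- t0) - (mesh ^+ a.+1) `^ (- t0)
  else m `^ (- t0).

Let m0 : 0 < m. Proof. exact: lt_trans m1. Qed.

Lemma mesh_gt0 : 0 < mesh. Proof. exact: powR_gt0. Qed.

Lemma mesh_pow : mesh ^+ L = m.
Proof.
rewrite -powR_mulrn ?powR_ge0// -powRrM mulVf ?powRr1 ?(ltW m0)//.
by rewrite pnatr_eq0 -lt0n.
Qed.

Lemma mesh_gt1 : 1 < mesh.
Proof.
have iL : 0 < L%:R^-1 :> R by rewrite invr_gt0 ltr0n.
by have := gt0_ltr_powR iL; move/(_ 1 m); rewrite powR1 !nnegrE; apply; rewrite ?(ltW m0).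
Qed.

Lemma mesh_le k l : (k <= l)%N -> mesh ^+ k <= mesh ^+ l.
Proof. by move=> kl; apply: ler_weXn2l => //; apply: ltW mesh_gt1. Qed.

Lemma cell_uniq a b w : cell a w -> cell b w -> a = b.
Proof.
have H a' b' : cell a' w -> cell b' w -> (a' <= b')%N.
  move=> /andP[aw _] /andP[_ wb].
  by have := lt_le_trans aw wb; rewrite ltr_eXn2l// mesh_gt1.
by move=> ca cb; apply: val_inj; apply/eqP; rewrite eqn_leq !H.
Qed.

Lemma type_of_cell a w : (type_of w == Some a) = cell a w.
Proof.
rewrite /type_of; case: pickP => [b bw|no]; last by rewrite no.
apply/eqP/idP => [[<-]//|aw]; by rewrite (cell_uniq aw bw).
Qed.

Lemma cell_exists w : 1 < w -> w <= m -> exists a, cell a w.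
Proof.
move=> w1 wm; have ex : exists k, w <= mesh ^+ k by exists L; rewrite mesh_pow.
case: (ex_minnP ex) => -[|k] wk mink.
  by move: wk; rewrite expr0 leNgt w1.
have kL : (k < L)%N by apply: mink; rewrite mesh_pow.
exists (Ordinal kL); rewrite /cell/= wk andbT ltNge.
by apply/negP => /mink; rewrite ltnn.
Qed.

Lemma cell_bounds a w : cell a w -> 1 < w <= m.
Proof.
move=> /andP[aw wa]; apply/andP; split.
  by apply: le_lt_trans aw; rewrite exprn_ege1// ltW// mesh_gt1.
by apply: (le_trans wa); rewrite -[leRHS]mesh_pow mesh_le.
Qed.

Lemma type_of_None w : (type_of w == None) = ~~ (1 < w <= m).
Proof.
rewrite /type_of; case: pickP => [b /cell_bounds ->//|no].
apply/esym/negP => /andP[w1 wm].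
by have [a] := cell_exists w1 wm; rewrite no.
Qed.

Lemma type_law_ge0 x : 0 <= type_law x.
Proof.
case: x => [a|] /=; last exact: powR_ge0.
rewrite subr_ge0 !powRN lef_pV2 ?posrE ?powR_gt0 ?exprn_gt0 ?mesh_gt0//.
by rewrite ge0_ler_powR ?nnegrE ?(ltW t00)// ?exprn_ge0 ?(ltW mesh_gt0) ?mesh_le.
Qed.

Lemma type_kernel_ge0 x z : 0 <= type_kernel x z.
Proof.
case: x => [a|]//=; case: z => [b|]//=.
by rewrite kernel_ge0// exprn_ge0// ltW// mesh_gt0.
Qed.

Lemma type_kernel_le x z : type_kernel x z <= Defs.kernel sigma m m.
Proof.
have K0 : 0 <= Defs.kernel sigma m m by rewrite kernel_ge0// ltW.
case: x => [a|]//=; case: z => [b|]//=.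
by apply: kernel_mono => //; rewrite ?exprn_ge0 ?(ltW mesh_gt0)// -[leRHS]mesh_pow
  mesh_le// ltnW.
Qed.

Lemma kernel_type_close a b w v : cell a w -> cell b v ->
  `|Defs.kernel sigma w v - type_kernel (Some a) (Some b)| <=
  (mesh `^ (1 + sigma) - 1) * Defs.kernel sigma m m.
Proof.
move=> /andP[aw wa] /andP[bv vb]; have e0 k : 0 <= mesh ^+ k.
  by rewrite exprn_ge0// ltW// mesh_gt0.
have lo : type_kernel (Some a) (Some b) <= Defs.kernel sigma w v.
  by apply: kernel_mono => //; apply: ltW.
have hi : Defs.kernel sigma w v <= mesh `^ (1 + sigma) * type_kernel (Some a) (Some b).
  rewrite /= -kernel_homog ?mesh_gt0// -!exprS.
  by apply: kernel_mono => //; [apply: le_trans (ltW aw)|apply: le_trans (ltW bv)].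
have r1 : 0 <= mesh `^ (1 + sigma) - 1.
  have p1 : 1 `^ (1 + sigma) = 1 :> R by rewrite powR1.
  rewrite subr_ge0 -[leLHS]p1; apply: ge0_ler_powR; rewrite ?nnegrE ?(ltW mesh_gt1)//.
    by rewrite addr_ge0// ltW.
  by rewrite ltW// mesh_gt0.
have KM := type_kernel_le (Some a) (Some b).
rewrite ger0_norm ?subr_ge0//.
apply: (@le_trans _ _ ((mesh `^ (1 + sigma) - 1) * type_kernel (Some a) (Some b))).
  by rewrite mulrBl mul1r lerD2r.
by rewrite ler_wpM2l.
Qed.

End types.

(** Raised to the power [L], the mesh term becomes the constant [m ^ (1 + sigma)], which
    [(1 + e) ^+ L] eventually exceeds. *)
Lemma mesh_cvg1 (R : realType) (sigma m e : R) : 0 < sigma -> 1 < m -> 0 < e ->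
  exists2 L0, (0 < L0)%N & forall L, (L0 <= L)%N -> mesh m L `^ (1 + sigma) - 1 <= e.
Proof.
move=> sigma0 m1 e0; have m0 : 0 < m by apply: lt_trans m1.
have e1 : (1 + e)^-1 < 1 by rewrite invf_lt1 ?addr_gt0// ltrDl.
have e2 : 0 <= (1 + e)^-1 by rewrite invr_ge0 addr_ge0// ltW.
have mp : 0 < (m `^ (1 + sigma))^-1 by rewrite invr_gt0 powR_gt0.
have [k Hk] := expr_small e2 e1 mp.
exists k.+1 => // L kL; have L0 : (0 < L)%N by apply: leq_trans kL.
have ep : 0 < 1 + e by rewrite addr_gt0.
rewrite lerBlDl -(ler_pXn2r L0) ?nnegrE ?powR_ge0 ?(ltW ep)//.
have -> : (mesh m L `^ (1 + sigma)) ^+ L = m `^ (1 + sigma).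
  rewrite -powR_mulrn ?powR_ge0// -!powRrM; congr (_ `^ _).
  by field; rewrite pnatr_eq0 -lt0n.
rewrite -[leRHS]invrK -exprVn.
rewrite -[leLHS]invrK lef_pV2 ?posrE ?invr_gt0 ?powR_gt0 ?exprn_gt0 ?invr_gt0//.
apply: le_trans Hk; apply: ler_wiXn2l.
- by rewrite invr_ge0 ltW.
- exact: ltW.
- exact: ltnW.
Qed.

(** * Spectral estimates for deterministic weights, with constants uniform in the graph *)

Section finite_graph.
Variables (R : realType) (sigma t0 : R).
Hypotheses (sigma0 : 0 < sigma) (t00 : 0 < t0).

(** What is kept of the torus and of one sample of the weights. Weights lie strictly above 1 so that
    each one falls in a cell as soon as it is at most [m]. *)
Record admissible (n : nat) (s : 'I_n -> 'I_n -> R) (c : R) (W : 'I_n -> R) : Prop := {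
  adm_n : (0 < n)%N;
  adm_ge0 : forall i j, 0 <= s i j;
  adm_sym : forall i j, s i j = s j i;
  adm_diag : forall i, s i i = 0;
  adm_sum : forall i, \sum_j s i j = 1;
  adm_c : 1 <= c;
  adm_le : forall i j, c * s i j <= 1;
  adm_W : forall i, 1 < W i
}.

Section fixed_graph.
Variables (n : nat) (s : 'I_n -> 'I_n -> R) (c : R) (W : 'I_n -> R).

Definition kap i j : R := Defs.kernel sigma (W i) (W j).

Definition eprobs i j : R := Num.min (kap i j * (c * s i j)) 1.

Definition gmat (w : {ffun 'I_n * 'I_n -> bool}) : 'M[R]_n :=
  \matrix_(i, j) ((Num.sqrt c)^-1 * (has_edge w i j)%:R).

Definition graph_mean (f : {ffun 'I_n * 'I_n -> bool} -> R) : R := Ex (eprob eprobs) f.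

Definition spread : R := n%:R^-1 * \sum_i \sum_j c * s i j ^+ 2.

Variable m : R.

Definition light i j : bool := (W i <= m) && (W j <= m).

Definition heavy_weight : R :=
  n%:R^-1 * \sum_i \sum_j (~~ light i j)%:R * (s i j * kap i j).

Definition lbeta i j : R := (Num.sqrt c)^-1 * (light i j && (i != j))%:R.

Definition lmat w : 'M[R]_n := cmat eprobs lbeta w.

Hypotheses (m1 : 1 < m) (adm : admissible s c W).

Let s0 := adm_ge0 adm.
Let ssym := adm_sym adm.
Let c1 := adm_c adm.
Let c0 : 0 < c. Proof. exact: lt_le_trans c1. Qed.
Let n0 := adm_n adm.
Let b0 := (Num.sqrt c)^-1.
Let M := Defs.kernel sigma m m.

Let W0 i : 0 <= W i. Proof. by rewrite ltW// (lt_trans ltr01)// (adm_W adm). Qed.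

Let kap0 i j : 0 <= kap i j. Proof. exact: kernel_ge0. Qed.

Lemma kap_sym i j : kap i j = kap j i. Proof. exact: kernelC. Qed.

Let x0 i j : 0 <= kap i j * (c * s i j).
Proof. by apply: mulr_ge0; [exact: kap0|apply: mulr_ge0; [exact: ltW|exact: s0]]. Qed.

Lemma eprobs01 i j : 0 <= eprobs i j <= 1.
Proof. by rewrite /eprobs le_min x0 ler01 ge_min lexx orbT. Qed.

Lemma eprobs_sym i j : eprobs i j = eprobs j i.
Proof. by rewrite /eprobs kap_sym ssym. Qed.

Lemma eprobs_le i j : eprobs i j <= kap i j * (c * s i j).
Proof. by rewrite ge_min lexx. Qed.

Lemma b0_sqr : b0 ^+ 2 = c^-1.
Proof. by rewrite exprVn sqr_sqrtr// ltW. Qed.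

Lemma b0_bounds : 0 < b0 <= 1.
Proof.
have q1 : 1 <= Num.sqrt c by rewrite -sqrtr1 ler_wsqrtr.
by rewrite invr_gt0 sqrtr_gt0 c0/= invf_le1// sqrtr_gt0.
Qed.

(** Each [c * s i j] is at most 1 and a row of them adds up to [c], so [c <= n]. This makes the
    uniform weights [1 / n] of the normalized trace eligible for [Ex_trace_dev]. *)
Lemma invn_le : n%:R^-1 <= b0 ^+ 2.
Proof.
rewrite b0_sqr lef_pV2 ?posrE ?ltr0n//.
apply: (@le_trans _ _ (c * \sum_j s (Ordinal n0) j)).
  by rewrite (adm_sum adm) mulr1.
rewrite mulr_sumr.
have -> : n%:R = \sum_(j < n) 1 :> R by rewrite sumr_const card_ord.
apply: ler_sum => j _.
exact: (adm_le adm).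
Qed.

Lemma light_sym i j : light i j = light j i.
Proof. by rewrite /light andbC. Qed.

Lemma lbeta_ge0 i j : 0 <= lbeta i j.
Proof. by rewrite mulr_ge0 ?invr_ge0 ?sqrtr_ge0. Qed.

Lemma lbeta_le i j : lbeta i j <= b0.
Proof.
have /andP[b _] := b0_bounds; rewrite -[leRHS]mulr1 ler_wpM2l ?(ltW b)//.
by case: (_ && _); rewrite ?ler01.
Qed.

Lemma lbeta_sym i j : lbeta i j = lbeta j i.
Proof. by rewrite /lbeta light_sym eq_sym. Qed.

Lemma lbeta_diag i : lbeta i i = 0.
Proof. by rewrite /lbeta eqxx andbF mulr0. Qed.

Lemma lmat_sym w : (lmat w)^T = lmat w.
Proof. exact: cmat_sym eprobs_sym lbeta_sym w. Qed.

Lemma gmat_sym w : (gmat w)^T = gmat w.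
Proof. by apply/matrixP => i j; rewrite !mxE has_edgeC. Qed.

Lemma M1 : 1 <= M.
Proof.
have <- : Defs.kernel sigma 1 1 = 1 by rewrite /Defs.kernel maxxx minxx powR1 mulr1.
by apply: kernel_mono => //; apply: ltW.
Qed.

Lemma kap_light i j : light i j -> kap i j <= M.
Proof. by move=> /andP[wi wj]; apply: kernel_mono. Qed.

Local Notation v := (vprof eprobs lbeta).

Lemma vprofE i j : v i j = (light i j)%:R * (c^-1 * (eprobs i j * (1 - eprobs i j))).
Proof.
rewrite /vprof /lbeta exprMn -/b0 b0_sqr; have [->|ne] := eqVneq i j.
  have -> : eprobs j j = 0 by rewrite /eprobs (adm_diag adm) !mulr0; apply/min_idPl.
  by rewrite !(mul0r, mulr0).
by rewrite andbT; case: (light i j); rewrite ?expr1n ?expr0n/=; ring.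
Qed.

Lemma vprof_le_s i j : v i j <= M * s i j.
Proof.
rewrite vprofE; case: (boolP (light i j)) => [li|_]; last first.
  by rewrite mul0r mulr_ge0// (le_trans ler01 M1).
rewrite mul1r; have /andP[p0 p1] := eprobs01 i j.
apply: (@le_trans _ _ (c^-1 * (kap i j * (c * s i j)))).
  rewrite ler_wpM2l ?invr_ge0 ?(ltW c0)//; apply: le_trans (eprobs_le i j).
  by rewrite -[leRHS]mulr1 ler_wpM2l// lerBlDr lerDl.
have -> : c^-1 * (kap i j * (c * s i j)) = kap i j * s i j by field; rewrite gt_eqF.
by rewrite ler_wpM2r// kap_light.
Qed.

Lemma vprof_sum i : \sum_j v i j <= M.
Proof.
apply: (le_trans (ler_sum _ (fun j _ => vprof_le_s i j))).
by rewrite -mulr_sumr (adm_sum adm) mulr1.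
Qed.

Section discretized.
Import complex.
Local Open Scope complex_scope.
Variable L : nat.
Hypothesis L0 : (0 < L)%N.

Definition wtype i := type_of m L (W i).

Local Notation tK := (@type_kernel R sigma m L).
Local Notation delta := (mesh m L `^ (1 + sigma) - 1).

Lemma wtype_light i j : light i j ->
  `|kap i j - tK (wtype i) (wtype j)| <= delta * M.
Proof.
move=> /andP[wi wj].
have [a ca] := cell_exists m1 L0 (adm_W adm i) wi.
have [b cb] := cell_exists m1 L0 (adm_W adm j) wj.
have -> : wtype i = Some a by apply/eqP; rewrite /wtype type_of_cell.
have -> : wtype j = Some b by apply/eqP; rewrite /wtype type_of_cell.
exact: kernel_type_close.
Qed.

Lemma wtype_heavy i j : ~~ light i j -> tK (wtype i) (wtype j) = 0.
Proof.
have None_heavy k : W k <= m = false -> wtype k = None.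
  by move=> Wk; apply/eqP; rewrite /wtype type_of_None// Wk andbF.
rewrite negb_and => /orP[] /negbTE /None_heavy ->//.
by case: (wtype i).
Qed.

(** Two errors occur: rounding the weights, measured by [delta], and replacing [p * (1 - p)] by the
    unclipped [x]. In the latter, the clipping loss [x - p] and the square [p ^+ 2] are both at most
    [x ^+ 2], a term of the kind summed in [spread]. *)
Lemma vprof_close i j :
  `|v i j - s i j * tK (wtype i) (wtype j)| <=
  delta * M * s i j + 2 * M ^+ 2 * (c * s i j ^+ 2).
Proof.
have d0 : 0 <= delta.
  have p1 : 1 `^ (1 + sigma) = 1 :> R by rewrite powR1.
  rewrite subr_ge0 -[leLHS]p1 ge0_ler_powR ?nnegrE ?ler01 ?(ltW (mesh_gt1 m1 L0))//.
    by rewrite addr_ge0// ltW.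
  by rewrite ltW// mesh_gt0.
have M0 : 0 <= M by apply: le_trans M1.
rewrite vprofE; case: (boolP (light i j)) => [li|li]; last first.
  rewrite wtype_heavy// mulr0 mul0r subrr normr0.
  have sij := s0 i j; have cc := ltW c0.
  apply: addr_ge0; first by apply: mulr_ge0 => //; apply: mulr_ge0.
  by apply: mulr_ge0; apply: mulr_ge0 => //; apply: sqr_ge0.
rewrite mul1r; set p := eprobs i j; set x := kap i j * (c * s i j).
have -> : c^-1 * (p * (1 - p)) - s i j * tK (wtype i) (wtype j) =
    (kap i j - tK (wtype i) (wtype j)) * s i j + c^-1 * (p * (1 - p) - x).
  by rewrite /x; field; rewrite gt_eqF.
apply: (le_trans (ler_normD _ _)); apply: lerD.
  by rewrite normrM (ger0_norm (s0 i j)) ler_wpM2r// wtype_light.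
have px : p <= x by apply: eprobs_le.
have /andP[p0 p1] : 0 <= p <= 1 by apply: eprobs01.
have x00 : 0 <= x := x0 i j.
have xp : x - p <= x ^+ 2.
  rewrite /p /eprobs -/x; case: (leP x 1) => [_|x1]; first by rewrite subrr sqr_ge0.
  have : 0 <= x * (x - 1) by apply: mulr_ge0 => //; rewrite subr_ge0 ltW.
  by rewrite mulrBr mulr1 -expr2; lra.
have p2 : p ^+ 2 <= x ^+ 2 by rewrite lerXn2r ?nnegrE.
rewrite normrM gtr0_norm ?invr_gt0//.
apply: (@le_trans _ _ (c^-1 * (2 * x ^+ 2))).
  rewrite ler_wpM2l ?invr_ge0 ?(ltW c0)//.
  by rewrite ler_norml; apply/andP; split; have := sqr_ge0 p; have := sqr_ge0 x;
    move: px xp p2; rewrite mulrBr mulr1 -expr2; lra.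
have -> : c^-1 * (2 * x ^+ 2) = 2 * kap i j ^+ 2 * (c * s i j ^+ 2).
  by rewrite /x; field; rewrite gt_eqF.
apply: ler_wpM2r; first by rewrite mulr_ge0 ?sqr_ge0// ltW.
by rewrite ler_wpM2l// lerXn2r ?nnegrE// kap_light.
Qed.

Definition type_error : R := type_defect (@type_law R t0 m L) s wtype.

Lemma type_error_ge0 : 0 <= type_error.
Proof.
apply: sumr_ge0 => a _; rewrite mulr_ge0 ?invr_ge0//.
by apply: sumr_ge0 => i _; apply: normr_ge0.
Qed.

Lemma spread_ge0 : 0 <= spread.
Proof.
rewrite mulr_ge0 ?invr_ge0//; apply: sumr_ge0 => i _; apply: sumr_ge0 => j _.
by rewrite mulr_ge0 ?sqr_ge0// ltW.
Qed.

Lemma kernel_defect_le :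
  kernel_defect tK v s wtype <= delta * M + 2 * M ^+ 2 * spread.
Proof.
have nK : n%:R^-1 * n%:R = 1 :> R by rewrite mulVf// pnatr_eq0 -lt0n.
rewrite /kernel_defect.
apply: (@le_trans _ _ (n%:R^-1 * \sum_i \sum_j
    (delta * M * s i j + 2 * M ^+ 2 * (c * s i j ^+ 2)))).
  rewrite ler_wpM2l ?invr_ge0//; apply: ler_sum => i _; apply: ler_sum => j _.
  exact: vprof_close.
have row i : \sum_j (delta * M * s i j + 2 * M ^+ 2 * (c * s i j ^+ 2)) =
    delta * M + 2 * M ^+ 2 * \sum_j c * s i j ^+ 2.
  by rewrite big_split/= -mulr_sumr -mulr_sumr (adm_sum adm) mulr1.
under eq_bigr do rewrite row.
rewrite big_split/= sumr_const card_ord -mulr_sumr mulrDr /spread.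
by rewrite -(mulr_natl (delta * M)) (mulrA _ _ (delta * M)) nK mul1r lerD2l mulrCA.
Qed.

(** The statistic is within a concentration error of its mean, and the mean within a stability error
    of the Picard iterate; the latter contains the residual of the self-consistent equation and both
    defects. *)
Lemma lmat_stat_close y f phi k : is_generator y f phi -> 1 <= y -> 2 * M <= y ^+ 2 ->
  graph_mean (fun w =>
    `|lin_stat (lmat w) f - phi (iterate_mean tK (@type_law R t0 m L) y k)|) <=
  2^-1 ^+ k + 2 * (delta * M) + 120 * M ^+ 2 * (type_error + spread + b0).
Proof.
move=> gen y1 yM.
have M0 : 0 <= M by apply: le_trans M1.
have /andP[bp b1] := b0_bounds; have bge := ltW bp.
pose G w := resolvent (lmat w) y.
pose u i := ExC (eprob eprobs) (fun w => G w i i).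
pose d (i : 'I_n) : R := n%:R^-1.
have p01 := eprobs01; have psym := eprobs_sym.
have b_ge0 := lbeta_ge0; have b_le := lbeta_le.
have b_sym := lbeta_sym; have b_diag := lbeta_diag.
have dev : graph_mean (fun w => modc (\sum_i (d i)%:C * G w i i -
    \sum_i (d i)%:C * u i)) <= 32 * M * b0.
  apply: (Ex_trace_dev p01 psym b_ge0 b_le b_sym b_diag bge b1 y1 M1 vprof_sum
    (D := n%:R^-1) (S := 1)).
  - by rewrite invr_ge0.
  - by move=> i; rewrite /d lexx invr_ge0 andbT.
  - by rewrite sumr_const card_ord -(mulr_natl n%:R^-1) mulfV// pnatr_eq0 -lt0n.
  - exact: invn_le.
  - exact: M1.
have mean : modc ((n%:R^-1)%:C * \sum_i u i -
    iterate_mean tK (@type_law R t0 m L) y k) <=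
    2^-1 ^+ k + 2 * ((40 * M + 1) * b0 + kernel_defect tK v s wtype + M * type_error) +
    type_error.
  apply: mean_close => //.
  - by move=> a b; apply: type_kernel_ge0.
  - by move=> a; apply: type_law_ge0.
  - by move=> a b; apply: type_kernel_le.
  - exact: M1.
  - by move=> i j; apply: vprof_ge0.
  - by move=> i j; apply: vprof_sym.
  - exact: vprof_sum.
  - exact: adm_sum adm.
  - by move=> i; apply: Im_EC_res_ge0.
  - by move=> i; apply: (modc_EC_res p01 psym b_sym y1).
  - move=> i; apply: (approx_self_consistency p01 psym b_ge0 b_le b_sym b_diag bge b1 y1 M1).
    exact: vprof_sum.
have phi_le w : `|lin_stat (lmat w) f - phi (iterate_mean tK (@type_law R t0 m L) y k)| <=
    modc (\sum_i (d i)%:C * G w i i - \sum_i (d i)%:C * u i) +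
    modc ((n%:R^-1)%:C * \sum_i u i - iterate_mean tK (@type_law R t0 m L) y k).
  rewrite (generator_stat gen (lmat_sym w) y1).
  apply: (le_trans (generator_lip _ _ gen y1)).
  have sumd (F : 'I_n -> R[i]) : \sum_i (d i)%:C * F i = (n%:R^-1)%:C * \sum_i F i.
    by rewrite mulr_sumr.
  by apply: le_trans (modcD _ _); rewrite !sumd subrKA.
have step : graph_mean (fun w =>
    `|lin_stat (lmat w) f - phi (iterate_mean tK (@type_law R t0 m L) y k)|) <=
    32 * M * b0 + (2^-1 ^+ k + 2 * ((40 * M + 1) * b0 + kernel_defect tK v s wtype +
    M * type_error) + type_error).
  apply: (le_trans (le_Ex (eprob01 p01) phi_le)).
  by rewrite ExD Ex_cst; apply: lerD.
apply: (le_trans step).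
have H := kernel_defect_le; have E0 := type_error_ge0; have S0 := spread_ge0.
have MM : M <= M ^+ 2 by rewrite expr2 -[leLHS]mul1r ler_wpM2r// M1.
have MM1 : 1 <= M ^+ 2 by apply: le_trans MM; apply: M1.
move: H E0 S0 MM MM1 bge M0; set H := kernel_defect _ _ _ _; set E := type_error.
set S := spread; set D := delta * M; set x := 2^-1 ^+ k; set Q := M ^+ 2.
clearbody M b0 H E S D x Q; clear; move=> HD E0 S0 MQ Q1 b00 M0.
(* As [M >= 1], every coefficient is dominated by a multiple of [Q = M ^+ 2]; the largest one,
   [32 * M + 2 * (40 * M + 1)] in front of [b0], is at most [114 * Q]. *)
have e1 : M * E <= Q * E by rewrite ler_wpM2r.
have e2 : E <= Q * E by rewrite -[leLHS]mul1r ler_wpM2r.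
have e3 : M * b0 <= Q * b0 by rewrite ler_wpM2r.
have e4 : b0 <= Q * b0 by rewrite -[leLHS]mul1r ler_wpM2r.
have e5 : 0 <= Q * S by rewrite mulr_ge0// (le_trans ler01).
have e6 : 0 <= Q * E by rewrite mulr_ge0// (le_trans ler01).
have e7 : 0 <= Q * b0 by rewrite mulr_ge0// (le_trans ler01).
lra.
Qed.

End discretized.

Lemma Ex_edge (E : finType) (q : E -> R) e : Ex q (fun w => (w e)%:R) = q e.
Proof.
have := Ex_centered q e (fun=> 1); rewrite (@eq_Ex _ _ _ _ (fun w => (w e)%:R - q e)).
  rewrite ExB Ex_cst (@eq_Ex _ _ _ (jump e _) (fun=> 0)) ?Ex_cst ?mulr0.
    by move/eqP; rewrite subr_eq0 => /eqP.
  by move=> w; rewrite /jump subrr.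
by move=> w; rewrite mulr1.
Qed.

Lemma graph_mean_edge i j : i != j ->
  graph_mean (fun w => (has_edge w i j)%:R) = eprobs i j.
Proof.
move=> ij; rewrite -(eprob_edge eprobs_sym ij) -Ex_edge.
by apply: eq_Ex => w; rewrite /has_edge ij.
Qed.

(** A light entry changes only by the centering [eprobs i j / sqrt c], whose square is of the kind
    summed in [spread]. A heavy entry is deleted, and its mean square is its edge probability over
    [c]. *)
Lemma entry_diff i j :
  graph_mean (fun w => (gmat w i j - lmat w i j) ^+ 2) <=
  M ^+ 2 * (c * s i j ^+ 2) + (~~ light i j)%:R * (s i j * kap i j).
Proof.
have cV : 0 <= c^-1 by rewrite invr_ge0 ltW.
have r0 : 0 <= M ^+ 2 * (c * s i j ^+ 2).
  by apply: mulr_ge0; rewrite ?sqr_ge0// mulr_ge0 ?sqr_ge0// ltW.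
have h0 : 0 <= (~~ light i j)%:R * (s i j * kap i j).
  by apply: mulr_ge0 => //; apply: mulr_ge0; [apply: s0|apply: kap0].
have [ij|ij] := eqVneq i j.
  rewrite /graph_mean (@eq_Ex _ _ _ _ (fun=> 0)) ?Ex_cst ?addr_ge0// => w.
  by rewrite !mxE ij lbeta_diag /has_edge eqxx/= mul0r mulr0 subrr expr0n.
have [li|li] := boolP (light i j).
  rewrite mul0r addr0 /graph_mean (@eq_Ex _ _ _ _ (fun=> c^-1 * eprobs i j ^+ 2)); last first.
    move=> w; rewrite !mxE /lbeta li ij/= mulr1 mulrBr opprB addrC subrK.
    by rewrite exprMn -/b0 b0_sqr.
  rewrite Ex_cst; have /andP[p0 p1] := eprobs01 i j.
  apply: (@le_trans _ _ (c^-1 * (kap i j * (c * s i j)) ^+ 2)).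
    by rewrite ler_wpM2l// lerXn2r ?nnegrE ?eprobs_le//; apply: x0.
  have -> : c^-1 * (kap i j * (c * s i j)) ^+ 2 = kap i j ^+ 2 * (c * s i j ^+ 2).
    by field; rewrite gt_eqF.
  apply: ler_wpM2r; first by rewrite mulr_ge0 ?sqr_ge0// ltW.
  by rewrite lerXn2r ?nnegrE ?kap_light ?(le_trans ler01 M1)//; apply: kap0.
rewrite mul1r; apply: (@le_trans _ _ (s i j * kap i j)); last by rewrite lerDr.
rewrite /graph_mean (@eq_Ex _ _ _ _ (fun w => c^-1 * (has_edge w i j)%:R)); last first.
  move=> w; rewrite !mxE /lbeta (negbTE li)/= mulr0 mul0r subr0 exprMn -/b0 b0_sqr.
  by case: (has_edge w i j); rewrite ?expr1n ?expr0n.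
rewrite ExZ -/(graph_mean _) graph_mean_edge// ler_pdivrMl// mulrCA mulrC [c * _]mulrC.
by apply: (le_trans (eprobs_le i j)); rewrite mulrA mulrC [_ * c]mulrC.
Qed.

Lemma gmat_lmat_close :
  graph_mean (fun w => n%:R^-1 * \sum_i \sum_j (gmat w i j - lmat w i j) ^+ 2) <=
  M ^+ 2 * spread + heavy_weight.
Proof.
rewrite /graph_mean ExZ Ex_sum /spread /heavy_weight mulrCA -mulrDr.
rewrite ler_wpM2l ?invr_ge0// mulr_sumr -big_split/=; apply: ler_sum => i _.
rewrite Ex_sum mulr_sumr -big_split/=; apply: ler_sum => j _.
exact: entry_diff.
Qed.

Lemma gmat_sqr_mean :
  graph_mean (fun w => lin_stat (gmat w) (fun x => x ^+ 2)) <=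
  n%:R^-1 * \sum_i \sum_j s i j * kap i j.
Proof.
rewrite /graph_mean (@eq_Ex _ _ _ _ (fun w => n%:R^-1 * \sum_i \sum_j gmat w i j ^+ 2)); last first.
  by move=> w; rewrite lin_stat_sqr// gmat_sym.
rewrite ExZ ler_wpM2l ?invr_ge0// Ex_sum; apply: ler_sum => i _.
rewrite Ex_sum; apply: ler_sum => j _.
rewrite (@eq_Ex _ _ _ _ (fun w => c^-1 * (has_edge w i j)%:R)); last first.
  move=> w; rewrite !mxE exprMn -/b0 b0_sqr.
  by case: (has_edge w i j); rewrite ?expr1n ?expr0n.
have [ij|ij] := eqVneq i j.
  rewrite (@eq_Ex _ _ _ _ (fun=> 0)) ?Ex_cst => [|w].
    by apply: mulr_ge0; [apply: s0|apply: kap0].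
  by rewrite /has_edge ij eqxx mulr0.
rewrite ExZ -/(graph_mean _) graph_mean_edge//.
apply: (@le_trans _ _ (c^-1 * (kap i j * (c * s i j)))).
  by rewrite ler_wpM2l ?invr_ge0 ?(ltW c0)//; apply: eprobs_le.
by rewrite le_eqVlt; apply/orP; left; apply/eqP; field; rewrite gt_eqF.
Qed.

End fixed_graph.

(** [l] may depend on the tolerance and on [L], but it precedes the graph. All [L] beyond a
    threshold are allowed so that two functions can share one discretization. The term with [C] will
    vanish in mean as the torus grows. *)
Definition light_universal (m : R) (f : R -> R) : Prop :=
  forall e : R, 0 < e -> exists L0, forall L, (L0 <= L)%N -> (0 < L)%N ->
  exists l C : R, 0 <= C /\ forall n (s : 'I_n -> 'I_n -> R) c W, admissible s c W ->
  graph_mean s c W (fun w => `|lin_stat (lmat s c W m w) f - l|) <=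
  e + C * (type_error s W m L + spread s c + (Num.sqrt c)^-1).

Section light_universal.
Variable m : R.
Hypothesis m1 : 1 < m.
Local Notation M := (Defs.kernel sigma m m).

Let err_ge0 n (s : 'I_n -> 'I_n -> R) c W L : admissible s c W ->
  0 <= type_error s W m L + spread s c + (Num.sqrt c)^-1.
Proof.
move=> adm; apply: addr_ge0; last by rewrite invr_ge0 sqrtr_ge0.
by apply: addr_ge0; [apply: type_error_ge0|apply: spread_ge0 adm].
Qed.

Lemma light_universal_one : light_universal m (fun=> 1).
Proof.
move=> e e0; exists 0%N => L _ _; exists 1, 0; split => // n s c W adm.
rewrite /graph_mean (@eq_Ex _ _ _ _ (fun=> 0)) ?Ex_cst ?mul0r ?addr0 ?(ltW e0)// => w.
by rewrite lin_stat_cst ?subrr ?normr0 ?(lmat_sym _ adm)// (adm_n adm).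
Qed.

Lemma light_universal_add f g : light_universal m f -> light_universal m g ->
  light_universal m (fun x => f x + g x).
Proof.
move=> Uf Ug e e0; have e20 : 0 < e / 2 by rewrite divr_gt0.
have [L1 H1] := Uf _ e20; have [L2 H2] := Ug _ e20.
exists (maxn L1 L2) => L; rewrite geq_max => /andP[L1L L2L] L0.
have [l1 [C1 [C10 K1]]] := H1 L L1L L0; have [l2 [C2 [C20 K2]]] := H2 L L2L L0.
exists (l1 + l2), (C1 + C2); split; first exact: addr_ge0.
move=> n s c W adm; have := lerD (K1 _ _ _ _ adm) (K2 _ _ _ _ adm).
have E0 := err_ge0 L adm; move: E0; set E := type_error _ _ _ _ + _ + _ => E0 K.
have -> : e + (C1 + C2) * E = e / 2 + C1 * E + (e / 2 + C2 * E) by field.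
apply: le_trans K; rewrite /graph_mean -ExD; apply: le_Ex; first exact: eprob01 (eprobs01 adm).
move=> w; rewrite lin_statD opprD addrACA; exact: ler_normD.
Qed.

Lemma light_universal_scale k f : light_universal m f ->
  light_universal m (fun x => k * f x).
Proof.
move=> Uf e e0; have k0 : 0 < `|k| + 1 by rewrite ltr_wpDl.
have ek : 0 < e / (`|k| + 1) by rewrite divr_gt0.
have [L1 H1] := Uf _ ek; exists L1 => L L1L L0.
have [l [C [C0 K]]] := H1 L L1L L0; exists (k * l), ((`|k| + 1) * C); split.
  by rewrite mulr_ge0// ltW.
move=> n s c W adm; have := K _ _ _ _ adm.
rewrite /graph_mean (@eq_Ex _ _ _ (fun w => `|lin_stat _ (fun x => k * f x) - k * l|)
  (fun w => `|k| * `|lin_stat (lmat s c W m w) f - l|)); last first.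
  by move=> w; rewrite lin_statZ -mulrBr normrM.
rewrite ExZ; set X := Ex _ _; set E := type_error _ _ _ _ + _ + _ => XE.
have X0 : 0 <= X by apply: Ex_ge0 => //; exact: eprob01 (eprobs01 adm).
apply: (@le_trans _ _ ((`|k| + 1) * X)); first by rewrite ler_wpM2r// lerDl.
have -> : e + (`|k| + 1) * C * E = (`|k| + 1) * (e / (`|k| + 1) + C * E).
  by field; rewrite gt_eqF.
by rewrite ler_wpM2l// ltW.
Qed.

Lemma light_universal_lim f :
  (forall e, 0 < e -> exists2 g, light_universal m g & forall x, `|f x - g x| <= e) ->
  light_universal m f.
Proof.
move=> Uf e e0; have e20 : 0 < e / 2 by rewrite divr_gt0.
have [g Ug fg] := Uf _ e20; have [L1 H1] := Ug _ e20; exists L1 => L L1L L0.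
have [l [C [C0 K]]] := H1 L L1L L0; exists l, C; split => // n s c W adm.
have := K _ _ _ _ adm; set E := type_error _ _ _ _ + _ + _ => KE.
have -> : e + C * E = e / 2 + (e / 2 + C * E) by field.
apply: le_trans (_ : e / 2 + _ <= _); last by rewrite lerD2l; apply: KE.
rewrite /graph_mean -[X in _ <= X + _](Ex_cst (eprob (eprobs s c W))) -ExD.
apply: le_Ex; first exact: eprob01 (eprobs01 adm).
move=> w; rewrite -(subrKA (lin_stat (lmat s c W m w) g)).
apply: (le_trans (ler_normD _ _)); rewrite lerD2r.
by apply: lin_stat_unif => //; [exact: lmat_sym adm _|exact: adm_n adm].
Qed.

Lemma light_universal_gen y f phi : is_generator y f phi -> 1 <= y ->
  2 * M <= y ^+ 2 -> light_universal m f.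
Proof.
move=> gen y1 yM e e0.
have M1' : 1 <= M := M1 m1.
have M0 : 0 < M by apply: lt_le_trans M1'.
have e2 : 0 < e / 2 by rewrite divr_gt0.
have e4 : 0 < e / (4 * M) by rewrite divr_gt0// mulr_gt0.
have [||k Hk] := @expr_small R 2^-1 (e / 2) _ _ e2; rewrite ?invr_ge0// ?invf_lt1 ?ltr1n//.
have [L0 L00 HL] := mesh_cvg1 sigma0 m1 e4.
exists L0 => L L0L Lp.
exists (phi (iterate_mean (@type_kernel R sigma m L) (@type_law R t0 m L) y k)), (120 * M ^+ 2).
split; first by rewrite mulr_ge0// sqr_ge0.
move=> n s c W adm; apply: (le_trans (lmat_stat_close m1 adm Lp k gen y1 yM)).
rewrite lerD2r; have -> : e = e / 2 + 2 * (e / (4 * M) * M) by field; rewrite gt_eqF.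
by apply: lerD => //; rewrite ler_wpM2l// ler_wpM2r ?(ltW M0)// HL.
Qed.

(** The condition [2 * M <= y ^+ 2] holds from [y0] on, and the generators with [y >= 1] already lie
    in [clspan y0]; the dependence of [y] on [m] disappears here. *)
Lemma light_universal_clspan f : clspan 1 f -> light_universal m f.
Proof.
pose y0 := Num.max 1 (2 * M).
have y01 : 1 <= y0 by rewrite le_max lexx.
have M1' : 1 <= M := M1 m1.
have yok y : y0 <= y -> 1 <= y /\ 2 * M <= y ^+ 2.
  move=> yy; have y1 : 1 <= y := le_trans y01 yy; split => //.
  apply: (@le_trans _ _ y); first by apply: le_trans yy; rewrite le_max lexx orbT.
  by rewrite expr2 -[leLHS]mul1r ler_wpM2r// (le_trans ler01).
have big g : clspan y0 g -> light_universal m g.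
  apply: clspan_minimal.
  - exact: light_universal_one.
  - move=> y /yok[y1 yM].
    by apply: (light_universal_gen (phi := fun z => y^-1 * complex.Im z) _ y1 yM); left.
  - move=> y /yok[y1 yM].
    by apply: (light_universal_gen (phi := @complex.Re R) _ y1 yM); right.
  - exact: light_universal_add.
  - exact: light_universal_scale.
  - exact: light_universal_lim.
elim=> {f}.
- exact: light_universal_one.
- by move=> y y1; apply: big; apply: clspan_lorentz_small.
- by move=> y y1; apply: big; apply: clspan_odd_lorentz_small.
- by move=> f g _ Uf _ Ug; apply: light_universal_add.
- by move=> k f _ Uf; apply: light_universal_scale.
- move=> g f _ Ug fg; apply: light_universal_lim => e e0.
  by exists (g e); [apply: Ug|apply: fg].
Qed.

(** Since [y] is now free of [m], the truncation level can later be sent to infinity with [f] fixed.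
    Truncation and centering are paid for by the Hilbert-Schmidt bound with Young weight [eta]. *)
Lemma gmat_universal y f phi (eta : R) : is_generator y f phi -> 1 <= y -> 0 < eta ->
  exists (L : nat) (l C : R), [/\ (0 < L)%N, 0 <= C &
  forall n (s : 'I_n -> 'I_n -> R) c W, admissible s c W ->
  graph_mean s c W (fun w => `|lin_stat (gmat c w) f - l|) <=
  2 * eta + eta^-1 * heavy_weight s W m +
  C * (type_error s W m L + spread s c + (Num.sqrt c)^-1)].
Proof.
move=> gen y1 eta0; have clf : clspan 1 f.
  by case: gen => [[-> _]|[-> _]]; [apply: clspan_even|apply: clspan_odd].
have [L0 H] := light_universal_clspan clf eta0.
have [l [C [C0 K]]] := H (maxn L0 1) (leq_maxl _ _) (leq_maxr _ _).
exists (maxn L0 1), l, (C + eta^-1 * M ^+ 2); split; first exact: leq_maxr.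
  by rewrite addr_ge0// mulr_ge0 ?invr_ge0 ?(ltW eta0)// sqr_ge0.
move=> n s c W adm; have := K _ _ _ _ adm.
have T0 : 0 <= type_error s W m (maxn L0 1) by apply: type_error_ge0.
have S0 := spread_ge0 adm.
have B0 : 0 <= (Num.sqrt c)^-1 by rewrite invr_ge0 sqrtr_ge0.
set T := type_error _ _ _ _ in T0 *; set B := (Num.sqrt c)^-1 in B0 *.
set S := spread s c in S0 * => KE.
have D := gmat_lmat_close m1 adm.
have eV : 0 <= eta^-1 by rewrite invr_ge0 ltW.
apply: (@le_trans _ _ (eta + eta^-1 * (M ^+ 2 * S + heavy_weight s W m) +
    (eta + C * (T + S + B)))).
  apply: le_trans (lerD (lerD (lexx eta) (ler_wpM2l eV D)) KE).
  rewrite /graph_mean -ExZ -[X in _ <= X + _ + _](Ex_cst (eprob (eprobs s c W))) -!ExD.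
  apply: le_Ex; first exact: eprob01 (eprobs01 adm).
  move=> w; rewrite -(subrKA (lin_stat (lmat s c W m w) f)).
  apply: (le_trans (ler_normD _ _)); rewrite lerD2r.
  by apply: (generator_stat_diff gen y1 (adm_n adm) (gmat_sym _ w) (lmat_sym _ adm w) eta0).
rewrite -subr_ge0; set h := heavy_weight _ _ _.
have -> : 2 * eta + eta^-1 * h + (C + eta^-1 * M ^+ 2) * (T + S + B) -
  (eta + eta^-1 * (M ^+ 2 * S + h) + (eta + C * (T + S + B))) =
  eta^-1 * M ^+ 2 * (T + B) by ring.
by rewrite mulr_ge0 ?addr_ge0// mulr_ge0// sqr_ge0.
Qed.

End light_universal.
End finite_graph.

(** * The torus *)

Section torus.
Variables (d N : nat).
Hypothesis N0 : (0 < N)%N.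
Implicit Types i j k : vertex d N.

Definition circ (a b : nat) : nat := minn `|a - b| (N - `|a - b|).

Definition translate k j : vertex d N :=
  [ffun l => Ordinal (ltn_pmod (j l + k l) N0)].

Definition rotation i j : vertex d N :=
  [ffun l => Ordinal (ltn_pmod (j l + (N - i l)) N0)].

Lemma modn_add_small a b : (a < N)%N -> (b < N)%N ->
  ((a + b) %% N = if (a + b < N) then a + b else a + b - N)%N.
Proof.
move=> aN bN; case: ltnP => abN; first by rewrite modn_small.
rewrite -{1}(subnK abN) modnDr modn_small//; lia.
Qed.

Lemma circ_shift (a b k : nat) : (a < N)%N -> (b < N)%N -> (k < N)%N ->
  circ ((a + k) %% N) ((b + k) %% N) = circ a b.
Proof.
move=> aN bN kN; rewrite /circ !modn_add_small//.
by case: ltnP => ?; case: ltnP => ?; lia.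
Qed.

Lemma torus_distE i j : torus_dist i j = (\sum_(l < d) circ (i l) (j l))%N.
Proof. by []. Qed.

Lemma torus_dist_translate k i j : torus_dist (translate k i) (translate k j) = torus_dist i j.
Proof.
by rewrite !torus_distE; apply: eq_bigr => l _; rewrite !ffunE/= circ_shift.
Qed.

Lemma translate_inj k : injective (translate k).
Proof.
move=> i j /ffunP E; apply/ffunP => l; apply: val_inj.
have /(congr1 val) := E l; rewrite !ffunE/= !modn_add_small//.
have iN := ltn_ord (i l); have jN := ltn_ord (j l); have kN := ltn_ord (k l).
rewrite -!/(nat_of_ord _).
by case: (ltnP (i l + k l)) => ?; case: (ltnP (j l + k l)) => ?; lia.
Qed.

Lemma translate_rotation i j : translate (rotation i j) i = j.
Proof.
apply/ffunP => l; apply: val_inj; rewrite !ffunE/=.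
rewrite modnDmr addnCA subnKC ?(ltnW (ltn_ord _))// modnDr modn_small//.
Qed.

Lemma torus_dist_sym i j : torus_dist i j = torus_dist j i.
Proof. by rewrite !torus_distE; apply: eq_bigr => l _; rewrite /circ distnC. Qed.

Lemma torus_dist_gt0 i j : i != j -> (0 < torus_dist i j)%N.
Proof.
move=> ij; have [l ijl] : exists l, i l != j l.
  apply/existsP; apply: contraR ij => /existsPn H.
  by apply/eqP/ffunP => l; apply/eqP; have := H l; rewrite negbK.
rewrite torus_distE (bigD1 l)//= ltn_addr// /circ.
have ne : (i l != j l :> nat) by [].
by have := ltn_ord (i l); have := ltn_ord (j l); lia.
Qed.

Lemma torus_dist_le i j : (torus_dist i j <= d * N)%N.
Proof.
rewrite torus_distE; apply: (@leq_trans (\sum_(l < d) N)).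
  by apply: leq_sum => l _; rewrite /circ; lia.
by rewrite sum_nat_const card_ord.
Qed.

Lemma card_ball i (r : nat) :
  (#|[set j | torus_dist i j <= r]%SET| <= (r.*2.+1) ^ d)%N.
Proof.
(* Coordinates relative to [i], shifted by [r] modulo [N]: on the ball they take values from 0 to
   [2 * r], and they determine [j]. *)
pose g j : {ffun 'I_d -> 'I_(r.*2.+1)} := [ffun l => inord ((rotation i j l + r) %% N)].
have gE j l : (torus_dist i j <= r)%N -> val (g j l) = ((rotation i j l + r) %% N)%N.
  move=> jr; rewrite ffunE/= inordK// ltnS.
  have cr : (circ (i l) (j l) <= r)%N.
    by apply: leq_trans jr; rewrite torus_distE (bigD1 l)//= leq_addr.
  have iN := ltn_ord (i l); have jN := ltn_ord (j l).
  have [Nr|rN] := leqP N r.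
    by apply: leq_trans (ltnW (ltn_pmod _ N0)) _; lia.
  have E : ((j l + (N - i l)) %% N = if (i l <= j l) then j l - i l else j l + N - i l)%N.
    case: leqP => ij.
      have -> : (j l + (N - i l) = (j l - i l) + N)%N by lia.
      by rewrite modnDr modn_small//; lia.
    by rewrite modn_small//; lia.
  rewrite ffunE/= E; move: cr; rewrite /circ => cr; case: (leqP (i l) (j l)) => ij.
    have [xr|xr] := leqP (j l - i l) r.
      apply: leq_trans (leq_mod _ _) _. lia.
    have -> : (j l - i l + r = (j l - i l + r - N) + N)%N by lia.
    by rewrite modnDr; apply: leq_trans (leq_mod _ _) _; lia.
  have [xr|xr] := leqP (j l + N - i l) r.
    by apply: leq_trans (leq_mod _ _) _; lia.
  have -> : (j l + N - i l + r = (j l + r - i l) + N)%N by lia.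
  by rewrite modnDr; apply: leq_trans (leq_mod _ _) _; lia.
rewrite -[X in (_ <= X ^ d)%N](card_ord (r.*2.+1)) -[X in (_ <= _ ^ X)%N](card_ord d) -card_ffun.
rewrite -(card_in_imset (f := g)) ?max_card// => j j'; rewrite !inE => jr jr' E.
apply/ffunP => l; apply: val_inj.
have := gE j l jr; rewrite E gE// => /eqP; rewrite !ffunE/=.
rewrite eqn_modDr !modn_mod eqn_modDr !modn_small// => /eqP ->//.
Qed.

End torus.

Lemma sum_enum_val (V : nmodType) (T : finType) (F : T -> V) :
  \sum_(a < #|{: T}|) F (enum_val a) = \sum_x F x.
Proof. by rewrite -big_enum_val; apply: eq_bigl. Qed.

(** * The normalized distance profile of the torus *)

Section torus_profile.
Variables (R : realType) (d : nat) (alpha : R).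
Hypotheses (d1 : (1 <= d)%N) (alpha0 : 0 < alpha) (alphad : alpha < d%:R).

Definition tweight (N : nat) (i j : vertex d N) : R :=
  if i == j then 0 else (torus_dist i j)%:R `^ (- alpha).

Definition profile (N : nat) (i j : 'I_#|{: vertex d N}|) : R :=
  (scaling d N alpha)^-1 * tweight (enum_val i) (enum_val j).

Section fixed_N.
Variable N : nat.
Hypothesis N0 : (0 < N)%N.
Local Notation c := (scaling d N alpha).
Implicit Types i j : vertex d N.

Lemma tweight_ge0 i j : 0 <= tweight i j.
Proof. by rewrite /tweight; case: eqP => // _; apply: powR_ge0. Qed.

Lemma tweight_sym i j : tweight i j = tweight j i.
Proof. by rewrite /tweight eq_sym torus_dist_sym. Qed.

Lemma tweight_sum i j : \sum_k tweight i k = \sum_k tweight j k.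
Proof.
rewrite -(translate_rotation N0 i j) [RHS](reindex_inj (@translate_inj _ _ N0 (rotation N0 i j))).
apply: eq_bigr => k _; rewrite /tweight torus_dist_translate.
by rewrite (inj_eq (@translate_inj _ _ N0 _)).
Qed.

Lemma card_vertex : #|{: vertex d N}| = (N ^ d)%N.
Proof. by rewrite card_ffun !card_ord. Qed.

(** Translations act transitively, so all row sums equal their average [c], and the rows of
    [profile] sum to exactly 1. *)
Lemma scalingE i : c = \sum_k tweight i k.
Proof.
rewrite /scaling.
have -> : \sum_(p : vertex d N * vertex d N | p.1 != p.2)
    (torus_dist p.1 p.2)%:R `^ (- alpha) =
    \sum_(j : vertex d N) \sum_k tweight j k.
  rewrite pair_bigA big_mkcond/=; apply: eq_bigr => p _.
  by rewrite /tweight; case: eqP.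
rewrite (eq_bigr (fun=> \sum_k tweight i k)) => [|j _]; last exact: tweight_sum.
rewrite sumr_const card_vertex -(mulr_natl (\sum_k _)) mulKf// pnatr_eq0.
by rewrite -lt0n expn_gt0 N0.
Qed.

Lemma tweight_le1 i j : tweight i j <= 1.
Proof.
rewrite /tweight; case: eqVneq => [_|/(torus_dist_gt0 N0) ij]; first exact: ler01.
rewrite powRN invf_le1 ?powR_gt0 ?ltr0n//.
have a1 : 1 <= (torus_dist i j)%:R :> R by rewrite ler1n.
by have := ler_powR a1 (ltW alpha0); rewrite powRr0.
Qed.

Lemma tweight_far i j (r : nat) : (r < torus_dist i j)%N ->
  tweight i j <= r.+1%:R `^ (- alpha).
Proof.
rewrite /tweight; case: eqP => [_ _|_ ij]; first exact: powR_ge0.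
rewrite !powRN lef_pV2 ?posrE ?powR_gt0 ?ltr0n//; last exact: leq_ltn_trans ij.
by apply: ge0_ler_powR; rewrite ?nnegrE ?ler_nat// ltW.
Qed.

Lemma tweight_ge i j : i != j -> (d * N)%:R `^ (- alpha) <= tweight i j.
Proof.
move=> ij; rewrite /tweight (negbTE ij) !powRN.
have t0 := torus_dist_gt0 N0 ij.
rewrite lef_pV2 ?posrE ?powR_gt0 ?ltr0n ?muln_gt0 ?N0 ?andbT//.
by apply: ge0_ler_powR; rewrite ?nnegrE ?ler_nat ?torus_dist_le// ltW.
Qed.

(** Every distance is at most [d * N]; this crude bound already diverges because [alpha < d]. *)
Lemma scaling_ge : ((N ^ d)%:R - 1) * (d * N)%:R `^ (- alpha) <= c.
Proof.
pose i : vertex d N := [ffun=> Ordinal N0].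
rewrite (scalingE i) (bigD1 i)//= {1}/tweight eqxx add0r.
apply: (@le_trans _ _ (\sum_(k | k != i) (d * N)%:R `^ (- alpha))).
  rewrite sumr_const -(mulr_natl (_ `^ _)) ler_wpM2r ?powR_ge0//.
  have -> : #|[pred k | k != i]| = (N ^ d).-1.
    by rewrite -card_vertex -[LHS]/#|predC1 i| cardC1.
  by rewrite -subn1 natrB// expn_gt0 N0.
by apply: ler_sum => k ki; apply: tweight_ge; rewrite eq_sym.
Qed.

Hypothesis c1 : 1 <= c.

Let c0 : 0 < c. Proof. exact: lt_le_trans c1. Qed.

Lemma profile_admissible (W : 'I_#|{: vertex d N}| -> R) : (forall a, 1 < W a) ->
  admissible (@profile N) c W.
Proof.
move=> W1; split => //.
- by rewrite card_vertex expn_gt0 N0.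
- by move=> i j; rewrite mulr_ge0 ?invr_ge0 ?(ltW c0) ?tweight_ge0.
- by move=> i j; rewrite /profile tweight_sym.
- by move=> i; rewrite /profile /tweight eqxx mulr0.
- move=> i; rewrite /profile -mulr_sumr.
  by rewrite (sum_enum_val (tweight (enum_val i))) -scalingE mulVf// gt_eqF.
- by move=> i j; rewrite /profile mulVKf ?gt_eqF// tweight_le1.
Qed.

(** Split at radius [r]: a far weight is at most [r.+1 ^ (- alpha)], against a row sum of 1, and the
    near ones contribute at most the size of a ball divided by [c]. *)
Lemma spread_profile (r : nat) :
  spread (@profile N) c <= r.+1%:R `^ (- alpha) + (r.*2.+1 ^ d)%:R / c.
Proof.
have n0 : (0 < #|{: vertex d N}|)%N by rewrite card_vertex expn_gt0 N0.
set B := (X in _ <= X).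
suff row (i : vertex d N) : \sum_j c * (c^-1 * tweight i j) ^+ 2 <= B.
  rewrite /spread ler_pdivrMl ?ltr0n// mulr_natl.
  apply: (@le_trans _ _ (\sum_(a < #|{: vertex d N}|) B)); last first.
    by rewrite sumr_const card_ord.
  apply: ler_sum => i _; apply: le_trans (row (enum_val i)).
  by rewrite -(sum_enum_val (fun j => c * (c^-1 * tweight (enum_val i) j) ^+ 2)).
have cV : 0 <= c^-1 by rewrite invr_ge0 ltW.
have pw : 0 <= r.+1%:R `^ (- alpha) by apply: powR_ge0.
have E j : c * (c^-1 * tweight i j) ^+ 2 = c^-1 * tweight i j ^+ 2.
  by field; rewrite gt_eqF.
under eq_bigr do rewrite E.
rewrite (bigID (fun j => r < torus_dist i j)%N)/=; apply: lerD.
  apply: (@le_trans _ _ (\sum_j r.+1%:R `^ (- alpha) * (c^-1 * tweight i j))); last first.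
    by rewrite -!mulr_sumr -scalingE mulVf ?gt_eqF// mulr1.
  rewrite [leRHS](bigID (fun j => r < torus_dist i j)%N)/= -[leLHS]addr0; apply: lerD.
    apply: ler_sum => j rj; rewrite [leRHS]mulrCA ler_wpM2l// expr2 ler_wpM2r ?tweight_ge0//.
    exact: tweight_far.
  apply: sumr_ge0 => j _; apply: mulr_ge0 => //; apply: mulr_ge0 => //; exact: tweight_ge0.
apply: (@le_trans _ _ (\sum_(j | ~~ (r < torus_dist i j)%N) c^-1)).
  apply: ler_sum => j _; rewrite -[leRHS]mulr1 ler_wpM2l// exprn_ile1 ?tweight_ge0 ?tweight_le1//.
rewrite sumr_const -(mulr_natl c^-1) ler_wpM2r// ler_nat.
apply: leq_trans (card_ball N0 i r); rewrite cardsE; apply: eq_leq; apply: eq_card => j.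
by rewrite !unfold_in/= -leqNgt.
Qed.

End fixed_N.

Lemma scaling_diverges (K : R) : exists N0, forall N, (N0 <= N)%N -> K <= scaling d N alpha.
Proof.
pose b := d%:R - alpha; have b0 : 0 < b by rewrite subr_gt0.
(* Half of [N ^ d] survives the removal of one vertex, and the lower bound on the scaling becomes
   [D * N ^ b] with [b = d - alpha]. *)
pose D : R := 2^-1 * d%:R `^ (- alpha).
have D0 : 0 < D by rewrite mulr_gt0 ?invr_gt0 ?powR_gt0 ?ltr0n.
pose K' := Num.max 1 (K / D).
have K1 : 1 <= K' by rewrite le_max lexx.
pose x := K' `^ b^-1.
have x0 : 0 <= x by apply: powR_ge0.
exists (maxn 2 (Num.bound x)) => N; rewrite geq_max => /andP[N2 xN].
have N0 : (0 < N)%N by apply: leq_trans N2.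
apply: le_trans (scaling_ge N0).
have xN' : x <= N%:R.
  by apply: (le_trans (ltW (archi_boundP x0))); rewrite ler_nat.
have NR0 : 0 < N%:R :> R by rewrite ltr0n.
have big : K' <= N%:R `^ b.
  have <- : x `^ b = K'.
    by rewrite /x -powRrM mulVf ?gt_eqF// powRr1// (le_trans ler01).
  by apply: ge0_ler_powR; rewrite ?nnegrE ?(ltW b0)// ltW.
have half : 2^-1 * (N ^ d)%:R <= (N ^ d)%:R - 1 :> R.
  have : 2 <= (N ^ d)%:R :> R.
    by rewrite ler_nat -[2%N]expn1; apply: (@leq_trans (N ^ 1)); rewrite ?leq_exp2l// !expn1.
  lra.
apply: (@le_trans _ _ (2^-1 * (N ^ d)%:R * (d * N)%:R `^ (- alpha))); last first.
  by rewrite ler_wpM2r ?powR_ge0.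
have -> : 2^-1 * (N ^ d)%:R * (d * N)%:R `^ (- alpha) = D * N%:R `^ b.
  rewrite natrM powRM ?ler0n// natrX -powR_mulrn ?ler0n// /b powRD ?(gt_eqF NR0) ?implybT//.
  by rewrite /D; ring.
rewrite mulrC -ler_pdivrMr//; apply: le_trans big.
by rewrite le_max lexx orbT.
Qed.

Lemma spread_vanishes (e : R) : 0 < e -> exists N0, forall N, (N0 <= N)%N ->
  spread (@profile N) (scaling d N alpha) <= e.
Proof.
move=> e0; pose x := (2 / e) `^ alpha^-1.
have x0 : 0 <= x by apply: powR_ge0.
pose r := Num.bound x.
have r_small : r.+1%:R `^ (- alpha) <= e / 2.
  rewrite powRN -[e / 2]invrK lef_pV2 ?posrE ?powR_gt0 ?ltr0n ?invr_gt0 ?divr_gt0//.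
  rewrite invf_div.
  have <- : x `^ alpha = 2 / e.
    by rewrite /x -powRrM mulVf ?gt_eqF// powRr1// divr_ge0// ltW.
  apply: ge0_ler_powR; rewrite ?nnegrE ?(ltW alpha0)//.
  by apply: (le_trans (ltW (archi_boundP x0))); rewrite ler_nat.
have [N1 H1] := scaling_diverges (Num.max 1 (2 * (r.*2.+1 ^ d)%:R / e)).
exists (maxn 1 N1) => N; rewrite geq_max => /andP[N0 /H1].
rewrite ge_max => /andP[c1 cN].
apply: (le_trans (spread_profile N0 c1 r)).
have -> : e = e / 2 + e / 2 by field.
apply: lerD => //; rewrite ler_pdivrMr ?(lt_le_trans ltr01)//.
by move: cN; rewrite ler_pdivrMr//; lra.
Qed.

End torus_profile.

(** * Integration over the weights *)

Section pareto_moments.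
Context {R : realType} {disp : measure_display} {T : measurableType disp}.
Variable P : probability T R.
Variables (t0 s : R).
Hypotheses (t00 : 0 < t0) (s0 : 0 < s) (st : s < t0).

(** The dyadic bound for the moment of order [s]: the sum of [2 ^ s * r ^+ k] with
    [r = 2 ^ (s - t0)], convergent because [s < t0]. *)
Definition moment_const : R := 2 `^ s / (1 - 2 `^ (s - t0)).

Let r : R := 2 `^ (s - t0).

Let r0 : 0 <= r. Proof. exact: powR_ge0. Qed.

Let r1 : r < 1.
Proof.
rewrite /r -opprB powRN invf_lt1 ?powR_gt0//.
have i0 : 0 < t0 - s by rewrite subr_gt0.
have := @gt0_ltr_powR R _ i0 1 2; rewrite powR1 !nnegrE; apply => //.
by rewrite ltr1n.
Qed.

Lemma geometric_le (n : nat) : \sum_(0 <= k < n) r ^+ k <= (1 - r)^-1.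
Proof.
rewrite big_mkord -[leRHS]mul1r ler_pdivlMr ?subr_gt0//.
have := subrX1 r n; set S := \sum_(k < n) _ => E.
have -> : S * (1 - r) = 1 - r ^+ n by move/eqP: E; rewrite subr_eq => /eqP ->; ring.
by rewrite gerBl exprn_ge0.
Qed.

Lemma nneseries_bound (u : nat -> \bar R) (b : \bar R) : (forall k, 0 <= u k)%E ->
  (forall n, \sum_(0 <= k < n) u k <= b)%E -> (\sum_(k <oo) u k <= b)%E.
Proof.
move=> u0 H; apply: lime_le; first exact: is_cvg_nneseries.
by apply: nearW => n; apply: H.
Qed.

Lemma emeasurable_series (D : set T) (h : nat -> T -> \bar R) :
  (forall k x, D x -> 0 <= h k x)%E -> (forall k, measurable_fun D (h k)) ->
  measurable_fun D (fun x => \sum_(k <oo) h k x)%E.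
Proof.
move=> h0 mh.
by apply: (@ge0_emeasurable_sum _ _ _ D h xpredT) => [k x Dx _|k _]; [apply: h0|apply: mh].
Qed.

Lemma nneseries_term (u : nat -> \bar R) k : (forall k, 0 <= u k)%E ->
  (u k <= \sum_(k <oo) u k)%E.
Proof.
move=> u0; apply: (@le_trans _ _ (\sum_(0 <= i < k.+1) u i)%E).
  by rewrite big_nat_recr//= leeDr// sume_ge0.
exact: (@nneseries_lim_ge _ u xpredT 0%N k.+1).
Qed.

Definition dyadic_weight (k : nat) : R := (2 ^+ k.+1) `^ s.

Lemma dyadic_weight_ge0 k : 0 <= dyadic_weight k. Proof. exact: powR_ge0. Qed.

Lemma powR_exp (x p : R) (k : nat) : 0 <= x -> (x ^+ k) `^ p = (x `^ p) ^+ k.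
Proof.
move=> x0; elim: k => [|k IH]; first by rewrite !expr0 powR1.
by rewrite !exprS powRM ?exprn_ge0// IH.
Qed.

Lemma dyadic_exists (x : R) : 1 < x ->
  exists k, 2 ^+ k < x /\ x `^ s <= dyadic_weight k.
Proof.
move=> x1; have ex : exists k, x <= 2 ^+ k.
  have x0 : 0 <= x by rewrite ltW// (lt_trans ltr01).
  exists (Num.bound x); apply: (le_trans (ltW (archi_boundP x0))).
  by rewrite -natrX ler_nat ltnW// ltn_expl.
case: (ex_minnP ex) => -[|k] xk mink; first by move: xk; rewrite expr0 leNgt x1.
exists k; split; first by rewrite ltNge; apply/negP => /mink; rewrite ltnn.
apply: ge0_ler_powR; rewrite ?nnegrE ?(ltW s0) ?exprn_ge0//.
by rewrite ltW// (lt_trans ltr01).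
Qed.

Lemma dyadic_tail (X : {RV P >-> R}) k : pareto X t0 ->
  ((dyadic_weight k)%:E * P [set w | (2 ^+ k < X w)%R] = (2 `^ s * r ^+ k)%:E)%E.
Proof.
move=> /(_ (2 ^+ k)) ->; rewrite exprn_ege1 ?ler1n//.
rewrite -EFinM; congr (_%:E); rewrite /dyadic_weight !powR_exp// exprS /r.
rewrite powRD; last by rewrite pnatr_eq0 implybT.
by rewrite exprMn mulrA.
Qed.

Section pair.
Variables (X Y : {RV P >-> R}).
Hypotheses (pX : pareto X t0) (pY : pareto Y t0).
Hypothesis indepXY : forall a b : R, P ([set w | a < X w] `&` [set w | b < Y w]) =
  (P [set w | (a < X w)%R] * P [set w | (b < Y w)%R])%E.
Variable D : set T.
Hypotheses (mD : measurable D) (DX : forall w, D w -> 1 < X w)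
  (DY : forall w, D w -> 1 < Y w).

Let A k := [set w | 2 ^+ k < X w].
Let B k := [set w | 2 ^+ k < Y w].

Lemma measurable_tail (Z : {RV P >-> R}) (a : R) : measurable [set w | a < Z w].
Proof.
have -> : [set w | a < Z w] = Z @^-1` `]a, +oo[%classic.
  by apply/seteqP; split => w /=; rewrite in_itv/= andbT.
by rewrite -[_ @^-1` _]setTI; apply: measurable_funPT.
Qed.

(** On [D], the power [X ^ s] is at most some [dyadic_weight k] with [2 ^+ k < X], and likewise for
    [Y]. The resulting double series involves only joint tails, where independence applies, and
    factors into two geometric series. *)
Lemma pair_moment_le :
  (\int[P]_(w in D) ((X w * Y w) `^ s)%:E <= (moment_const ^+ 2)%:E)%E.
Proof.
pose u k l w : \bar R := (dyadic_weight k * dyadic_weight l * \1_(A k `&` B l) w)%:E.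
have u0 k l w : (0 <= u k l w)%E.
  by rewrite lee_fin !mulr_ge0 ?dyadic_weight_ge0.
have mAB k l : measurable (A k `&` B l) by apply: measurableI; apply: measurable_tail.
have mu k l : measurable_fun D (u k l).
  apply/measurable_EFinP; apply: measurable_funM => //.
have mX : measurable_fun D X by apply: measurable_funTS.
have mY : measurable_fun D Y by apply: measurable_funTS.
apply: (@le_trans _ _ (\int[P]_(w in D) \sum_(k <oo) \sum_(l <oo) u k l w)%E).
  apply: ge0_le_integral => //.
  - by move=> w _; rewrite lee_fin powR_ge0.
  - apply/measurable_EFinP.
    apply: (@measurableT_comp _ _ _ _ _ _ (@powR R ^~ s)) => //.
    exact: measurable_funM.
  - apply: emeasurable_series => [k w Dw|k]; first exact: nneseries_ge0.
    exact: emeasurable_series.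
  move=> w Dw; have [k [kX Xk]] := dyadic_exists (DX Dw).
  have [l [lY Yl]] := dyadic_exists (DY Dw).
  apply: (@le_trans _ _ (u k l w)).
    have X0 := ltW (lt_trans ltr01 (DX Dw)); have Y0 := ltW (lt_trans ltr01 (DY Dw)).
    rewrite lee_fin indicE mem_set ?mulr1//= powRM//.
    by apply: ler_pM; rewrite ?powR_ge0.
  apply: (@le_trans _ _ (\sum_(l <oo) u k l w)%E).
    exact: (nneseries_term (u := fun l => u k l w)).
  by apply: (nneseries_term (u := fun k => \sum_(l <oo) u k l w)%E) => k'; apply: nneseries_ge0.
rewrite integral_nneseries//; last 2 first.
- by move=> k; apply: emeasurable_series.
- by move=> k w _; apply: nneseries_ge0.
have term k l : (\int[P]_(w in D) u k l w <= (2 `^ s * r ^+ k * (2 `^ s * r ^+ l))%:E)%E.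
  rewrite /u; under eq_integral do rewrite EFinM.
  rewrite ge0_integralZl_EFin//; last 2 first.
  - by apply/measurable_EFinP.
  - by rewrite mulr_ge0 ?dyadic_weight_ge0.
  rewrite integral_indic// [leRHS]EFinM -(dyadic_tail k pX) -(dyadic_tail l pY).
  rewrite [leRHS]muleACA -indepXY -EFinM; apply: lee_pmul => //.
    by rewrite lee_fin mulr_ge0 ?dyadic_weight_ge0.
  by apply: le_measure; rewrite ?inE; [apply: measurableI|apply: mAB|apply: subIsetl].
have r1' : 0 < 1 - r by rewrite subr_gt0.
have c0 : 0 <= 2 `^ s by apply: powR_ge0.
apply: nneseries_bound => [k|n]; first by apply: integral_ge0 => w _; apply: nneseries_ge0.
have inner k : (\int[P]_(w in D) \sum_(l <oo) u k l w <=
    (2 `^ s * r ^+ k * moment_const)%:E)%E.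
  rewrite integral_nneseries//.
  apply: nneseries_bound => [l|n'].
    by apply: integral_ge0 => w _; apply: u0.
  apply: (@le_trans _ _ (\sum_(0 <= l < n') (2 `^ s * r ^+ k * (2 `^ s * r ^+ l))%:E)%E).
    by apply: lee_sum => l _; apply: term.
  rewrite sumEFin lee_fin -mulr_sumr -mulr_sumr ler_wpM2l ?mulr_ge0 ?exprn_ge0//.
  by rewrite ler_wpM2l// geometric_le.
apply: (@le_trans _ _ (\sum_(0 <= k < n) (2 `^ s * r ^+ k * moment_const)%:E)%E).
  by apply: lee_sum => k _; apply: inner.
have mc0 : 0 <= moment_const by rewrite divr_ge0// ltW.
rewrite sumEFin lee_fin -mulr_suml -mulr_sumr expr2 ler_wpM2r//.
by rewrite ler_wpM2l// geometric_le.
Qed.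

End pair.
End pareto_moments.

Section independence.
Context {R : realType} {disp : measure_display} {T : measurableType disp}.
Variable P : probability T R.
Variables (I : finType) (X : I -> {RV P >-> R}).
Hypothesis indep : independent_RVs X.

Lemma indep_pair i j (A B : set R) : i != j -> measurable A -> measurable B ->
  P (X i @^-1` A `&` X j @^-1` B) = (P (X i @^-1` A) * P (X j @^-1` B))%E.
Proof.
move=> ij mA mB; pose C k := if k == i then A else if k == j then B else setT.
have mC k : measurable (C k) by rewrite /C; case: ifP => // _; case: ifP.
have := indep mC.
have -> : \bigcap_(k in [set: I]) X k @^-1` C k = X i @^-1` A `&` X j @^-1` B.
  apply/seteqP; split => w /=.
    move=> H; split; first by have := H i Logic.I; rewrite /C/= eqxx.
    by have := H j Logic.I; rewrite /C/= eqxx eq_sym (negbTE ij).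
  move=> [Aw Bw] k _ /=; rewrite /C; case: eqP => [->//|_].
  by case: eqP => [->|].
rewrite (bigD1 i)//= (bigD1 j)/=; last by rewrite eq_sym.
rewrite big1 => [|k /andP[ki kj]]; last first.
  by rewrite /C (negbTE ki) (negbTE kj) preimage_setT probability_setT.
rewrite mulr1 /C !eqxx (eq_sym j) (negbTE ij) EFinM => ->.
by rewrite !fineK// fin_num_measure// -[_ @^-1` _]setTI; apply: measurable_funPT.
Qed.

End independence.

(** * Integration over an event of full probability *)

Section full_measure.
Context {R : realType} {disp : measure_display} {T : measurableType disp}.
Variables (P : probability T R) (D : set T).
Hypotheses (mD : measurable D) (PD : P D = 1%E).

Lemma probability_full (A : set T) : measurable A -> P (A `&` D) = P A.
Proof.
move=> mA; have H : P (A `\` D) = 0%E.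
  apply/eqP; rewrite eq_le measure_ge0 andbT.
  apply: (@le_trans _ _ (P (~` D))).
    by apply: le_measure; rewrite ?inE; [apply: measurableD|apply: measurableC|move=> w []].
  by rewrite probability_setC// PD subee.
by rewrite -[in RHS](setDUK (@subIsetl _ A D)) measureU ?setDIK//;
  [rewrite [X in (_ + X)%E](_ : _ = 0%E) ?adde0//; rewrite -H; congr (P _);
   rewrite setDIr setDv set0U
  |apply: measurableI|apply: measurableD => //; apply: measurableI].
Qed.

Local Notation int f := (\int[P]_(w in D) (f w)%:E)%E.

(** For nonnegative functions extended integrals are additive whether finite or not. Both properties
    are asked on [D] alone, since facts about the weights such as [1 < W i] hold only there. *)
Definition nnm (f : T -> R) : Prop := (forall w, D w -> 0 <= f w) /\ measurable_fun D f.

Lemma intD f g : nnm f -> nnm g -> int (fun w => f w + g w) = (int f + int g)%E.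
Proof.
move=> [f0 mf] [g0 mg]; under eq_integral do rewrite EFinD.
apply: ge0_integralD => //; try by apply/measurable_EFinP.
Qed.

Lemma intZ (k : R) f : 0 <= k -> nnm f -> int (fun w => k * f w) = (k%:E * int f)%E.
Proof.
move=> k0 [f0 mf]; under eq_integral do rewrite EFinM.
by apply: ge0_integralZl_EFin => //; apply/measurable_EFinP.
Qed.

Lemma nnmD f g : nnm f -> nnm g -> nnm (fun w => f w + g w).
Proof.
move=> [f0 mf] [g0 mg]; split; last exact: measurable_funD.
by move=> w Dw; rewrite addr_ge0 ?f0 ?g0.
Qed.

Lemma nnmM f g : nnm f -> nnm g -> nnm (fun w => f w * g w).
Proof.
move=> [f0 mf] [g0 mg]; split; last exact: measurable_funM.
by move=> w Dw; rewrite mulr_ge0 ?f0 ?g0.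
Qed.

Lemma nnm_cst k : 0 <= k -> nnm (fun=> k).
Proof. by move=> k0; split. Qed.

Lemma nnmZ k f : 0 <= k -> nnm f -> nnm (fun w => k * f w).
Proof. by move=> k0; apply: nnmM; apply: nnm_cst. Qed.

Lemma nnm_sum (I : Type) (r : seq I) (F : I -> T -> R) : (forall i, nnm (F i)) ->
  nnm (fun w => \sum_(i <- r) F i w).
Proof.
move=> nF; split; last by apply: measurable_sum => i; case: (nF i).
by move=> w Dw; apply: sumr_ge0 => i _; case: (nF i) => + _; apply.
Qed.

Lemma int_sum (I : Type) (r : seq I) (F : I -> T -> R) : (forall i, nnm (F i)) ->
  int (fun w => \sum_(i <- r) F i w) = (\sum_(i <- r) int (F i))%E.
Proof.
move=> nF; elim: r => [|i r IH].
  rewrite big_nil -[RHS](integral0 P D); apply: eq_integral => w _.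
  by rewrite big_nil.
rewrite big_cons -IH -intD//; last exact: nnm_sum.
by apply: eq_integral => w _; rewrite big_cons.
Qed.

Lemma int_le f g : nnm f -> nnm g -> (forall w, D w -> f w <= g w) -> (int f <= int g)%E.
Proof.
move=> [f0 mf] [g0 mg] fg; apply: ge0_le_integral => //; try by apply/measurable_EFinP.
Qed.

Lemma int_cst k : int (fun=> k) = k%:E.
Proof. by rewrite integral_cst// -[RHS]mule1; congr (_ * _)%E. Qed.

Lemma int_indic A : measurable A -> int (\1_A) = P A.
Proof. by move=> mA; rewrite integral_indic//; exact: probability_full. Qed.

Lemma nnm_indic A : measurable A -> nnm (\1_A).
Proof. by move=> mA; split. Qed.

Lemma int_sum_le (I : finType) (F : I -> T -> R) (b : I -> R) :
  (forall i, nnm (F i)) -> (forall i, int (F i) <= (b i)%:E)%E ->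
  (int (fun w => \sum_i F i w) <= (\sum_i b i)%:E)%E.
Proof.
by move=> nF Fb; rewrite int_sum// -sumEFin; apply: lee_sum => i _; apply: Fb.
Qed.

Lemma int_ge0 f : nnm f -> (0 <= int f)%E.
Proof. by move=> [f0 _]; apply: integral_ge0 => w Dw; rewrite lee_fin f0. Qed.

Lemma intZ_le (k b : R) f : 0 <= k -> nnm f -> (int f <= b%:E)%E ->
  (int (fun w => k * f w) <= (k * b)%:E)%E.
Proof.
move=> k0 nf fb; rewrite intZ// EFinM; apply: lee_pmul => //; exact: int_ge0.
Qed.

Lemma intD_le (a b : R) f g : nnm f -> nnm g -> (int f <= a%:E)%E -> (int g <= b%:E)%E ->
  (int (fun w => f w + g w) <= (a + b)%:E)%E.
Proof. by move=> nf ng fa gb; rewrite intD// EFinD; apply: leeD. Qed.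

End full_measure.

(** * The law of the graph as a mixture over the weights *)

Section graph_law.
Context {R : realType} {disp : measure_display} {T : measurableType disp}.
Variables (P : probability T R) (d N : nat) (tau alpha sigma : R).
Variables (W : vertex d N -> {RV P >-> R}) (adj : T -> rel (vertex d N)).
Hypotheses (N0 : (0 < N)%N) (alpha0 : 0 < alpha) (tau1 : 1 < tau).
Hypothesis model : kernel_random_graph tau alpha sigma W adj.
Local Notation c := (scaling d N alpha).
Hypothesis c1 : 1 <= c.

Local Notation n := #|{: vertex d N}|.
Local Notation code_type := {ffun 'I_n * 'I_n -> bool}.

(** Edges are recorded at index pairs [i < j] and the rest is false, to match the probabilities
    [eprob]. *)
Definition code (w : T) : code_type :=
  [ffun e : 'I_n * 'I_n => (e.1 < e.2)%N && adj w (enum_val e.1) (enum_val e.2)].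

Definition wvec (w : T) (a : 'I_n) : R := W (enum_val a) w.

Definition good : set T := [set w | forall i, 1 < W i w].

Lemma code_gmat w : gmat c (code w) = scaled_adjacency alpha (adj w).
Proof.
apply/matrixP => a b; rewrite !mxE; congr (_ * _%:R); congr nat_of_bool.
rewrite /has_edge; have [->|ne] := eqVneq a b; first by rewrite (adj_irr model).
rewrite ffunE /edge; case: (ltngtP a b) => [ab|ba|/val_inj E] /=.
- by rewrite ab.
- by rewrite ba (adj_sym model).
- by rewrite E eqxx in ne.
Qed.

Lemma goodE : good = \bigcap_(i in [set: vertex d N]) (W i @^-1` `]1, +oo[%classic).
Proof.
apply/seteqP; split => w /= H i; first by move=> _ /=; rewrite in_itv/= andbT; apply: H.
by have /= := H i Logic.I; rewrite in_itv/= andbT.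
Qed.

Lemma measurable_preim (X : {RV P >-> R}) (B : set R) : measurable B -> measurable (X @^-1` B).
Proof. by move=> mB; rewrite -[_ @^-1` _]setTI; apply: measurable_funPT. Qed.

Lemma measurable_good : measurable good.
Proof.
rewrite goodE; apply: fin_bigcap_measurable => // i _.
by apply: measurable_preim.
Qed.

Lemma tail_preim (X : {RV P >-> R}) (a : R) : [set w | a < X w] = X @^-1` `]a, +oo[%classic.
Proof. by apply/seteqP; split => w /=; rewrite in_itv/= andbT. Qed.

Lemma probability_good : P good = 1%E.
Proof.
rewrite goodE (weight_indep model (B := fun=> `]1, +oo[%classic))// big1// => i _.
by rewrite -tail_preim (weight_pareto model) lexx powR1.
Qed.

Lemma measurable_code w0 : measurable [set w | code w = w0].
Proof.
have -> : [set w | code w = w0] =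
    \bigcap_(e in [set: 'I_n * 'I_n]) [set w | code w e = w0 e].
  apply/seteqP; split => w /=; first by move=> cw e _ /=; rewrite cw.
  by move=> H; apply/ffunP => e; apply: H.
apply: fin_bigcap_measurable => // e _.
have mt : measurable [set w | code w e].
  have [lt|ge] := boolP (e.1 < e.2)%N.
    have -> : [set w | code w e] = [set w | adj w (enum_val e.1) (enum_val e.2)].
      by apply/seteqP; split => w /=; rewrite ffunE lt.
    exact: (adj_measurable model).
  have -> : [set w | code w e] = set0; last exact: measurable0.
  by apply/seteqP; split => w //=; rewrite ffunE (negbTE ge).
case: (w0 e).
  by have -> : [set w | code w e = true] = [set w | code w e].
have -> : [set w | code w e = false] = ~` [set w | code w e].
  by apply/seteqP; split => w /=; [move=> ->|move/negP/negbTE].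
exact: measurableC.
Qed.

Local Notation mean w phi := (graph_mean sigma (@profile _ d alpha N) c (wvec w) phi).
Local Notation q w := (eprob (eprobs sigma (@profile _ d alpha N) c (wvec w))).

Lemma eprobs_edge_prob w a b : a != b ->
  eprobs sigma (@profile _ d alpha N) c (wvec w) a b =
  edge_prob alpha sigma (fun k => W k w) (enum_val a) (enum_val b).
Proof.
move=> ab; rewrite /eprobs /edge_prob /kap /profile mulVKf; last first.
  by rewrite gt_eqF// (lt_le_trans ltr01).
by rewrite /tweight (inj_eq enum_val_inj) (negbTE ab) powRN.
Qed.

Lemma measurable_bweight (D : set T) w0 : measurable D -> measurable_fun D (fun w => bweight (q w) w0).
Proof.
move=> mD; apply: measurable_prod => e _; rewrite /bern.
have me : measurable_fun D (fun w => q w e).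
  rewrite /eprob; have [lt|/negbTE lt] := boolP (e.1 < e.2)%N; rewrite ?lt; last first.
    exact: measurable_cst.
  rewrite /eprobs /kap /Defs.kernel /wvec.
  have mW a : measurable_fun D (fun w => W (enum_val a) w) by apply: measurable_funTS.
  apply: measurable_minr => //; apply: measurable_funM => //.
  apply: measurable_funM; first exact: measurable_maxr.
  apply: (@measurableT_comp _ _ _ _ _ _ (@powR R ^~ sigma)) => //.
  exact: measurable_minr.
by case: (w0 e) => //; apply: measurable_funB.
Qed.

Lemma admissible_good w : good w -> admissible (@profile _ d alpha N) c (wvec w).
Proof. by move=> gw; apply: profile_admissible => // a; apply: gw. Qed.

Lemma bweight_ge0_good w w0 : good w -> 0 <= bweight (q w) w0.
Proof.
move=> gw; apply: bweight_ge0 => e; apply: eprob01 => a b.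
exact: eprobs01 (admissible_good gw) a b.
Qed.

(** The event [good] belongs to the sigma-algebra of the weights and has probability 1, so the
    conditional law may be integrated over it; the product over vertex pairs is then reindexed by
    their ranks. *)
Lemma code_law w0 :
  P [set w | code w = w0] = (\int[P]_(w in good) (bweight (q w) w0)%:E)%E.
Proof.
(* A code with an edge outside [i < j] is never attained, and its weight is 0 as well because
   [eprob] vanishes there. *)
have [[e e0]|supp] := pselect (exists e, w0 e && ~~ (e.1 < e.2)%N).
  have /andP[we ge] := e0.
  have -> : [set w | code w = w0] = set0.
    apply/seteqP; split => w //= cw; move: we; rewrite -cw ffunE (negbTE ge)//.
  rewrite measure0 -[LHS](integral0 P good); apply: eq_integral => w _.
  by rewrite /bweight (bigD1 e)//= we /= /eprob (negbTE ge) mul0r.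
have {}supp e : w0 e -> (e.1 < e.2)%N.
  by move=> we; apply: contrapT => /negP ge; apply: supp; exists e; rewrite we.
pose g (x z : vertex d N) : bool := w0 (enum_rank x, enum_rank z).
have sgood : generated_salgebra W good.
  rewrite goodE /generated_salgebra; set G := (X in <<s X >>).
  have : measurable (\bigcap_(i in [set: vertex d N]) (W i @^-1` `]1, +oo[%classic) :
      set (g_sigma_algebraType G)).
    apply: fin_bigcap_measurable => // i _; apply: sub_sigma_algebra.
    by exists i; exists `]1, +oo[%classic.
  by [].
have := adj_cond_law model g sgood.
have -> : good `&` [set w | forall p, upair p -> adj w p.1 p.2 = g p.1 p.2] =
    [set w | code w = w0] `&` good.
  apply/seteqP; split => w /=.
    move=> [gw H]; split => //; apply/ffunP => -[a b]; rewrite ffunE/=.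
    have [ab|ab] := boolP (a < b)%N; last first.
      by apply/esym/negbTE; apply: contra ab => /supp.
    rewrite (H (enum_val a, enum_val b)) /upair/= ?enum_valK//.
    by rewrite /g !enum_valK.
  move=> [cw gw]; split => // -[x z]; rewrite /upair/= => xz.
  by rewrite /g -cw ffunE/= xz !enum_rankK.
rewrite (probability_full measurable_good probability_good (measurable_code w0)) => ->.
apply: eq_integral => w _; congr (_%:E).
pose h (e : 'I_n * 'I_n) : vertex d N * vertex d N := (enum_val e.1, enum_val e.2).
pose h' (p : vertex d N * vertex d N) : 'I_n * 'I_n := (enum_rank p.1, enum_rank p.2).
have hK : cancel h h' by move=> [a b]; rewrite /h /h' /= !enum_valK.
have hK' : cancel h' h by move=> [x z]; rewrite /h /h' /= !enum_rankK.
rewrite (reindex h); last by exists h' => x _; rewrite ?hK ?hK'.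
rewrite /bweight [RHS](bigID (fun e : 'I_n * 'I_n => (e.1 < e.2)%N))/=.
rewrite [X in _ = _ * X]big1 ?mulr1 => [|e ge]; last first.
  have -> : w0 e = false by apply/negbTE; apply: contra ge => /supp.
  by rewrite /bern /eprob (negbTE ge) subr0.
apply: eq_big => [e|e]; rewrite /upair/= !enum_valK// => lt.
rewrite /g !enum_valK -surjective_pairing /bern /eprob lt eprobs_edge_prob//.
by rewrite neq_ltn lt.
Qed.

(** The graph takes finitely many values, so events and means of spectral functionals become finite
    sums of these masses. *)
Definition code_mass w0 : R := fine (P [set w | code w = w0]).

Definition code_mean (phi : code_type -> R) : R := \sum_w0 code_mass w0 * phi w0.

Lemma code_mass_ge0 w0 : 0 <= code_mass w0.
Proof. exact: fine_ge0. Qed.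

Lemma code_massE w0 : (code_mass w0)%:E = P [set w | code w = w0].
Proof. by rewrite /code_mass fineK// fin_num_measure//; apply: measurable_code. Qed.

Lemma code_in_seq (r : seq code_type) : measurable [set w | code w \in r] /\
  (uniq r -> P [set w | code w \in r] = (\sum_(w0 <- r) code_mass w0)%:E).
Proof.
elim: r => [|w0 r [mr IH]].
  have -> : [set w | code w \in [::]] = set0 by apply/seteqP; split.
  by rewrite measure0 big_nil; split.
have E : [set w | code w \in w0 :: r] = [set w | code w = w0] `|` [set w | code w \in r].
  apply/seteqP; split => w /=; rewrite inE; first by move=> /orP[/eqP|]; [left|right].
  by move=> [->|->]; rewrite ?eqxx ?orbT.
rewrite E; split; first by apply: measurableU => //; apply: measurable_code.
move=> /= /andP[wr ur]; rewrite measureU//; last 2 first.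
- exact: measurable_code.
- by apply/seteqP; split => w //= -[->]; rewrite (negbTE wr).
by rewrite big_cons EFinD code_massE; congr (_ + _)%E; apply: IH.
Qed.

Lemma code_event (Q : pred code_type) : measurable [set w | Q (code w)] /\
  P [set w | Q (code w)] = (\sum_(w0 | Q w0) code_mass w0)%:E.
Proof.
have [mQ /(_ (enum_uniq _)) PQ] := code_in_seq (enum Q).
have E : [set w | Q (code w)] = [set w | code w \in enum Q].
  by apply/seteqP; split => w /=; rewrite mem_enum.
by rewrite E PQ big_enum; split.
Qed.

Lemma sum_code_mass : \sum_w0 code_mass w0 = 1.
Proof.
have [_] := code_event xpredT.
have -> : [set w | xpredT (code w)] = setT by apply/seteqP; split.
by rewrite probability_setT => -[].
Qed.

Lemma code_markov (phi : code_type -> R) (eta : R) : (forall w0, 0 <= phi w0) -> 0 < eta ->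
  \sum_(w0 | eta <= phi w0) code_mass w0 <= code_mean phi / eta.
Proof.
move=> phi0 eta0; rewrite ler_pdivlMr// /code_mean mulr_suml.
rewrite [leRHS](bigID (fun w0 => eta <= phi w0))/= -[leLHS]addr0; apply: lerD.
  by apply: ler_sum => w0 H; rewrite ler_wpM2l ?code_mass_ge0.
by apply: sumr_ge0 => w0 _; rewrite mulr_ge0 ?code_mass_ge0.
Qed.

(** The bridge from frozen to random weights: a bound on the conditional mean over [good] is
    integrated against the mixture. *)
Lemma code_mean_le (phi : code_type -> R) (B : T -> R) (b : R) :
  (forall w0, 0 <= phi w0) -> nnm good B ->
  (forall w, good w -> mean w phi <= B w) -> (\int[P]_(w in good) (B w)%:E <= b%:E)%E ->
  code_mean phi <= b.
Proof.
move=> phi0 nB phiB Bb; rewrite -lee_fin; apply: le_trans Bb.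
have nb w0 : nnm good (fun w => phi w0 * bweight (q w) w0).
  split; last by apply: measurable_funM => //; apply: measurable_bweight measurable_good.
  by move=> w gw; rewrite mulr_ge0 ?bweight_ge0_good.
have E : (code_mean phi)%:E =
    (\int[P]_(w in good) (\sum_w0 phi w0 * bweight (q w) w0)%:E)%E.
  rewrite (int_sum P measurable_good _ nb) /code_mean -sumEFin; apply: eq_bigr => w0 _.
  rewrite mulrC EFinM code_massE code_law -intZ//; first exact: measurable_good.
  split; last exact: measurable_bweight measurable_good.
  by move=> w gw; apply: bweight_ge0_good.
rewrite E; apply: int_le => //; first exact: measurable_good.
  exact: nnm_sum.
move=> w gw; apply: le_trans (phiB w gw).
by apply: ler_sum => w0 _; rewrite mulrC.
Qed.

End graph_law.

(** * Mean size of the truncation and discretization errors *)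

Section weight_integrals.
Context {R : realType} {disp : measure_display} {T : measurableType disp}.
Variables (P : probability T R) (d N : nat) (tau alpha sigma : R).
Variables (W : vertex d N -> {RV P >-> R}) (adj : T -> rel (vertex d N)).
Hypotheses (N0 : (0 < N)%N) (alpha0 : 0 < alpha) (tau2 : 2 < tau).
Hypotheses (sigma0 : 0 < sigma) (sigma1 : sigma < tau - 1).
Hypothesis model : kernel_random_graph tau alpha sigma W adj.
Local Notation c := (scaling d N alpha).
Hypothesis c1 : 1 <= c.

Local Notation n := #|{: vertex d N}|.
Local Notation s := (@profile R d alpha N).
Local Notation X w := (wvec W w).
Local Notation good := (good W).

(** [sx] below is the midpoint of [smax] and [tau - 1]: small enough for finite moments, and larger
    by the margin [gam] than the growth of the kernel. *)
Let smax : R := Num.max 1 sigma.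
Let gam : R := (tau - 1 - smax) / 2.
Let sx : R := smax + gam.
Local Notation C := (moment_const (tau - 1) sx).

Let smax_lt : smax < tau - 1.
Proof. by rewrite /smax gt_max; apply/andP; split => //; rewrite ltrBrDr; apply: le_lt_trans tau2. Qed.

Let gam0 : 0 < gam. Proof. by rewrite /gam; have := smax_lt; lra. Qed.

Let sx_lt : sx < tau - 1. Proof. by rewrite /sx /gam; have := smax_lt; lra. Qed.

Let smax1 : 1 <= smax. Proof. by rewrite le_max lexx. Qed.

Let sx0 : 0 < sx. Proof. by rewrite /sx; have := smax1; have := gam0; lra. Qed.

Let t00 : 0 < tau - 1. Proof. by rewrite subr_gt0 (lt_trans _ tau2)// ltr1n. Qed.

Let mgood : measurable good. Proof. exact: measurable_good. Qed.

Let Pgood : P good = 1%E. Proof. exact: probability_good model. Qed.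

Let c0 : 0 < c. Proof. exact: lt_le_trans c1. Qed.

Let n0 : (0 < n)%N. Proof. by rewrite card_vertex expn_gt0 N0. Qed.

Let s_ge0 a b : 0 <= s a b.
Proof. by rewrite mulr_ge0 ?invr_ge0 ?(ltW c0) ?tweight_ge0. Qed.

Let s_diag a : s a a = 0.
Proof. by rewrite /profile /tweight eqxx mulr0. Qed.

Let s_sum a : \sum_b s a b = 1.
Proof.
rewrite /profile -mulr_sumr (sum_enum_val (tweight alpha (enum_val a))).
by rewrite -scalingE// mulVf// gt_eqF.
Qed.

Let s_le a b : c * s a b <= 1.
Proof. by rewrite /profile mulVKf ?gt_eqF// tweight_le1. Qed.

Let mX a : measurable_fun good (fun w => X w a).
Proof. by apply: measurable_funTS. Qed.

Lemma nnm_powR a b p : nnm good (fun w => (X w a * X w b) `^ p).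
Proof.
split; first by move=> w _; apply: powR_ge0.
apply: (@measurableT_comp _ _ _ _ _ _ (@powR R ^~ p)) => //.
exact: measurable_funM.
Qed.

Lemma int_pair_moment a b : a != b ->
  (\int[P]_(w in good) ((X w a * X w b) `^ sx)%:E <= (C ^+ 2)%:E)%E.
Proof.
move=> ab; apply: (pair_moment_le sx0 sx_lt (weight_pareto model _) (weight_pareto model _)) => //.
move=> x z; rewrite !tail_preim; apply: (indep_pair (weight_indep model)) => //.
by rewrite (inj_eq enum_val_inj).
Qed.

Lemma nnm_kap a b : nnm good (fun w => kap sigma (X w) a b).
Proof.
split; first by move=> w gw; apply: kernel_ge0 => //; apply: ltW (lt_trans ltr01 (gw _)).
apply: measurable_funM; first exact: measurable_maxr.
apply: (@measurableT_comp _ _ _ _ _ _ (@powR R ^~ sigma)) => //.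
exact: measurable_minr.
Qed.

Lemma kap_le w a b : good w -> kap sigma (X w) a b <= (X w a * X w b) `^ smax.
Proof.
move=> gw; apply: kernel_le_pow => //; try exact: ltW (gw _).
by rewrite le_max lexx orbT.
Qed.

Lemma kap_le_moment w a b : good w -> kap sigma (X w) a b <= (X w a * X w b) `^ sx.
Proof.
move=> gw; apply: (le_trans (kap_le a b gw)); apply: ler_powR.
  by rewrite mulr_ege1// ltW// gw.
by rewrite /sx lerDl ltW.
Qed.

(** One weight of a heavy pair exceeds [m] and the other is at least 1, so the product is at least
    [m] and the surplus exponent [gam] is traded for [m ^ (- gam)]. *)
Lemma heavy_kap_le (m : R) w a b : 1 < m -> good w -> ~~ light (X w) m a b ->
  kap sigma (X w) a b <= m `^ (- gam) * (X w a * X w b) `^ sx.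
Proof.
move=> m1 gw hv; have m0 := lt_trans ltr01 m1.
have a1 : 1 <= X w a := ltW (gw _); have b1 : 1 <= X w b := ltW (gw _).
have a0 := le_trans ler01 a1; have b0 := le_trans ler01 b1.
have mX_le : m <= X w a * X w b.
  move: hv; rewrite negb_and -!ltNge => /orP[] /ltW H.
    by rewrite -[leLHS]mulr1 ler_pM// ltW.
  by rewrite -[leLHS]mul1r ler_pM// ltW.
apply: (le_trans (kap_le a b gw)).
rewrite /sx powRD; last first.
  by rewrite gt_eqF ?implybT// mulr_gt0// (lt_trans ltr01)// gw.
rewrite mulrCA -[leLHS]mulr1 ler_wpM2l ?powR_ge0//.
rewrite powRN ler_pdivlMl ?powR_gt0// mulr1.
apply: ge0_ler_powR => //; first exact: ltW gam0.
  by rewrite nnegrE ltW.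
by rewrite nnegrE mulr_ge0.
Qed.

Lemma measurable_light (m : R) a b : measurable [set w | light (X w) m a b].
Proof.
have -> : [set w | light (X w) m a b] =
    (W (enum_val a) @^-1` `]-oo, m]%classic) `&` (W (enum_val b) @^-1` `]-oo, m]%classic).
  by apply/seteqP; split => w /=; rewrite !in_itv/= /light => /andP.
by apply: measurableI; apply: measurable_preim.
Qed.

Lemma nnm_bool (Q : T -> bool) : measurable [set w | Q w] -> nnm good (fun w => (Q w)%:R : R).
Proof.
move=> mQ; have -> : (fun w => (Q w)%:R) = \1_[set w | Q w] :> (T -> R).
  by apply/funext => w; rewrite indicE; congr (_%:R); congr nat_of_bool; rewrite mem_setE.
exact: nnm_indic.
Qed.

(** The rows of [s] sum to 1, so a bound proportional to [s a a'] survives the normalized double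
    sum. *)
Lemma average_le (F : 'I_n -> 'I_n -> T -> R) (b : R) :
  (forall a a', nnm good (F a a')) -> 0 <= b ->
  (forall a a', (\int[P]_(w in good) (F a a' w)%:E <= (s a a' * b)%:E)%E) ->
  nnm good (fun w => n%:R^-1 * \sum_a \sum_a' F a a' w) /\
  (\int[P]_(w in good) (n%:R^-1 * \sum_a \sum_a' F a a' w)%:E <= b%:E)%E.
Proof.
move=> nF b0 Fb.
have nS a : nnm good (fun w => \sum_a' F a a' w) by apply: nnm_sum.
have nn : 0 <= n%:R^-1 :> R by rewrite invr_ge0.
have nSS : nnm good (fun w => \sum_a \sum_a' F a a' w) by apply: nnm_sum.
split; first exact: nnmZ.
apply: (@le_trans _ _ (n%:R^-1 * \sum_(a < n) b)%:E); last first.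
  by rewrite lee_fin sumr_const card_ord -(mulr_natl b) mulKf// pnatr_eq0 -lt0n.
apply: intZ_le => //; apply: int_sum_le => // a.
apply: (@le_trans _ _ (\sum_a' s a a' * b)%:E); last first.
  by rewrite lee_fin -mulr_suml s_sum mul1r.
by apply: int_sum_le.
Qed.

Lemma int_heavy (m : R) : 1 < m ->
  nnm good (fun w => heavy_weight sigma s (X w) m) /\
  (\int[P]_(w in good) (heavy_weight sigma s (X w) m)%:E <=
   (m `^ (- gam) * C ^+ 2)%:E)%E.
Proof.
move=> m1; apply: average_le => [a b||a b].
- apply: nnmM; last by apply: nnmZ (nnm_kap a b).
  apply: nnm_bool; rewrite (_ : [set w | _] = ~` [set w | light (X w) m a b]).
    exact: measurableC (measurable_light _ _ _).
  by apply/seteqP; split => w /= /negP.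
- by rewrite mulr_ge0 ?powR_ge0// sqr_ge0.
have [->|ab] := eqVneq a b.
  rewrite (eq_integral (fun=> 0%E)) => [|w _]; last by rewrite s_diag mul0r mulr0.
  by rewrite integral0 s_diag mul0r.
apply: (@le_trans _ _ (\int[P]_(w in good) (s a b * (m `^ (- gam) * (X w a * X w b) `^ sx))%:E)%E).
  apply: int_le => //.
  - apply: nnmM; last by apply: nnmZ (nnm_kap a b).
    apply: nnm_bool; rewrite (_ : [set w | _] = ~` [set w | light (X w) m a b]).
      exact: measurableC (measurable_light _ _ _).
    by apply/seteqP; split => w /= /negP.
  - by apply: nnmZ => //; apply: nnmZ (powR_ge0 _ _) (nnm_powR _ _ _).
  move=> w gw; have [li|li] := boolP (light (X w) m a b).
    rewrite mul0r; apply: mulr_ge0; first exact: s_ge0.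
    by apply: mulr_ge0; apply: powR_ge0.
  by rewrite mul1r ler_wpM2l// heavy_kap_le.
apply: intZ_le => //; first by apply: nnmZ (powR_ge0 _ _) (nnm_powR _ _ _).
apply: intZ_le; [exact: mgood|exact: powR_ge0|exact: nnm_powR|].
exact: int_pair_moment.
Qed.

Lemma int_kernel :
  nnm good (fun w => n%:R^-1 * \sum_a \sum_b s a b * kap sigma (X w) a b) /\
  (\int[P]_(w in good) (n%:R^-1 * \sum_a \sum_b s a b * kap sigma (X w) a b)%:E <=
   (C ^+ 2)%:E)%E.
Proof.
apply: average_le => [a b||a b]; first by apply: nnmZ (nnm_kap a b).
  exact: sqr_ge0.
have [->|ab] := eqVneq a b.
  rewrite (eq_integral (fun=> 0%E)) => [|w _]; last by rewrite s_diag mul0r.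
  by rewrite integral0 s_diag mul0r.
apply: intZ_le => //; first exact: nnm_kap.
apply: le_trans (int_pair_moment ab); apply: int_le => //.
- exact: nnm_kap.
- exact: nnm_powR.
- by move=> w gw; apply: kap_le_moment.
Qed.

Section type_fluctuations.
Variables (m : R) (L : nat).
Hypotheses (m1 : 1 < m) (L0 : (0 < L)%N).

Local Notation ind x b w := ((wtype (X w) m L b == x)%:R : R).
Local Notation law x := (@type_law R (tau - 1) m L x).

Definition type_set (x : option 'I_L) : set R := [set z | type_of m L z == x].

Lemma type_setE x : type_set x =
  if x is Some k then `]mesh m L ^+ k, mesh m L ^+ k.+1]%classic
  else ~` `]1, m]%classic.
Proof.
apply/seteqP; split => z; rewrite /type_set; case: x => [k|] /=.
- by rewrite type_of_cell// in_itv.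
- by rewrite type_of_None// in_itv => /negP.
- by rewrite type_of_cell// in_itv.
- by rewrite type_of_None// in_itv => /negP.
Qed.

Lemma measurable_type_set x : measurable (type_set x).
Proof. by rewrite type_setE; case: x => [k|] //; apply: measurableC. Qed.

Lemma interval_law (b : 'I_n) (u v : R) : 1 <= u -> u <= v ->
  P (W (enum_val b) @^-1` `]u, v]%classic) =
  (u `^ (- (tau - 1)) - v `^ (- (tau - 1)))%:E.
Proof.
move=> u1 uv; have v1 := le_trans u1 uv.
have -> : W (enum_val b) @^-1` `]u, v]%classic =
    [set w | u < W (enum_val b) w] `\` [set w | v < W (enum_val b) w].
  apply/seteqP; split => w /=; rewrite in_itv/=.
    by move=> /andP[-> wv]; split => //; apply/negP; rewrite -leNgt.
  by move=> [-> /negP]; rewrite -leNgt.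
have mt z : measurable [set w | z < W (enum_val b) w].
  by rewrite tail_preim; apply: measurable_preim.
rewrite measureD//; last by rewrite -ge0_fin_numE ?fin_num_measure.
rewrite setIidr; last by move=> w /=; apply: le_lt_trans.
rewrite EFinB; congr (_ - _)%E.
  by rewrite [LHS](weight_pareto model) u1.
by rewrite [LHS](weight_pareto model) v1.
Qed.

Lemma type_set_law (b : 'I_n) x : P (W (enum_val b) @^-1` type_set x) = (law x)%:E.
Proof.
rewrite type_setE; case: x => [k|].
  apply: interval_law; last exact: mesh_le.
  by rewrite exprn_ege1// ltW// mesh_gt1.
have mI : measurable (W (enum_val b) @^-1` `]1, m]%classic) by apply: measurable_preim.
rewrite preimage_setC probability_setC//.
by rewrite interval_law ?(ltW m1)// powR1 -EFinB opprB addrC subrK.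
Qed.

Lemma nnm_ind x b : nnm good (fun w => ind x b w).
Proof.
apply: nnm_bool; exact: (measurable_preim (W (enum_val b)) (measurable_type_set x)).
Qed.

Lemma indE x b w : ind x b w = \1_(W (enum_val b) @^-1` type_set x) w.
Proof.
by rewrite indicE; congr (_%:R); congr nat_of_bool; rewrite mem_setE.
Qed.

Lemma int_ind x b : (\int[P]_(w in good) (ind x b w)%:E)%E = (law x)%:E.
Proof.
rewrite -(type_set_law b).
rewrite -(int_indic mgood Pgood (measurable_preim (W (enum_val b)) (measurable_type_set x))).
by apply: eq_integral => w _; rewrite indE.
Qed.

Lemma int_ind_pair x b b' :
  (\int[P]_(w in good) (ind x b w * ind x b' w)%:E)%E =
  (if b == b' then law x else law x * law x)%:E.
Proof.
have [->|bb] := eqVneq b b'.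
  rewrite -(int_ind x b'); apply: eq_integral => w _; congr (_%:E).
  by case: (_ == x); rewrite ?mulr1 ?mulr0.
rewrite EFinM -{1}(type_set_law b) -(type_set_law b').
rewrite -(indep_pair (weight_indep model)) ?(inj_eq enum_val_inj)//; try exact: measurable_type_set.
rewrite -(int_indic mgood Pgood); last first.
  by apply: measurableI; apply: measurable_preim; apply: measurable_type_set.
by apply: eq_integral => w _; rewrite !indE indicI.
Qed.

Lemma law01 x : 0 <= law x <= 1.
Proof.
rewrite type_law_ge0//=; pose b : 'I_n := Ordinal n0.
rewrite -lee_fin -(type_set_law b); apply: probability_le1.
by apply: measurable_preim; apply: measurable_type_set.
Qed.

Let Y a x w : R := \sum_b s a b * ind x b w - law x.

Lemma nnm_freq a x : nnm good (fun w => \sum_b s a b * ind x b w).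
Proof. by apply: nnm_sum => b; apply: nnmZ (nnm_ind x b). Qed.

Lemma measurable_Y a x : measurable_fun good (Y a x).
Proof. by apply: measurable_funB => //; case: (nnm_freq a x). Qed.

Lemma nnm_Ysqr a x : nnm good (fun w => Y a x w ^+ 2).
Proof.
split; first by move=> w _; apply: sqr_ge0.
by apply: measurable_funX; apply: measurable_Y.
Qed.

(** The variance of a weighted sum of independent indicators is at most the sum of the [s a b ^+ 2],
    hence at most the largest [s a b], which is at most [1 / c]. *)
Lemma int_Ysqr a x : (\int[P]_(w in good) (Y a x w ^+ 2)%:E <= (c^-1)%:E)%E.
Proof.
have /andP[q0 q1] := law01 x; set q := law x in q0 q1.
pose S w : R := \sum_b s a b * ind x b w.
have nS : nnm good S by apply: nnm_freq.
have iS : (\int[P]_(w in good) (S w)%:E)%E = q%:E.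
  rewrite /S int_sum//; last by move=> b; apply: nnmZ (nnm_ind x b).
  rewrite (eq_bigr (fun b => (s a b * q)%:E)) => [|b _].
    by rewrite sumEFin -mulr_suml s_sum mul1r.
  by rewrite intZ//; [rewrite int_ind EFinM|apply: nnm_ind].
have nSS b b' : nnm good (fun w => s a b * s a b' * (ind x b w * ind x b' w)).
  by apply: nnmZ; [apply: mulr_ge0|apply: nnmM; apply: nnm_ind].
have iSS : (\int[P]_(w in good) (\sum_b \sum_b' s a b * s a b' * (ind x b w * ind x b' w))%:E <=
    (q ^+ 2 + c^-1)%:E)%E.
  apply: (@le_trans _ _ (\sum_b \sum_b' s a b * s a b' * (if b == b' then q else q * q))%:E).
    apply: int_sum_le => // b; first by apply: nnm_sum.
    apply: int_sum_le => // b'; apply: intZ_le => //; first exact: mulr_ge0.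
      by apply: nnmM; apply: nnm_ind.
    by rewrite int_ind_pair.
  rewrite lee_fin.
  apply: (@le_trans _ _ (\sum_b (s a b * q ^+ 2 + c^-1 * s a b))); last first.
    by rewrite big_split/= -mulr_suml s_sum -mulr_sumr s_sum mul1r mulr1.
  apply: ler_sum => b _.
  rewrite (bigD1 b)//= eqxx addrC; apply: lerD.
    apply: (@le_trans _ _ (\sum_b' s a b * s a b' * q ^+ 2)); last first.
      by rewrite -mulr_suml -mulr_sumr s_sum mulr1.
    rewrite [leRHS](bigD1 b)//= -[leLHS]add0r; apply: lerD.
      by apply: mulr_ge0; [apply: mulr_ge0|apply: sqr_ge0].
    by apply: ler_sum => b' bb'; rewrite eq_sym (negbTE bb') expr2.
  rewrite -[leRHS]mulr1; apply: ler_pM => //; first exact: mulr_ge0.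
  rewrite ler_wpM2r//; move: (s_le a b); rewrite mulrC => H.
  by rewrite -[c^-1]mul1r ler_pdivlMr.
(* The cross term of the square is moved to the left, so that only integrals of nonnegative
   functions occur. *)
have E : (\int[P]_(w in good) (Y a x w ^+ 2)%:E + (2 * q * q)%:E =
    \int[P]_(w in good) (\sum_b \sum_b' s a b * s a b' * (ind x b w * ind x b' w))%:E + (q ^+ 2)%:E)%E.
  have -> : ((2 * q * q)%:E = \int[P]_(w in good) (2 * q * S w)%:E)%E.
    by rewrite intZ// ?iS ?EFinM//; apply: mulr_ge0.
  have -> : ((q ^+ 2)%:E = \int[P]_(w in good) (q ^+ 2)%:E)%E.
    by rewrite (int_cst mgood Pgood).
  rewrite -intD//; last 2 first.
  - exact: nnm_Ysqr.
  - by apply: nnmZ => //; apply: mulr_ge0.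
  rewrite -intD//; last 2 first.
  - by apply: nnm_sum => b; apply: nnm_sum.
  - by apply: nnm_cst; apply: sqr_ge0.
  apply: eq_integral => w _; congr (_%:E).
  have -> : \sum_b \sum_b' s a b * s a b' * (ind x b w * ind x b' w) = S w ^+ 2.
    rewrite expr2 /S mulr_suml; apply: eq_bigr => b _; rewrite mulr_sumr.
    by apply: eq_bigr => b' _; rewrite mulrACA.
  by rewrite /Y -/(S w) -/q; ring.
rewrite -(@leeD2rE _ (2 * q * q)%:E)// E.
apply: (le_trans (leeD iSS (lexx _))); rewrite -!EFinD lee_fin.
by rewrite le_eqVlt; apply/orP; left; apply/eqP; ring.
Qed.

Lemma int_type_error :
  nnm good (fun w => type_error (tau - 1) s (X w) m L) /\
  (\int[P]_(w in good) (type_error (tau - 1) s (X w) m L)%:E <=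
   (L.+1%:R * (2 * (Num.sqrt c)^-1))%:E)%E.
Proof.
set b0 := (Num.sqrt c)^-1.
have b00 : 0 < b0 by rewrite invr_gt0 sqrtr_gt0.
have b02 : b0 * b0 = c^-1 by rewrite -expr2 exprVn sqr_sqrtr// ltW.
have nY a x : nnm good (fun w => `|Y a x w|).
  split; first by move=> w _; apply: normr_ge0.
  by apply: measurableT_comp => //; apply: measurable_Y.
have iY a x : (\int[P]_(w in good) (`|Y a x w|)%:E <= (2 * b0)%:E)%E.
  have bV : 0 <= b0^-1 by rewrite invr_ge0 ltW.
  (* [|z| <= b0 + z ^+ 2 / b0]; the mean of [z ^+ 2] is at most [b0 ^+ 2], which gives [2 * b0]
     without a square root of integrals. *)
  apply: (@le_trans _ _ (\int[P]_(w in good) (b0 + b0^-1 * Y a x w ^+ 2)%:E)%E).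
    apply: int_le => //.
      by apply: nnmD; [apply: nnm_cst; apply: ltW|apply: nnmZ (nnm_Ysqr a x)].
    move=> w _; rewrite -subr_ge0; set z := Y a x w.
    have -> : b0 + b0^-1 * z ^+ 2 - `|z| = b0^-1 * ((b0 - 2^-1 * `|z|) ^+ 2 + 3 / 4 * z ^+ 2).
      have -> : z ^+ 2 = `|z| ^+ 2 by rewrite real_normK ?num_real.
      by field; rewrite gt_eqF.
    by rewrite mulr_ge0// addr_ge0 ?sqr_ge0// mulr_ge0 ?sqr_ge0.
  have -> : 2 * b0 = b0 + b0^-1 * c^-1 by rewrite -b02; field; rewrite gt_eqF.
  apply: intD_le => //.
  - by apply: nnm_cst; apply: ltW.
  - exact: nnmZ (nnm_Ysqr a x).
  - by rewrite (int_cst mgood Pgood).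
  - by apply: intZ_le => //; [apply: nnm_Ysqr|apply: int_Ysqr].
have nn : 0 <= n%:R^-1 :> R by rewrite invr_ge0.
have nA x : nnm good (fun w => n%:R^-1 * \sum_a `|Y a x w|).
  by apply: nnmZ => //; apply: nnm_sum.
split; first exact: nnm_sum.
apply: (@le_trans _ _ (\sum_(x : option 'I_L) 2 * b0)%:E); last first.
  by rewrite lee_fin sumr_const card_option card_ord -(mulr_natl (2 * b0)).
apply: int_sum_le => // x.
apply: (@le_trans _ _ (n%:R^-1 * \sum_(a < n) 2 * b0)%:E).
  have nS : nnm good (fun w => \sum_a `|Y a x w|) by apply: nnm_sum => a; apply: nY.
  have iS : (\int[P]_(w in good) (\sum_a `|Y a x w|)%:E <= (\sum_(a < n) 2 * b0)%:E)%E.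
    by apply: int_sum_le => // a; apply: iY.
  exact: (intZ_le mgood nn nS iS).
by rewrite lee_fin sumr_const card_ord -(mulr_natl (2 * b0)) mulKf// pnatr_eq0 -lt0n.
Qed.

End type_fluctuations.

End weight_integrals.

Section code_mean_theory.
Context {R : realType} {disp : measure_display} {T : measurableType disp}.
Variables (P : probability T R) (d N : nat) (adj : T -> rel (vertex d N)).
Implicit Types phi psi : {ffun 'I_#|{: vertex d N}| * 'I_#|{: vertex d N}| -> bool} -> R.

Lemma code_mean_mono phi psi : (forall w0, phi w0 <= psi w0) ->
  code_mean P adj phi <= code_mean P adj psi.
Proof. by move=> H; apply: ler_sum => w0 _; rewrite ler_wpM2l ?code_mass_ge0. Qed.

Lemma code_meanD phi psi :
  code_mean P adj (fun w0 => phi w0 + psi w0) = code_mean P adj phi + code_mean P adj psi.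
Proof. by rewrite -big_split; apply: eq_bigr => w0 _; rewrite mulrDr. Qed.

Lemma code_meanZ k phi : code_mean P adj (fun w0 => k * phi w0) = k * code_mean P adj phi.
Proof. by rewrite mulr_sumr; apply: eq_bigr => w0 _; rewrite mulrCA. Qed.

Lemma code_mean_cst tau (alpha sigma : R) (W : vertex d N -> {RV P >-> R}) k :
  kernel_random_graph tau alpha sigma W adj -> code_mean P adj (fun=> k) = k.
Proof. by move=> model; rewrite /code_mean -mulr_suml (sum_code_mass model) mul1r. Qed.

End code_mean_theory.

(** * Universal limits of linear statistics *)

Section universality.
Context {R : realType}.
Variables (tau sigma : R).
Hypotheses (tau2 : 2 < tau) (sigma0 : 0 < sigma) (sigma1 : sigma < tau - 1).

Let gam : R := (tau - 1 - Num.max 1 sigma) / 2.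
(** The exponent is the same midpoint as in the weight integrals; the value bounds the mean of
    [lin_stat] of [x ^+ 2] for large [N]. *)
Definition second_moment : R :=
  moment_const (tau - 1) (Num.max 1 sigma + (tau - 1 - Num.max 1 sigma) / 2) ^+ 2.
Local Notation V := second_moment.

Let gam0 : 0 < gam.
Proof.
rewrite divr_gt0// subr_gt0 gt_max sigma1 andbT ltrBrDr.
exact: le_lt_trans tau2.
Qed.

Let V0 : 0 <= V. Proof. exact: sqr_ge0. Qed.

Definition model_mean {disp} {T : measurableType disp} (P : probability T R) d N (alpha : R)
    (adj : T -> rel (vertex d N)) (phi : R -> R) (l : R) : R :=
  code_mean P adj (fun w0 => `|lin_stat (gmat (scaling d N alpha) w0) phi - l|).

(** [l] and [e] precede [d], [alpha] and the probability space; the threshold on [N] is the only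
    quantity that depends on [d] and [alpha]. *)
Definition eventually_close (f : R -> R) (l e : R) : Prop :=
  forall d (alpha : R), (0 < d)%N -> 0 < alpha -> alpha < d%:R ->
  exists N0, forall N, (N0 <= N)%N -> forall disp (T : measurableType disp)
    (P : probability T R) (W : vertex d N -> {RV P >-> R}) (adj : T -> rel (vertex d N)),
  kernel_random_graph tau alpha sigma W adj -> model_mean P alpha adj f l <= e.

(** The value may change with the tolerance; [stabilizes_limit] extracts a single one. *)
Definition stabilizes (f : R -> R) : Prop :=
  forall e, 0 < e -> exists l, eventually_close f l e.

(** Order of choices: [eta] from [e], then [m] so that heavy pairs cost at most [e / 4], then [L],
    [l] and [C] from [m], and finally [N], which makes spread and type error small against [C]. *)
Lemma generator_stabilizes y f phi : is_generator y f phi -> 1 <= y -> stabilizes f.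
Proof.
move=> gen y1 e e0; have t00 := lt_trans sigma0 sigma1.
pose eta := e / 8; have eta0 : 0 < eta by rewrite divr_gt0.
have etaE : 2 * eta = e / 4 by rewrite /eta; field.
clearbody eta.
(* Chosen so that [m ^ gam] exceeds [eta^-1 * V * (4 / e)]; the final 1 ensures [m > 1]. *)
pose m := (1 + eta^-1 * V * (4 / e)) `^ gam^-1 + 1.
have b0 : 0 <= eta^-1 * V * (4 / e).
  by apply: mulr_ge0; [apply: mulr_ge0 => //; rewrite invr_ge0 ltW|rewrite divr_ge0// ltW].
have m1 : 1 < m by rewrite ltrDr powR_gt0// ltr_pwDl.
have mV : eta^-1 * (m `^ (- gam) * V) <= e / 4.
  have mg : 1 + eta^-1 * V * (4 / e) <= m `^ gam.
    have -> : 1 + eta^-1 * V * (4 / e) = ((1 + eta^-1 * V * (4 / e)) `^ gam^-1) `^ gam.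
      by rewrite -powRrM mulVf ?gt_eqF// powRr1// addr_ge0.
    apply: ge0_ler_powR; rewrite ?nnegrE ?(ltW gam0) ?powR_ge0 ?(ltW (lt_trans ltr01 m1))//.
    by rewrite lerDl.
  have mg0 : 0 < m `^ gam by apply: powR_gt0; apply: lt_trans m1.
  rewrite powRN mulrCA -ler_pdivlMl ?invr_gt0// invrK.
  have -> : eta^-1 * V = e / 4 * (eta^-1 * V * (4 / e)) by field; rewrite !gt_eqF.
  by rewrite mulrC ler_wpM2r ?divr_ge0 ?(ltW e0)//; apply: le_trans mg; rewrite lerDr.
have [L [l [C [L0 C0 H]]]] := gmat_universal sigma0 t00 m1 gen y1 eta0.
exists l => d alpha d0 alpha0 alphad.
(* The spread and the terms in [1 / sqrt c] are each held to [del], so that [C] times their sum is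
   at most [e / 2]. *)
pose del := e / (4 * (C + 1)).
have C1 : 0 < C + 1 by rewrite ltr_wpDl.
have del0 : 0 < del by rewrite divr_gt0// mulr_gt0.
pose K := (2 * L.+1%:R + 1) / del : R.
have K0 : 0 < K by rewrite divr_gt0.
have [N1 sc] := scaling_diverges d0 alpha0 alphad (Num.max 1 (K ^+ 2)).
have [N2 sp] := spread_vanishes d0 alpha0 alphad del0.
exists (maxn 1 (maxn N1 N2)) => N; rewrite !geq_max => /and3P[N0 NN1 NN2].
move=> disp T P W adj model.
have := sc _ NN1; rewrite ge_max => /andP[c1 cK].
have [nh ih] := int_heavy N0 tau2 sigma1 model c1 m1.
have [nt it] := int_type_error N0 alpha0 tau2 model c1 m1 L0.
have mg : measurable (good W) by apply: measurable_good.
have Pg : P (good W) = 1%E by apply: probability_good model.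
have spN := sp _ NN2; set s0 := spread _ _ in spN.
set rc := (Num.sqrt (scaling d N alpha))^-1 in it.
have c0 : 0 < scaling d N alpha := lt_le_trans ltr01 c1.
have s00 : 0 <= s0.
  rewrite /s0 /spread mulr_ge0 ?invr_ge0//; apply: sumr_ge0 => a _; apply: sumr_ge0 => b _.
  by rewrite mulr_ge0 ?sqr_ge0// ltW.
have rc0 : 0 < rc by rewrite invr_gt0 sqrtr_gt0.
have rcK : rc <= K^-1.
  rewrite lef_pV2 ?posrE ?sqrtr_gt0//.
  by rewrite -(ler_pXn2r (ltn0Sn 1)) ?nnegrE ?sqrtr_ge0 ?(ltW K0)// sqr_sqrtr// ltW.
apply: (@code_mean_le _ _ _ _ _ _ tau alpha sigma W adj N0 alpha0 model c1 _
  (fun w => 2 * eta + eta^-1 * heavy_weight sigma (profile alpha (N:=N)) (wvec W w) m +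
   C * (type_error (tau - 1) (profile alpha (N:=N)) (wvec W w) m L + s0 + rc))).
- by move=> w0; apply: normr_ge0.
- apply: nnmD; first apply: nnmD.
  + by apply: nnm_cst; rewrite mulr_ge0 ?(ltW eta0).
  + by apply: nnmZ nh; rewrite invr_ge0 ltW.
  + apply: nnmZ => //; apply: nnmD; last by apply: nnm_cst; apply: ltW.
    by apply: nnmD => //; apply: nnm_cst.
- by move=> w gw; apply: H; apply: admissible_good.
have bound : 2 * eta + eta^-1 * (m `^ (- gam) * V) +
    C * (L.+1%:R * (2 * rc) + s0 + rc) <= e.
  rewrite etaE.
  have cd : C * (L.+1%:R * (2 * rc) + s0 + rc) <= C * (2 * del).
    rewrite ler_wpM2l//.
    have -> : L.+1%:R * (2 * rc) + s0 + rc = (2 * L.+1%:R + 1) * rc + s0 by ring.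
    have -> : 2 * del = del + del by ring.
    apply: lerD => //; apply: (@le_trans _ _ ((2 * L.+1%:R + 1) * K^-1)); first exact: ler_wpM2l.
    by rewrite /K invfM invrK mulrA mulfV ?mul1r// gt_eqF.
  have cd2 : C * (2 * del) <= e / 2.
    have -> : C * (2 * del) = e / 2 * (C / (C + 1)) by rewrite /del; field; rewrite gt_eqF.
    rewrite -[leRHS]mulr1 ler_wpM2l ?divr_ge0 ?(ltW e0)//.
    by rewrite ler_pdivrMr// mul1r lerDl.
  move: mV cd cd2; set A := eta^-1 * _; set B := C * _; set D := C * _.
  by move: A B D => A B D; lra.
apply: le_trans (_ : _ <= (2 * eta + eta^-1 * (m `^ (- gam) * V) +
    C * (L.+1%:R * (2 * rc) + s0 + rc))%:E)%E _; last by rewrite lee_fin.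
have eta1 : 0 <= eta^-1 by rewrite invr_ge0 ltW.
have n1 : nnm (good W) (fun=> 2 * eta) by apply: nnm_cst; rewrite mulr_ge0 ?(ltW eta0).
have n2 := nnmZ eta1 nh.
have n3 : nnm (good W) (fun=> s0) by apply: nnm_cst.
have n4 : nnm (good W) (fun=> rc) by apply: nnm_cst; apply: ltW.
have n5 := nnmD nt n3; have n6 := nnmD n5 n4.
apply: (intD_le mg (nnmD n1 n2) (nnmZ C0 n6)).
  by apply: (intD_le mg n1 n2); [rewrite (int_cst mg Pg)|apply: (intZ_le mg eta1 nh)].
apply: (intZ_le mg C0 n6); apply: (intD_le mg n5 n4); last by rewrite (int_cst mg Pg).
by apply: (intD_le mg nt n3) => //; rewrite (int_cst mg Pg).
Qed.

Lemma second_moment_bound d (alpha : R) : (0 < d)%N -> 0 < alpha -> alpha < d%:R ->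
  exists N0, forall N, (N0 <= N)%N -> forall disp (T : measurableType disp)
    (P : probability T R) (W : vertex d N -> {RV P >-> R}) (adj : T -> rel (vertex d N)),
  kernel_random_graph tau alpha sigma W adj ->
  (0 < N)%N /\ code_mean P adj (fun w0 => lin_stat (gmat (scaling d N alpha) w0) (fun x => x ^+ 2)) <= V.
Proof.
move=> d0 alpha0 alphad; have [N1 sc] := scaling_diverges d0 alpha0 alphad 1.
exists (maxn 1 N1) => N; rewrite geq_max => /andP[N0 NN1] disp T P W adj model; split => //.
have c1 := sc _ NN1.
have [nk ik] := int_kernel N0 tau2 sigma1 model c1.
apply: (code_mean_le N0 alpha0 model c1 _ nk) => // [w0|w gw].
  rewrite /lin_stat mulr_ge0 ?invr_ge0//; apply: sumr_ge0 => x _; exact: sqr_ge0.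
by apply: gmat_sqr_mean; apply: admissible_good.
Qed.

Definition limit f l := forall e, 0 < e -> eventually_close f l e.

Lemma limit_one : limit (fun=> 1) 1.
Proof.
move=> e e0 d alpha d0 alpha0 alphad.
exists 1%N => N N0 disp T P W adj model; rewrite /model_mean -(code_mean_cst e model).
apply: code_mean_mono => w0; rewrite lin_stat_cst ?gmat_sym//; last first.
  by rewrite card_vertex expn_gt0 N0.
by rewrite subrr normr0 ltW.
Qed.

Lemma eventually_closeD f g l k e e' : eventually_close f l e -> eventually_close g k e' ->
  eventually_close (fun x => f x + g x) (l + k) (e + e').
Proof.
move=> Hf Hg d alpha d0 alpha0 alphad.
have [N1 K1] := Hf _ _ d0 alpha0 alphad; have [N2 K2] := Hg _ _ d0 alpha0 alphad.
exists (maxn N1 N2) => N; rewrite geq_max => /andP[NN1 NN2] disp T P W adj model.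
apply: le_trans (lerD (K1 _ NN1 _ _ _ _ _ model) (K2 _ NN2 _ _ _ _ _ model)).
rewrite /model_mean -code_meanD; apply: code_mean_mono => w0.
by rewrite lin_statD opprD addrACA ler_normD.
Qed.

Lemma eventually_closeZ f l e k : eventually_close f l e ->
  eventually_close (fun x => k * f x) (k * l) (`|k| * e).
Proof.
move=> Hf d alpha d0 alpha0 alphad; have [N1 K1] := Hf _ _ d0 alpha0 alphad.
exists N1 => N NN1 disp T P W adj model.
apply: le_trans (ler_wpM2l (normr_ge0 k) (K1 _ NN1 _ _ _ _ _ model)).
rewrite /model_mean -code_meanZ; apply: code_mean_mono => w0.
by rewrite lin_statZ -mulrBr normrM.
Qed.

(** The spectrum has second moment at most [V] in mean, so an approximation up to [1 + x ^+ 2] is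
    affordable, as [clspan_ramp] provides it. *)
Lemma eventually_close_approx f g l e b : 0 <= b -> eventually_close g l e ->
  (forall x, `|f x - g x| <= b * (1 + x ^+ 2)) ->
  eventually_close f l (e + b * (1 + V)).
Proof.
move=> b0 Hg fg d alpha d0 alpha0 alphad.
have [N1 K1] := Hg _ _ d0 alpha0 alphad.
have [N2 K2] := second_moment_bound d0 alpha0 alphad.
exists (maxn N1 N2) => N; rewrite geq_max => /andP[NN1 NN2] disp T P W adj model.
have [N0 K] := K2 _ NN2 _ _ _ _ _ model.
rewrite addrC; apply: le_trans (lerD (ler_wpM2l b0 (lerD (lexx 1) K)) (K1 _ NN1 _ _ _ _ _ model)).
rewrite -{1}(code_mean_cst 1 model) /model_mean -code_meanD -code_meanZ -code_meanD.
apply: code_mean_mono => w0; rewrite -(subrKA (lin_stat (gmat (scaling d N alpha) w0) g)).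
apply: (le_trans (ler_normD _ _)); rewrite lerD2r; apply: (le_trans (lin_statB_le _ _ _)).
apply: (le_trans (lin_stat_le _ fg)); rewrite lin_statZ lin_statD lin_stat_cst ?gmat_sym//.
by rewrite card_vertex expn_gt0 N0.
Qed.

Lemma stabilizes_approx f :
  (forall e, 0 < e -> exists2 g, stabilizes g & forall x, `|f x - g x| <= e * (1 + x ^+ 2)) ->
  stabilizes f.
Proof.
move=> H e e0; have V1 : 0 < 1 + V by rewrite ltr_pwDl.
have b0 : 0 < e / 2 / (1 + V) by rewrite !divr_gt0.
have [g Ug fg] := H _ b0; have [l Hl] := Ug (e / 2) (divr_gt0 e0 (ltr0Sn _ 1)).
exists l; have := eventually_close_approx (ltW b0) Hl fg.
by rewrite divfK ?gt_eqF// -splitr.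
Qed.

Lemma stabilizes_clspan f : clspan 1 f -> stabilizes f.
Proof.
apply: clspan_minimal.
- by move=> e e0; exists 1; apply: limit_one.
- by move=> y y1; apply: (@generator_stabilizes y _ (fun z => y^-1 * complex.Im z)) => //; left.
- by move=> y y1; apply: (@generator_stabilizes y _ (@complex.Re R)) => //; right.
- move=> g h Ug Uh e e0; have e2 : 0 < e / 2 by rewrite divr_gt0.
  have [l Hl] := Ug _ e2; have [k Hk] := Uh _ e2.
  by exists (l + k); rewrite (splitr e); apply: eventually_closeD.
- move=> c g Ug e e0; have c1 : 0 < `|c| + 1 by rewrite ltr_wpDl.
  have [l Hl] := Ug _ (divr_gt0 e0 c1); exists (c * l).
  move=> d alpha d0 alpha0 alphad.
  have [N1 K1] := eventually_closeZ c Hl d0 alpha0 alphad.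
  exists N1 => N NN1 disp T P W adj model; apply: le_trans (K1 _ NN1 _ _ _ _ _ model) _.
  by rewrite mulrCA -[leRHS]mulr1 ler_wpM2l ?(ltW e0)// ler_pdivrMr// mul1r lerDl.
- move=> g H; apply: stabilizes_approx => e e0; have [h Uh gh] := H _ e0.
  exists h => // x; apply: (le_trans (gh x)).
  by rewrite -[leLHS]mulr1 ler_wpM2l ?(ltW e0)// lerDl sqr_ge0.
Qed.

Lemma stabilizes_ramp a h : 0 < h -> stabilizes (ramp a h).
Proof.
move=> h0; apply: stabilizes_approx => e e0.
have [g cg ag] := clspan_ramp (lexx 1) a h0 e0.
by exists g => //; apply: stabilizes_clspan.
Qed.

(* Without models of arbitrarily large size the theorem is vacuous; with them, the
   limits are unique. *)
Definition realizable : Prop := exists d (alpha : R), [/\ (0 < d)%N, 0 < alpha, alpha < d%:R &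
  forall N0, exists2 N, (N0 <= N)%N & exists disp (T : measurableType disp)
    (P : probability T R) (W : vertex d N -> {RV P >-> R}) (adj : T -> rel (vertex d N)),
  kernel_random_graph tau alpha sigma W adj].

Hypothesis model_exists : realizable.

(** Both approximations are read on one large model, where the pointwise inequality passes to the
    statistics and [k * x ^+ 2] costs [k * V]; [realizable] supplies that model. *)
Lemma eventually_close_le f g l l' e e' k : 0 <= k ->
  eventually_close f l e -> eventually_close g l' e' -> (forall x, f x <= g x + k * x ^+ 2) ->
  l <= l' + k * V + (e + e').
Proof.
move=> k0 Hf Hg fg; have [d [alpha [d0 alpha0 alphad ex]]] := model_exists.
have [N1 K1] := Hf _ _ d0 alpha0 alphad; have [N2 K2] := Hg _ _ d0 alpha0 alphad.
have [N3 K3] := second_moment_bound d0 alpha0 alphad.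
have [N] := ex (maxn N1 (maxn N2 N3)); rewrite !geq_max => /and3P[NN1 NN2 NN3].
move=> [disp [T [P [W [adj model]]]]].
have H1 := K1 _ NN1 _ _ _ _ _ model; have H2 := K2 _ NN2 _ _ _ _ _ model.
have [_ H3] := K3 _ NN3 _ _ _ _ _ model.
have -> : l' + k * V + (e + e') = e + e' + l' + k * V by ring.
apply: le_trans (lerD (lerD (lerD H1 H2) (lexx l')) (ler_wpM2l k0 H3)).
rewrite -{1}(code_mean_cst l model) -[X in _ <= _ + X + _](code_mean_cst l' model).
rewrite /model_mean -code_meanZ -!code_meanD; apply: code_mean_mono => w0.
set A := gmat _ _; have := lin_stat_le A fg; rewrite lin_statD lin_statZ.
have := ler_norm (l - lin_stat A f); rewrite distrC.
have := ler_norm (lin_stat A g - l').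
set u := `|_|; set v := `|_|; lra.
Qed.

Lemma limit_le f g l l' k : 0 <= k -> limit f l -> limit g l' ->
  (forall x, f x <= g x + k * x ^+ 2) -> l <= l' + k * V.
Proof.
move=> k0 Hf Hg fg; apply/ler_addgt0Pr => e e0.
have e2 : 0 < e / 2 by rewrite divr_gt0.
by have := eventually_close_le k0 (Hf _ e2) (Hg _ e2) fg; rewrite -splitr.
Qed.

Lemma limit_zero : limit (fun=> 0) 0.
Proof.
move=> e e0; have := eventually_closeZ 0 (limit_one e0).
rewrite normr0 !mul0r.
move=> H d alpha d0 alpha0 alphad; have [N1 K1] := H _ _ d0 alpha0 alphad.
exists N1 => N NN1 disp T P W adj model.
by apply: le_trans (K1 _ NN1 _ _ _ _ _ model) (ltW e0).
Qed.

(** A Cauchy argument over tolerances: any [l' - e'] is at most any [l + e], so the supremum of the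
    former lies within [e] of every value [l] admissible for [e]. *)
Lemma stabilizes_limit f : stabilizes f -> exists l, limit f l.
Proof.
move=> Uf; pose S := [set r | exists l e, [/\ 0 < e, eventually_close f l e & r = l - e]].
have ub l e : eventually_close f l e -> ubound S (l + e).
  move=> H r [l' [e' [_ H' ->]]].
  have ff x : f x <= f x + 0 * x ^+ 2 by rewrite mul0r addr0.
  by have := eventually_close_le (lexx 0) H' H ff; rewrite mul0r; lra.
exists (sup S) => e e0; have e2 : 0 < e / 2 by rewrite divr_gt0.
have [l Hl] := Uf _ e2.
have Sl : S (l - e / 2) by exists l, (e / 2).
have l1 : l - e / 2 <= sup S by apply: ub_le_sup => //; exists (l + e / 2); apply: ub.
have l2 : sup S <= l + e / 2 by apply: ge_sup; [exists (l - e / 2)|apply: ub].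
move=> d alpha d0 alpha0 alphad; have [N1 K1] := Hl _ _ d0 alpha0 alphad.
exists N1 => N NN1 disp T P W adj model; have K := K1 _ NN1 _ _ _ _ _ model.
rewrite [leRHS]splitr; apply: le_trans (lerD K (lexx _)).
rewrite /model_mean -[X in _ <= _ + X](code_mean_cst (e / 2) model) -code_meanD.
apply: code_mean_mono => w0; rewrite -(subrKA l); apply: (le_trans (ler_normD _ _)).
by rewrite lerD2l ler_distlC l1 l2.
Qed.

Lemma ramp_limit a h : 0 < h -> exists l, limit (ramp a h) l.
Proof. by move=> h0; apply: stabilizes_limit; apply: stabilizes_ramp. Qed.

End universality.

(** * The limiting measure *)

Section limit_distribution.
Context {R : realType}.
Implicit Types (a b h x : R).

Lemma ramp_eq1 a h x : 0 < h -> x <= a -> ramp a h x = 1.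
Proof.
move=> h0 xa; rewrite /ramp; have H : 1 <= (a + h - x) / h by rewrite ler_pdivlMr// mul1r; lra.
by rewrite min_l// max_r.
Qed.

Lemma ramp_eq0 a h x : 0 < h -> a + h <= x -> ramp a h x = 0.
Proof.
move=> h0 xa; rewrite /ramp max_l// ge_min ler_pdivrMr// mul0r.
by apply/orP; right; lra.
Qed.

Lemma ramp_step a h b h' x : 0 < h -> 0 < h' -> a + h <= b -> ramp a h x <= ramp b h' x.
Proof.
move=> h0 h'0 ab; have [xb|bx] := leP x b.
  by rewrite (ramp_eq1 h'0 xb) ramp_le1.
by rewrite ramp_eq0 ?ramp_ge0//; apply: le_trans ab (ltW bx).
Qed.

Lemma probability_of_cdf (F : R -> R) : nondecreasing F -> right_continuous F ->
  F @ -oo --> (0 : R) -> F @ +oo --> (1 : R) ->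
  exists mu : probability (measurableTypeR R) R,
    forall x, mu `]-oo, x]%classic = (F x)%:E.
Proof.
move=> nF rF F0 F1.
pose b := isCumulative.Build R _ R F nF rF.
pose b' := isCumulativeBounded.Build R 0 1 F F0 F1.
pose G : cumulativeBounded (0:R) (1:R) := HB.pack F b b'.
exists (lebesgue_stieltjes_measure G : probability _ _) => x.
exact: (cdf_lebesgue_stieltjes_id G x).
Qed.

Variables (tau sigma : R).
Hypotheses (tau2 : 2 < tau) (sigma0 : 0 < sigma) (sigma1 : sigma < tau - 1).
Hypothesis model_exists : realizable tau sigma.
Local Notation V := (second_moment tau sigma).
Local Notation limit := (limit tau sigma).

Definition limit_values a : set R :=
  [set l | exists b h, [/\ a < b, 0 < h & limit (ramp b h) l]].

(* Taking the infimum over all ramps starting beyond [a] makes right continuity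
   automatic. *)
Definition limit_cdf a : R := inf (limit_values a).
Local Notation F := limit_cdf.

Let V0 : 0 <= V. Proof. exact: sqr_ge0. Qed.

Let rlim b h : 0 < h -> exists l, limit (ramp b h) l := ramp_limit tau2 sigma0 sigma1 model_exists b (h:=h).

Let lim_le f g l l' : limit f l -> limit g l' -> (forall x, f x <= g x) -> l <= l'.
Proof.
move=> Hf Hg fg; have := limit_le tau2 sigma1 model_exists (lexx 0) Hf Hg.
by rewrite mul0r addr0; apply => x; rewrite mul0r addr0.
Qed.

Lemma limit_values_ge0 a l : limit_values a l -> 0 <= l.
Proof.
by move=> [b [h [_ h0 H]]]; apply: (lim_le (limit_zero _ _) H) => x; apply: ramp_ge0.
Qed.

Lemma limit_values_le1 a l : limit_values a l -> l <= 1.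
Proof.
by move=> [b [h [_ h0 H]]]; apply: (lim_le H (limit_one _ _)) => x; apply: ramp_le1.
Qed.

Let lbv a : has_lbound (limit_values a).
Proof. by exists 0 => l; apply: limit_values_ge0. Qed.

Let nev a : limit_values a !=set0.
Proof. by have [l H] := rlim (a + 1) ltr01; exists l, (a + 1), 1; rewrite ltrDl. Qed.

Lemma limit_cdf_le a b h l : a < b -> 0 < h -> limit (ramp b h) l -> F a <= l.
Proof. by move=> ab h0 H; apply: ge_inf => //; exists b, h. Qed.

Lemma limit_cdf_ge a l : (forall b h k, a < b -> 0 < h -> limit (ramp b h) k -> l <= k) -> l <= F a.
Proof. by move=> H; apply: lb_le_inf => // k [b [h [ab h0 Hk]]]; apply: (H b h). Qed.

Lemma limit_cdf_nondecreasing : nondecreasing F.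
Proof.
move=> a a' aa'; apply: limit_cdf_ge => b h k ab h0 Hk.
by apply: limit_cdf_le Hk => //; apply: le_lt_trans ab.
Qed.

Lemma limit_cdf_right_continuous : right_continuous F.
Proof.
move=> a; apply/cvgrPdist_le => e e0.
have : exists2 l, limit_values a l & l < F a + e.
  by apply: inf_adherent => //; split.
move=> [l [b [h [ab h0 Hl]]] lF]; near=> x.
have ax : a < x by near: x; apply: nbhs_right_gt.
have xb : x < b by near: x; apply: nbhs_right_lt.
have F1 := limit_cdf_nondecreasing (ltW ax).
have F2 := limit_cdf_le xb h0 Hl.
by rewrite ler_distlC; apply/andP; split; lra.
Unshelve. all: by end_near. Qed.

Lemma limit_cdf_ge0 a : 0 <= F a.
Proof. by apply: limit_cdf_ge => b h k ab h0 Hk; apply: (@limit_values_ge0 a); exists b, h. Qed.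

Lemma limit_cdf_le1 a : F a <= 1.
Proof.
have [l Hl] := rlim (a + 1) ltr01.
have aa : a < a + 1 by rewrite ltrDl.
apply: (le_trans (limit_cdf_le aa ltr01 Hl)).
by apply: (@limit_values_le1 a); exists (a + 1), 1.
Qed.

Lemma limit_cdf_left a : 0 < a -> F (- (2 * a)) <= a ^- 2 * V.
Proof.
move=> a0; have h0 : 0 < a / 2 by rewrite divr_gt0.
(* This ramp descends strictly beyond [- (2 * a)] and vanishes from [- a] on, so it is at most
   [x ^+ 2 / a ^+ 2]: a Chebyshev bound. *)
have [l Hl] := rlim (- (3 / 2 * a)) h0.
have ab : - (2 * a) < - (3 / 2 * a) by lra.
apply: (le_trans (limit_cdf_le ab h0 Hl)).
have aV : 0 <= a ^- 2 by rewrite invr_ge0 sqr_ge0.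
rewrite -[leRHS]add0r; apply: (limit_le tau2 sigma1 model_exists aV Hl (limit_zero _ _)) => x.
rewrite add0r; have [xa|ax] := leP x (- a); last first.
  by rewrite ramp_eq0//; [rewrite mulr_ge0// sqr_ge0|lra].
apply: (le_trans (ramp_le1 _ _ _)); rewrite ler_pdivlMl ?exprn_gt0//.
by rewrite mulr1 -(sqrrN x) ler_pXn2r ?nnegrE//; lra.
Qed.

(** Chebyshev again: where a ramp starting beyond [a] drops below 1, [x] exceeds [a]. *)
Lemma limit_cdf_right a : 0 < a -> 1 - a ^- 2 * V <= F a.
Proof.
move=> a0; apply: limit_cdf_ge => b h k ab h0 Hk; rewrite lerBlDr.
have aV : 0 <= a ^- 2 by rewrite invr_ge0 sqr_ge0.
apply: (limit_le tau2 sigma1 model_exists aV (limit_one _ _) Hk) => x.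
have [xb|bx] := leP x b.
  by rewrite ramp_eq1// lerDl mulr_ge0// sqr_ge0.
rewrite -[leLHS]add0r lerD ?ramp_ge0//.
rewrite ler_pdivlMl ?exprn_gt0// mulr1.
by rewrite ler_pXn2r ?nnegrE//; lra.
Qed.

Let small e : 0 < e -> exists2 a, 0 < a & forall b, a <= b -> b ^- 2 * V <= e.
Proof.
move=> e0; pose a := 1 + V / e; have a1 : 1 <= a by rewrite lerDl divr_ge0// ltW.
have a0 := lt_le_trans ltr01 a1; exists a => // b ab.
have b0 := lt_le_trans a0 ab.
rewrite ler_pdivrMl ?exprn_gt0//.
have : V / e <= b ^+ 2.
  apply: (@le_trans _ _ a); first by rewrite lerDr.
  by apply: (le_trans ab); rewrite expr2 ler_peMr ?(ltW b0)// (le_trans a1).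
by rewrite ler_pdivrMr.
Qed.

Lemma limit_cdf_Ny : F @ -oo --> (0 : R).
Proof.
apply/cvgrPdist_le => e e0; have [a a0 H] := small e0.
near=> x; have xa : x <= - (2 * a) by near: x; apply: nbhs_ninfty_le; rewrite num_real.
rewrite sub0r normrN ger0_norm ?limit_cdf_ge0//.
apply: (le_trans (limit_cdf_nondecreasing xa)); apply: (le_trans (limit_cdf_left a0)).
exact: H.
Unshelve. all: by end_near. Qed.

Lemma limit_cdf_y : F @ +oo --> (1 : R).
Proof.
apply/cvgrPdist_le => e e0; have [a a0 H] := small e0.
near=> x; have xa : a <= x by near: x; apply: nbhs_pinfty_ge; rewrite num_real.
rewrite ger0_norm ?subr_ge0 ?limit_cdf_le1//.
have := limit_cdf_right a0; have := limit_cdf_nondecreasing xa; have := H _ (lexx a).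
set u := _ * V; lra.
Unshelve. all: by end_near. Qed.

Lemma limit_ramp_le a h l : 0 < h -> limit (ramp a h) l -> l <= F (a + h).
Proof.
move=> h0 Hl; apply: limit_cdf_ge => b h' k ab h'0 Hk.
by apply: (lim_le Hl Hk) => x; apply: ramp_step => //; apply: ltW.
Qed.

End limit_distribution.

(** * The Levy-Prokhorov distance from distribution functions on a grid *)

Section prokhorov_distance.
Context {R : realType}.
Local Notation meas := {measure set (measurableTypeR R) -> \bar R}.
Implicit Types (mu nu : meas) (F G : R -> R).

Lemma measurable_eps_nbhd (B : set R) (e : R) : measurable (eps_nbhd B e : set (measurableTypeR R)).
Proof.
have -> : eps_nbhd B e = \bigcup_(y in B) ball y e.
  apply/seteqP; split => x [y By xy]; exists y => //; move: xy; rewrite /ball/= distrC//.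
by apply: open_measurable; apply: bigcup_open => y _; apply: ball_open.
Qed.

Section grid.
Variables (x : nat -> R) (K : nat) (e : R).
Hypotheses (x_lt : forall k, x k < x k.+1) (x_gap : forall k, x k.+1 - x k < e).

Local Notation cell k := (`]x k, x k.+1]%classic : set (measurableTypeR R)).

Lemma grid_le k l : (k <= l)%N -> x k <= x l.
Proof.
move=> /subnKC <-; elim: (l - k)%N => [|i IH]; first by rewrite addn0.
by rewrite addnS; apply: le_trans IH (ltW (x_lt _)).
Qed.

Lemma grid_locate n y : x 0%N < y -> y <= x n -> exists2 k, (k < n)%N & cell k y.
Proof.
elim: n => [|n IH] y0 yn; first by move: (lt_le_trans y0 yn); rewrite ltxx.
have [yn'|yn'] := leP y (x n); last by exists n => //=; rewrite in_itv/= yn' yn.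
by have [k kn Hk] := IH y0 yn'; exists k => //; apply: leqW.
Qed.

Lemma trivIset_cell : trivIset [set: 'I_K] (fun k : 'I_K => cell k).
Proof.
apply/trivIsetP => k l _ _ kl; apply/seteqP; split => // y []/=.
rewrite !in_itv/= => /andP[k1 k2] /andP[l1 l2].
have [kl'|lk|E] := ltngtP k l; last by move: kl; rewrite -val_eqE/= E eqxx.
  by have := le_lt_trans (le_trans k2 (grid_le kl')) l1; rewrite ltxx.
by have := le_lt_trans (le_trans l2 (grid_le lk)) k1; rewrite ltxx.
Qed.

(** Cells are shorter than [e], so a cell meeting [B] lies in its [e]-neighbourhood. [B] is covered
    by the two tails and such cells, whose masses are compared one by one. *)
Lemma prokhorov_half mu nu (t del : R) : 0 <= del ->
  (mu `]-oo, x 0%N]%classic <= t%:E)%E -> (mu `]x K, +oo[%classic <= t%:E)%E ->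
  (forall k : 'I_K, mu (cell k) <= nu (cell k) + del%:E)%E -> 2 * t + K%:R * del <= e ->
  forall B : set (measurableTypeR R), measurable B -> (mu B <= nu (eps_nbhd B e) + e%:E)%E.
Proof.
move=> del0 tl tr ck te B mB.
pose S (k : 'I_K) := `[< exists2 y, B y & cell k y >].
pose U := \big[setU/set0]_(k < K | S k) cell k.
have mU : measurable U by apply: bigsetU_measurable.
have BU : B `<=` (`]-oo, x 0%N]%classic `|` `]x K, +oo[%classic) `|` U.
  move=> y By; have [y0|y0] := leP y (x 0%N); first by left; left; rewrite /= in_itv.
  have [yK|yK] := leP y (x K); last by left; right; rewrite /= in_itv/= yK.
  right; have [k kK Hk] := grid_locate y0 yK.
  rewrite /U (bigD1 (Ordinal kK)); last by apply/asboolP; exists y.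
  by left.
apply: (@le_trans _ _ (t%:E + t%:E + mu U)%E).
  apply: (@le_trans _ _ (mu ((`]-oo, x 0%N]%classic `|` `]x K, +oo[%classic) `|` U))).
    apply: le_measure; rewrite ?inE//; apply: measurableU => //.
    by apply: measurableU.
  apply: (le_trans (measureU2 _ _ _)) => //; first exact: measurableU.
  apply: leeD => //; apply: (le_trans (measureU2 _ _ _)) => //; exact: leeD.
have muU : (mu U <= nu U + (K%:R * del)%:E)%E.
  rewrite /U !measure_bigsetU_ord//; try exact: trivIset_cell.
  apply: (@le_trans _ _ (\sum_(k < K | S k) (nu (cell k) + del%:E))%E).
    by apply: lee_sum => k _; apply: ck.
  rewrite big_split/=; apply: leeD => //; rewrite sumEFin lee_fin.
  apply: (@le_trans _ _ (\sum_(k < K) del)).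
    rewrite [leRHS](bigID S)/= lerDl; exact: sumr_ge0.
  by rewrite sumr_const card_ord mulr_natl.
have Unb : U `<=` eps_nbhd B e.
  rewrite /U; elim/big_ind: _ => [//|A A' HA HA'|k /asboolP[y By]]; first by rewrite subUset.
  rewrite /= in_itv/= => /andP[y1 y2] z; rewrite /= in_itv/= => /andP[z1 z2].
  exists y => //; apply: le_lt_trans (x_gap k); rewrite ler_norml; apply/andP; split; lra.
apply: (le_trans (leeD (lexx _) muU)).
apply: (@le_trans _ _ (t%:E + t%:E + (nu (eps_nbhd B e) + (K%:R * del)%:E))%E).
  apply: leeD => //; apply: leeD => //; apply: le_measure; rewrite ?inE//.
  exact: measurable_eps_nbhd.
rewrite addeCA; apply: leeD => //; rewrite -!EFinD lee_fin; apply: le_trans te.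
by rewrite -mulr2n -(mulr_natl t).
Qed.

Lemma cell_cdf mu F a b : mu setT = 1%E -> (forall z, mu `]-oo, z]%classic = (F z)%:E) ->
  a <= b -> mu `]a, b]%classic = (F b - F a)%:E.
Proof.
move=> mu1 muF ab.
have -> : `]a, b]%classic = `]-oo, b]%classic `\` `]-oo, a]%classic :> set R.
  apply/seteqP; split => y /=; rewrite !in_itv/=.
    by move=> /andP[ay ->]; split => //; apply/negP; rewrite -ltNge.
  by move=> [-> /negP]; rewrite -ltNge => ->.
have fb : (mu `]-oo, b]%classic < +oo)%E by rewrite muF ltry.
rewrite measureD// setIidr; first by rewrite EFinB -!muF.
by move=> y /=; rewrite !in_itv/= => /le_trans; apply.
Qed.

Lemma tail_cdf mu F a : mu setT = 1%E -> (forall z, mu `]-oo, z]%classic = (F z)%:E) ->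
  mu `]a, +oo[%classic = (1 - F a)%:E.
Proof.
move=> mu1 muF.
have -> : `]a, +oo[%classic = setT `\` `]-oo, a]%classic :> set R.
  apply/seteqP; split => y /=; rewrite !in_itv/= andbT.
    by move=> ay; split => //; apply/negP; rewrite -ltNge.
  by move=> [_ /negP]; rewrite -ltNge.
have f1 : (mu setT < +oo)%E by rewrite mu1 ltry.
rewrite measureD//.
by rewrite setTI EFinB -muF; congr (_ - _)%E; apply: mu1.
Qed.

(** A cell mass is a difference of two values of the distribution function, hence the error
    [2 * del]; the tails of [nu] may exceed [t] by one more [del]. *)
Lemma levy_prokhorov_cdf mu nu F G (t del : R) : 0 < e -> 0 <= del ->
  mu setT = 1%E -> nu setT = 1%E ->
  (forall z, mu `]-oo, z]%classic = (F z)%:E) ->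
  (forall z, nu `]-oo, z]%classic = (G z)%:E) ->
  F (x 0%N) <= t -> 1 - t <= F (x K) ->
  (forall k, (k <= K)%N -> `|F (x k) - G (x k)| <= del) ->
  2 * (t + del) + K%:R * (2 * del) <= e -> levy_prokhorov nu mu <= e.
Proof.
move=> e0 del0 mu1 nu1 muF nuG F0 FK FG te.
have FG' k : (k <= K)%N -> F (x k) - del <= G (x k) <= F (x k) + del.
  by move=> /FG; rewrite ler_distlC.
have del2 : 0 <= 2 * del by rewrite mulr_ge0.
rewrite /levy_prokhorov; apply: ge_inf; first by exists 0 => z [/ltW].
have /andP[a1 a2] := FG' _ (leq0n K); have /andP[b1 b2] := FG' _ (leqnn K).
have cc k : mu (cell k) = (F (x k.+1) - F (x k))%:E.
  by apply: cell_cdf => //; apply: ltW.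
have cc' k : nu (cell k) = (G (x k.+1) - G (x k))%:E.
  by apply: cell_cdf => //; apply: ltW.
split => // B mB; split.
  apply: (prokhorov_half del2 _ _ _ te mB).
  - by rewrite nuG lee_fin; lra.
  - by rewrite (tail_cdf _ nu1 nuG) lee_fin; lra.
  - move=> k; rewrite cc cc' lee_fin.
    by have /andP[? ?] := FG' _ (ltnW (ltn_ord k)); have /andP[? ?] := FG' _ (ltn_ord k); lra.
apply: (prokhorov_half del2 _ _ _ te mB).
- by rewrite muF lee_fin; lra.
- by rewrite (tail_cdf _ mu1 muF) lee_fin; lra.
- move=> k; rewrite cc cc' lee_fin.
  by have /andP[? ?] := FG' _ (ltnW (ltn_ord k)); have /andP[? ?] := FG' _ (ltn_ord k); lra.
Qed.

End grid.

Lemma esd_cdf n (A : 'M[R]_n) z : A^T = A ->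
  esd A `]-oo, z]%classic = (lin_stat A (fun y => (y <= z)%R%:R))%:E.
Proof.
move=> sA; rewrite /esd /= /mscale /= /msum /= /lin_stat EFinM; congr (_ * _)%E.
rewrite (big_nth 0) size_eigenvalues// big_mkord -sumEFin.
apply: eq_bigr => k _; rewrite diracE; congr (_%:E); congr (_%:R); congr nat_of_bool.
by rewrite mem_setE in_itv.
Qed.

(* Replaces the choice of continuity points of the limiting distribution function. *)
Lemma small_increment F (a b del : R) : nondecreasing F -> (forall z, 0 <= F z <= 1) ->
  a < b -> 0 < del -> exists y h, [/\ a < y < b, 0 < h & F (y + h) - F (y - h) <= del].
Proof.
move=> nF F01 ab del0; pose M := (Num.bound del^-1).+1.
have M0 : 0 < M%:R :> R by rewrite ltr0n.
have Md : 1 < M%:R * del.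
  rewrite -ltr_pdivrMr// div1r; apply: lt_le_trans (_ : (Num.bound del^-1)%:R <= _).
    by apply: archi_boundP; rewrite invr_ge0 ltW.
  by rewrite ler_nat.
pose p (k : nat) := a + (b - a) * (k%:R / M%:R).
have pS k : p k.+1 = p k + (b - a) / M%:R by rewrite /p -natr1; field; rewrite gt_eqF.
have s0 : 0 < (b - a) / M%:R by rewrite divr_gt0// subr_gt0.
apply: contrapT => H.
(* Pigeonhole: were there no such point, each of the [M] intervals would carry at least [del], and
   [M * del > 1]. *)
have inc k : (k < M)%N -> del <= F (p k.+1) - F (p k).
  move=> kM; rewrite leNgt; apply/negP => Hk; apply: H.
  pose h := (b - a) / M%:R / 2; have h0 : 0 < h by rewrite divr_gt0.
  exists (p k + h), h.
  have -> : p k + h + h = p k.+1 by rewrite pS -addrA -splitr.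
  rewrite addrK; split => //; last exact: ltW.
  have pa : a <= p k by rewrite lerDl mulr_ge0// ?subr_ge0 ?(ltW ab)// divr_ge0.
  have pb : p k.+1 <= b.
    rewrite -[leRHS](subrKC a) lerD2l -[leRHS]mulr1 ler_wpM2l ?subr_ge0 ?(ltW ab)//.
    by rewrite ler_pdivrMr// mul1r ler_nat.
  move: pb; rewrite pS (splitr (_ / M%:R)) -/h => pb; apply/andP; split; lra.
have tel : \sum_(k < M) (F (p k.+1) - F (p k)) = F (p M) - F (p 0%N).
  by rewrite -(big_mkord xpredT (fun k => F (p k.+1) - F (p k))) telescope_sumr.
have : M%:R * del <= F (p M) - F (p 0%N).
  rewrite -tel mulr_natl -[X in _ *+ X](card_ord M) -sumr_const.
  by apply: ler_sum => k _; apply: inc.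
by have /andP[] := F01 (p M); have /andP[] := F01 (p 0%N); lra.
Qed.

End prokhorov_distance.

(** * Convergence of the empirical spectral distribution *)

Section convergence.
Context {R : realType}.
Variables (tau sigma : R).
Hypotheses (tau2 : 2 < tau) (sigma0 : 0 < sigma) (sigma1 : sigma < tau - 1).

Lemma limit_mean_sum K (f : nat -> R -> R) (l : nat -> R) :
  (forall k, limit tau sigma (f k) (l k)) ->
  forall d (alpha : R) e, (0 < d)%N -> 0 < alpha -> alpha < d%:R -> 0 < e ->
  exists N0, forall N, (N0 <= N)%N -> forall disp (T : measurableType disp)
    (P : probability T R) (W : vertex d N -> {RV P >-> R}) (adj : T -> rel (vertex d N)),
  kernel_random_graph tau alpha sigma W adj ->
  code_mean P adj (fun w0 =>
    \sum_(k < K) `|lin_stat (gmat (scaling d N alpha) w0) (f k) - l k|) <= e.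
Proof.
move=> fl d alpha e d0 alpha0 alphad; elim: K e => [|K IH] e e0.
  exists 0%N => N _ disp T P W adj model; rewrite -(code_mean_cst e model).
  by apply: code_mean_mono => w0; rewrite big_ord0 ltW.
have e2 : 0 < e / 2 by rewrite divr_gt0.
have [N1 K1] := IH _ e2; have [N2 K2] := fl K _ e2 _ _ d0 alpha0 alphad.
exists (maxn N1 N2) => N; rewrite geq_max => /andP[NN1 NN2] disp T P W adj model.
rewrite (splitr e).
apply: le_trans (lerD (K1 _ NN1 _ _ _ _ _ model) (K2 _ NN2 _ _ _ _ _ model)).
rewrite /model_mean -code_meanD; apply: code_mean_mono => w0.
by rewrite big_ord_recr.
Qed.

Hypothesis model_exists : realizable tau sigma.
Local Notation F := (limit_cdf tau sigma).

Let Fmono : nondecreasing F := limit_cdf_nondecreasing tau2 sigma0 sigma1 model_exists.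

Let F01 z : 0 <= F z <= 1.
Proof. by rewrite limit_cdf_ge0// limit_cdf_le1. Qed.

Lemma limit_cdf_tails (t : R) : 0 < t -> exists a, F (- a) <= t /\ 1 - t <= F a.
Proof.
move=> t0.
have /cvgrPdist_le/(_ _ t0)[A [_ HA]] := limit_cdf_Ny tau2 sigma0 sigma1 model_exists.
have /cvgrPdist_le/(_ _ t0)[B [_ HB]] := limit_cdf_y tau2 sigma0 sigma1 model_exists.
exists (Num.max (- A) B + 1); split.
  have := HA (- (Num.max (- A) B + 1)); rewrite sub0r normrN.
  case/andP: (F01 (- (Num.max (- A) B + 1))) => u _; rewrite ger0_norm//; apply.
  by rewrite ltrNl; apply: le_lt_trans (_ : Num.max (- A) B < _); rewrite ?le_max ?lexx// ltrDl.
have := HB (Num.max (- A) B + 1).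
case/andP: (F01 (Num.max (- A) B + 1)) => _ u; rewrite ger0_norm ?subr_ge0// => H.
rewrite lerBlDr -lerBlDl; apply: H.
by apply: le_lt_trans (_ : Num.max (- A) B < _); rewrite ?le_max ?lexx ?orbT// ltrDl.
Qed.

(** One point with a small increment of [F] around it is picked in each successive interval of
    length [e / 2], so neighbours are less than [e] apart. *)
Lemma continuity_grid (e : R) : 0 < e -> exists (x h : nat -> R) K del,
  [/\ (forall k, x k < x k.+1) /\ (forall k, x k.+1 - x k < e), 0 < del,
      forall k, 0 < h k /\ F (x k + h k) - F (x k - h k) <= del,
      F (x 0%N) <= e / 4 /\ 1 - e / 4 <= F (x K) &
      2 * (e / 4 + 2 * del) + K%:R * (2 * (2 * del)) <= e].
Proof.
move=> e0; have e4 : 0 < e / 4 by rewrite divr_gt0.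
have s0 : 0 < e / 2 by rewrite divr_gt0.
have [a [Fa1 Fa2]] := limit_cdf_tails e4.
(* [K] steps of length [e / 2] lead from [- a - e] beyond [a]; [del] makes
   [e / 2 + 4 * (K + 1) * del] equal to [e]. *)
pose K := Num.bound ((`|a| + a + e) / (e / 2)); pose del := e / (8 * K.+1%:R).
have del0 : 0 < del by rewrite divr_gt0// mulr_gt0.
pose p (k : nat) := - a - e + k%:R * (e / 2).
have pS k : p k.+1 = p k + e / 2 by rewrite /p -natr1; ring.
have H k : exists yh : R * R, [/\ p k < yh.1 < p k.+1, 0 < yh.2 &
    F (yh.1 + yh.2) - F (yh.1 - yh.2) <= del].
  have pk : p k < p k.+1 by rewrite pS ltrDl.
  by have [y [h Hy]] := small_increment Fmono F01 pk del0; exists (y, h).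
have [yh Hyh] := choice H.
exists (fun k => (yh k).1), (fun k => (yh k).2), K, del; split => //.
- by split=> k; have [/andP[a1 a2] _ _] := Hyh k; have [/andP[b1 b2] _ _] := Hyh k.+1;
    move: a1 a2 b1 b2; rewrite !pS; lra.
- by move=> k; have [] := Hyh k.
- split.
    have [/andP[a1 a2] _ _] := Hyh 0%N; apply: le_trans (Fmono _) Fa1.
    by move: a2; rewrite /p; lra.
  have [/andP[a1 a2] _ _] := Hyh K; apply: (le_trans Fa2); apply: Fmono.
  have : (`|a| + a + e) / (e / 2) < K%:R.
    apply: archi_boundP; rewrite divr_ge0 ?(ltW s0)// addr_ge0 ?(ltW e0)//.
    by have := ler_norm (- a); rewrite normrN -subr_ge0 opprK.
  rewrite ltr_pdivrMr// => Ka; have := ler_norm a; move: a1; rewrite /p.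
  by move: (K%:R * (e / 2)) Ka => u; lra.
rewrite (_ : _ + _ = e / 2 + (4 * (K%:R + 1)) * del); last by field.
rewrite natr1 /del le_eqVlt; apply/orP; left; apply/eqP.
by move: (K.+1%:R) (ltr0Sn R K) => v v0; field; rewrite gt_eqF.
Qed.

(** The spectral distribution function at [x i] lies between two ramp statistics; the limit of the
    lower one is at least [F (x i - h i)], that of the upper one at most [F (x i + h i)]. The
    increment of [F] and the error of the statistics are at most [del] each, whence [2 * del]. A
    single sum measures closeness, ready for one use of Markov's inequality. *)
Lemma spectral_distance_small (mu : probability (measurableTypeR R) R) (e : R) :
  (forall z, mu `]-oo, z]%classic = (F z)%:E) -> 0 < e ->
  exists K (f g : nat -> R -> R) (l k : nat -> R) del,
  [/\ 0 < del, forall i, limit tau sigma (f i) (l i), forall i, limit tau sigma (g i) (k i) &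
  forall n (A : 'M[R]_n), A^T = A -> (0 < n)%N ->
  \sum_(i < K) `|lin_stat A (f i) - l i| + \sum_(i < K) `|lin_stat A (g i) - k i| <= del ->
  levy_prokhorov (esd A) mu <= e].
Proof.
move=> muF e0; have [x [h [K [del [[x_lt x_gap] del0 hF [F0 FK] small]]]]] := continuity_grid e0.
have h0 i : 0 < h i by case: (hF i).
have h20 i : 0 < h i / 2 by rewrite divr_gt0.
have rl a w : 0 < w -> exists l, limit tau sigma (ramp a w) l by apply: ramp_limit.
have [l Hl] := choice (fun i => rl (x i - h i / 2) _ (h20 i)).
have [k Hk] := choice (fun i => rl (x i) _ (h0 i)).
exists K.+1, (fun i => ramp (x i - h i / 2) (h i / 2)), (fun i => ramp (x i) (h i)), l, k, del.
split => // n A sA n0 close.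
pose G z := lin_stat A (fun y => (y <= z)%R%:R).
have nuG z : esd A `]-oo, z]%classic = (G z)%:E by apply: esd_cdf.
apply: (levy_prokhorov_cdf x_lt x_gap e0 (_ : 0 <= 2 * del)
  (@probability_setT _ _ _ mu) (esdT A n0) muF nuG F0 FK _ small).
  by rewrite mulr_ge0// ltW.
move=> i iK; pose j : 'I_K.+1 := Ordinal (iK : (i < K.+1)%N).
have s1 : 0 <= \sum_(i < K.+1) `|lin_stat A (ramp (x i - h i / 2) (h i / 2)) - l i| by apply: sumr_ge0.
have s2 : 0 <= \sum_(i < K.+1) `|lin_stat A (ramp (x i) (h i)) - k i| by apply: sumr_ge0.
have c1 : `|lin_stat A (ramp (x i - h i / 2) (h i / 2)) - l i| <= del.
  apply: le_trans close; rewrite (bigD1 j)//= -addrA lerDl addr_ge0//; exact: sumr_ge0.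
have c2 : `|lin_stat A (ramp (x i) (h i)) - k i| <= del.
  apply: le_trans close; rewrite [X in _ <= _ + X](bigD1 j)//= addrCA lerDl addr_ge0//; exact: sumr_ge0.
have G1 : lin_stat A (ramp (x i - h i / 2) (h i / 2)) <= G (x i).
  apply: lin_stat_le => y; have [_|xy] := leP y (x i); first exact: ramp_le1.
  by rewrite ramp_eq0// subrK ltW.
have G2 : G (x i) <= lin_stat A (ramp (x i) (h i)).
  apply: lin_stat_le => y; have [yx|_] := leP y (x i); last exact: ramp_ge0.
  by rewrite ramp_eq1.
have F1 : F (x i - h i) <= l i.
  by apply: limit_cdf_le (Hl i) => //; have := h0 i; lra.
have F2 : k i <= F (x i + h i) by apply: limit_ramp_le (Hk i).
have m1 : F (x i - h i) <= F (x i) by apply: Fmono; rewrite gerBl ltW.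
have m2 : F (x i) <= F (x i + h i) by apply: Fmono; rewrite lerDl ltW.
have [_ inc] := hF i.
move: c1 c2; rewrite !ler_distlC => /andP[c1 c1'] /andP[c2 c2'].
apply/andP; split; lra.
Qed.

End convergence.

(** [mu] comes before [d] and [alpha], in accordance with its being indexed by [sigma] and [tau]
    alone. *)
Theorem theorem2p1 (R : realType) (tau sigma : R)
    (htau : 2 < tau) (hsigma0 : 0 < sigma) (hsigma1 : sigma < tau - 1) :
  exists mu : probability (measurableTypeR R) R,
  forall (d : nat) (alpha : R),
    (1 <= d)%N -> 0 < alpha -> alpha < d%:R ->
  forall (disp : nat -> measure_display)
    (T : forall N : nat, measurableType (disp N))
    (P : forall N : nat, probability (T N) R)
    (W : forall N : nat, vertex d N -> {RV (P N) >-> R})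
    (adj : forall N : nat, T N -> rel (vertex d N)),
    (forall N : nat, kernel_random_graph tau alpha sigma (W N) (@adj N)) ->
  cvg_in_probability P
    (fun (N : nat) (w : T N) => esd (scaled_adjacency alpha (adj N w))) mu.
Proof.
have [ex|nex] := pselect (realizable tau sigma); last first.
  (* No sequence of models exists in this case, so any probability measure will do. *)
  exists (\d_(0 : measurableTypeR R) : probability _ R).
  move=> d alpha d0 alpha0 alphad disp T P W adj model; exfalso; apply: nex.
  exists d, alpha; split => // N0; exists N0 => //.
  by exists (disp N0), (T N0), (P N0), (W N0), (adj N0).
have [mu muF] := probability_of_cdf (limit_cdf_nondecreasing htau hsigma0 hsigma1 ex)
  (limit_cdf_right_continuous htau hsigma0 hsigma1 ex)
  (limit_cdf_Ny htau hsigma0 hsigma1 ex) (limit_cdf_y htau hsigma0 hsigma1 ex).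
exists mu => d alpha d0 alpha0 alphad disp T P W adj model e e0.
have [K [f [g [l [k [del [del0 Hf Hg near]]]]]]] :=
  spectral_distance_small htau hsigma0 hsigma1 ex muF e0.
pose c N : R := scaling d N alpha.
(* The event depends on the graph alone, so its probability is a finite sum of code masses. *)
pose Q N w0 := `[< e < levy_prokhorov (esd (gmat (c N) w0 : 'M[R]_#|{: vertex d N}|)) mu >].
pose r N : R := \sum_(w0 | Q N w0) code_mass (P N) (adj N) w0.
have PE N : P N [set w | e < levy_prokhorov (esd (scaled_adjacency alpha (adj N w))) mu] = (r N)%:E.
  have [_ <-] := code_event (model N) (Q N); congr (P N _).
  by apply/seteqP; split => w; rewrite /= /Q (code_gmat (model N)) => /asboolP.
rewrite (_ : (fun N => _) = (fun N => (r N)%:E)); last by apply/funext => N; rewrite PE.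
apply/cvg_EFin; first by apply: nearW => N.
apply/cvgrPdist_le => e' e'0.
have b0 : 0 < del * e' / 2 by rewrite divr_gt0// mulr_gt0.
have [N1 K1] := limit_mean_sum K Hf d0 alpha0 alphad b0.
have [N2 K2] := limit_mean_sum K Hg d0 alpha0 alphad b0.
exists (maxn 1 (maxn N1 N2)) => // N /=; rewrite !geq_max => /and3P[N0 NN1 NN2].
have r0 : 0 <= r N by apply: sumr_ge0 => w0 _; apply: code_mass_ge0.
rewrite sub0r normrN ger0_norm//.
pose Z w0 := \sum_(i < K) `|lin_stat (gmat (c N) w0 : 'M[R]_#|{: vertex d N}|) (f i) - l i| +
  \sum_(i < K) `|lin_stat (gmat (c N) w0 : 'M[R]_#|{: vertex d N}|) (g i) - k i|.
have Z0 w0 : 0 <= Z w0 by rewrite addr_ge0// sumr_ge0.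
have n0 : (0 < #|{: vertex d N}|)%N by rewrite card_vertex expn_gt0 N0.
apply: (@le_trans _ _ (code_mean (P N) (adj N) Z / del)); last first.
  rewrite ler_pdivrMr// mulrC (splitr (del * e')) code_meanD.
  exact: lerD (K1 _ NN1 _ _ _ _ _ (model N)) (K2 _ NN2 _ _ _ _ _ (model N)).
(* Markov's inequality for [Z]: by [near], a code with [Z <= del] has distance at most [e]. *)
apply: le_trans (code_markov _ _ Z0 del0).
rewrite /r [leLHS]big_mkcond [leRHS]big_mkcond/=; apply: ler_sum => w0 _.
case: ifPn => [/asboolP Qw|_]; last by case: ifP => _ //; apply: code_mass_ge0.
have [//|Zd] := leP del (Z w0); exfalso; move: Qw; apply/negP; rewrite -leNgt.
by apply: near => //; [apply: gmat_sym|apply: ltW].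
Qed.
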